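(* The Word Problem of the algebra $\mathbb Z[1/2]\rtimes\mathbb Z$ with swapping is decidable in time $O(n^4)$, where $n$ is the input length.
   Context: Time is measured on a random-access machine (RAM). $\mathbb Z[1/2]$ is the ring of rational numbers whose denominators are powers of $2$. The semi-direct product $\mathbb Z[1/2]\rtimes\mathbb Z$ is the group of pairs $(r,m)\in\mathbb Z[1/2]\times\mathbb Z$ with multiplication $(r,m)\cdot(s,n)=(r+2^m s,\,m+n)$; it is generated by $(1,0)$ and $(0,1)$. It is equipped with the partially defined unary swap operation: for $(r,m)\in\mathbb Z\times\mathbb Z$ (i.e. when $r\in\mathbb Z$), $\mathrm{swap}(r,m)=(m,r)$; swap is undefined when $r\notin\mathbb Z$. The Word Problem is: given an expression of length $n$ built from the generators $(1,0)$, $(0,1)$ and their inverses using the group multiplication and the swap operation, decide whether it is defined and evaluates to the identity element $(0,0)$. *)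

(* Defs.v *)
From HB Require Import structures.
From mathcomp Require Import all_boot all_order all_algebra.

Set Implicit Arguments.
Unset Strict Implicit.
Unset Printing Implicit Defensive.

Import Order.TTheory GRing.Theory Num.Theory.

Section Dyadic.
Local Open Scope ring_scope.

Definition is_dyadic : pred rat := fun r => 2%N.-nat `|denq r|%N.

Lemma is_dyadicP (r : rat) :
  reflect (exists k (n : int), r = n%:~R / 2%:R ^+ k) (is_dyadic r).
Proof.
apply: (iffP idP) => [/p_natP[k dr]|[k [n def_r]]].
  exists k, (numq r); rewrite -[LHS]divq_num_den; congr (_ / _).
  by rewrite -absz_denq dr -pmulrn natrX.
have pos2k : (0 < 2 ^ k)%N by rewrite expn_gt0.
apply: (@pnat_dvd _ (2 ^ k)); last by rewrite pnatX pnat_id.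
have: n%:~R / (2 ^ k)%N%:Z%:~R = r by rewrite def_r -pmulrn natrX.
case def_d: _ _ / (divqP n (2 ^ k)%N) => [|c x _].
  by case: (2 ^ k)%N def_d pos2k.
move=> <-; have ->: (2 ^ k)%N = `|(c * denq x)%R|%N by rewrite -def_d.
by rewrite abszM dvdn_mull.
Qed.

Fact is_dyadic_subring : subring_closed is_dyadic.
Proof.
have n0 k : 2%:R ^+ k != 0 :> rat by rewrite expf_neq0.
split=> [|x y|x y]; first by apply/is_dyadicP; exists 0%N, 1; rewrite divr1.
  move=> /is_dyadicP[k [m ->]] /is_dyadicP[l [n ->]]; apply/is_dyadicP.
  exists (k + l)%N, (m * 2 ^+ l - n * 2 ^+ k).
  rewrite exprD rmorphB !rmorphM !rmorphXn /=.
  by rewrite -[in LHS]mulNr addf_div // mulNr.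
move=> /is_dyadicP[k [m ->]] /is_dyadicP[l [n ->]]; apply/is_dyadicP.
by exists (k + l)%N, (m * n); rewrite exprD rmorphM /= mulf_div.
Qed.

HB.instance Definition _ :=
  GRing.isSubringClosed.Build rat is_dyadic is_dyadic_subring.

Definition dyadic : Type := {r : rat | is_dyadic r}.

HB.instance Definition _ := SubType.on dyadic.
HB.instance Definition _ := [Choice of dyadic by <:].
HB.instance Definition _ := [SubChoice_isSubComNzRing of dyadic by <:].

Fact exp2_subproof (m : int) (r : dyadic) : is_dyadic (2%:R ^ m * val r).
Proof.
rewrite -[is_dyadic _]/(_ \in is_dyadic) rpredM //; last exact: (valP r).
apply/is_dyadicP; case: m => m.
  by exists 0%N, (2 ^+ m); rewrite divr1 rmorphXn.
by exists m.+1, 1; rewrite mul1r NegzE -exprnN.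
Qed.

Definition exp2_mul (m : int) (r : dyadic) : dyadic :=
  Sub (2%:R ^ m * val r) (exp2_subproof m r).

End Dyadic.

(** Z[1/2] ><| Z, kept as an alias so that it does not pick up the
    direct-product structure of pairs. *)
Definition ZhalfZ : Type := (dyadic * int)%type.

HB.instance Definition _ := Choice.on ZhalfZ.

Section SemidirectProduct.
Local Open Scope ring_scope.

Definition sd_mul (x y : ZhalfZ) : ZhalfZ :=
  (x.1 + exp2_mul x.2 y.1, x.2 + y.2).
Definition sd_one : ZhalfZ := (0, 0).
Definition sd_inv (x : ZhalfZ) : ZhalfZ := (exp2_mul (- x.2) (- x.1), - x.2).

Fact exp2_mulD m : {morph exp2_mul m : r s / r + s}.
Proof. by move=> r s; apply: val_inj; rewrite /= mulrDr. Qed.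
Fact exp2_mulA m n r : exp2_mul m (exp2_mul n r) = exp2_mul (m + n) r.
Proof. by apply: val_inj; rewrite /= mulrA -expfzDr. Qed.
Fact exp2_mul0 r : exp2_mul 0 r = r.
Proof. by apply: val_inj; rewrite /= expr0z mul1r. Qed.

Fact sd_mulA : associative sd_mul.
Proof.
move=> [r m] [s n] [t p]; rewrite /sd_mul /=.
by rewrite exp2_mulD exp2_mulA !addrA.
Qed.
Fact sd_mul1 : left_id sd_one sd_mul.
Proof. by move=> [r m]; rewrite /sd_mul /= exp2_mul0 !add0r. Qed.
Fact sd_mulr1 : right_id sd_one sd_mul.
Proof.
move=> [r m]; rewrite /sd_mul /= addr0; congr pair.
by apply: val_inj; rewrite /= mulr0 addr0.
Qed.
Fact sd_mulV : left_inverse sd_one sd_inv sd_mul.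
Proof.
move=> [r m]; rewrite /sd_mul /= -exp2_mulD addNr addrC subrr; congr pair.
by apply: val_inj; rewrite /= mulr0.
Qed.
Fact sd_mulrV : right_inverse sd_one sd_inv sd_mul.
Proof.
by move=> [r m]; rewrite /sd_mul /= exp2_mulA subrr exp2_mul0 subrr.
Qed.

End SemidirectProduct.

HB.instance Definition _ :=
  isGroup.Build ZhalfZ sd_mulA sd_mul1 sd_mulr1 sd_mulV sd_mulrV.

Section Swap.
Local Open Scope ring_scope.

Definition gen_a : ZhalfZ := (1, 0).
Definition gen_t : ZhalfZ := (0, 1).

(** The swap is undefined ([None]) off Z x Z. *)
Definition swap (x : ZhalfZ) : option ZhalfZ :=
  if val x.1 \is a Num.int then Some (x.2%:~R, numq (val x.1)) else None.

End Swap.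

Inductive expr : Type :=
| EA     (* (1,0) *)
| EAinv  (* (1,0)^-1 *)
| ET     (* (0,1) *)
| ETinv  (* (0,1)^-1 *)
| EMul of expr & expr
| ESwap of expr.

Fixpoint eval (e : expr) : option ZhalfZ :=
  match e with
  | EA => Some gen_a
  | EAinv => Some (gen_a^-1)%g
  | ET => Some gen_t
  | ETinv => Some (gen_t^-1)%g
  | EMul e1 e2 =>
      if (eval e1, eval e2) is (Some x, Some y) then Some (x * y)%g else None
  | ESwap e1 => obind swap (eval e1)
  end.

Definition word_problem (e : expr) : Prop := eval e = Some 1%g.

(** An expression is given in Polish (prefix) notation as a word over a
    six-letter alphabet; its length is the number of symbols occurring in it. *)
Fixpoint encode (e : expr) : seq nat :=
  match e with
  | EA => [:: 0]
  | EAinv => [:: 1]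
  | ET => [:: 2]
  | ETinv => [:: 3]
  | EMul e1 e2 => 4 :: encode e1 ++ encode e2
  | ESwap e1 => 5 :: encode e1
  end.

(** A RAM has registers, addressed by constants of the program, and a memory
    of cells addressed indirectly through registers; both hold natural numbers.
    Subtraction is truncated and division by zero gives zero. *)
Inductive instr : Type :=
| IConst (d c : nat)    (* reg[d] := c *)
| IAdd (d a b : nat)    (* reg[d] := reg[a] + reg[b] *)
| ISub (d a b : nat)
| IMul (d a b : nat)
| IDiv (d a b : nat)
| ILoad (d a : nat)     (* reg[d] := mem[reg[a]] *)
| IStore (a b : nat)    (* mem[reg[a]] := reg[b] *)
| IJump (l : nat)
| IJumpz (a l : nat)    (* jump to l if reg[a] = 0 *)
| IHalt (b : bool).     (* stop and accept ([true]) or reject ([false]) *)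

Definition program := seq instr.

Record config := Config { pc : nat; reg : nat -> nat; mem : nat -> nat }.

Definition upd (f : nat -> nat) (i v : nat) : nat -> nat :=
  fun j => if j == i then v else f j.

Definition exec (i : instr) (c : config) : config :=
  let: Config p r m := c in
  match i with
  | IConst d k => Config p.+1 (upd r d k) m
  | IAdd d a b => Config p.+1 (upd r d (r a + r b)) m
  | ISub d a b => Config p.+1 (upd r d (r a - r b)) m
  | IMul d a b => Config p.+1 (upd r d (r a * r b)) m
  | IDiv d a b => Config p.+1 (upd r d (r a %/ r b)) m
  | ILoad d a => Config p.+1 (upd r d (m (r a))) m
  | IStore a b => Config p.+1 r (upd m (r a) (r b))
  | IJump l => Config l r m
  | IJumpz a l => Config (if r a == 0 then l else p.+1) r m
  | IHalt _ => c
  end.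

(** A machine whose program counter has left the program is stuck: it never
    halts. *)
Definition step (P : program) (c : config) : config :=
  if onth P (pc c) is Some i then exec i c else c.

Definition run (P : program) (t : nat) (c : config) : config :=
  iter t (step P) c.

Definition halted (P : program) (c : config) : option bool :=
  if onth P (pc c) is Some (IHalt b) then Some b else None.

(** The input w is stored in mem[0..size w - 1] and its length in reg[0];
    everything else is zero. *)
Definition init (w : seq nat) : config :=
  Config 0 (fun i => if i == 0 then size w else 0) (nth 0 w).

Definition word_bounded (B : nat) (c : config) : Prop :=
  forall i, reg c i < B /\ mem c i < B.

(** Each instruction costs one unit of time.  As usual for this cost measure,
    machine words have O(log n) bits on inputs of length n: during the
    computation every register and memory cell stays below (n+1)^k, for some k
    depending only on the program. *)
Definition decidable_in_time (X : Type) (enc : X -> seq nat) (L : X -> Prop)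
    (T : nat -> nat) : Prop :=
  exists (P : program) (k : nat), forall x : X,
    let n := size (enc x) in
    exists (t : nat) (b : bool),
      [/\ t <= T n,
          halted P (run P t (init (enc x))) = Some b,
          b <-> L x
        & forall s, s <= t ->
            word_bounded (n.+1 ^ k) (run P s (init (enc x)))].

Definition is_bigO (f g : nat -> nat) : Prop :=
  exists C N : nat, forall n, N <= n -> f n <= C * g n.

(* Main.v *)
Require Import Defs.
From mathcomp Require Import all_boot all_order all_algebra.
From mathcomp Require Import zify.

Set Implicit Arguments.
Unset Strict Implicit.
Unset Printing Implicit Defensive.

Import Order.TTheory GRing.Theory Num.Theory.

(** Swapping turns a power of two into an exponent, so the components of the
    value of an expression with n symbols can be towers of exponentials and
    cannot be written in binary.  They are however sums of few signed powers of
    two: the two components (r, m) of a value are represented by lists of terms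
    2 ^ a or - 2 ^ a.  A generator has one term; a product
    (r, m)(s, k) = (r + 2 ^ m s, m + k) concatenates lists, after m has been
    added to each exponent of s; the swap exchanges the lists.  Equal or
    opposite terms are kept apart, so no carry ever propagates and a list has
    at most as many terms as the expression has symbols.

    The exponents a are again unbounded integers, represented in the same way:
    a term refers to a node v of a global table, and v carries a list of terms
    with nonnegative exponents, whose sum is the exponent of v.  Adding m to the
    exponents of s creates one node per term of s (shift_node, scale_spec), its
    list being the merge of the list of the old node with that of m.  There are
    at most n new nodes per product, and n ^ 2 in all.

    The nodes are kept sorted by exponent, and each has a compressed
    coordinate, of size polynomial in n: the difference of two coordinates and
    that of the two exponents coincide when capped at K = M ^ 2, where
    M = 8 (n + 1).  Since 2 ^ K exceeds the bound B = M ^ 8 on the numbers in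
    use, coordinates determine 2 ^ (a - b) up to saturation at B.  This is
    enough to add up, in time O(n), a list of terms sorted by decreasing
    exponent by Horner's rule: a running sum that has reached B in absolute
    value cannot be cancelled by the O(n) terms which remain, each of them at most
    the current unit (sat, sat_add, horner_spec).  Hence the sign of a sum, and
    its absolute value up to K, are computed exactly (sat_min).  Applied to the
    merge of a list with the opposite of another, this compares exponents
    (compare_spec).

    A new node is therefore inserted with O(n) comparisons: M steps of length M
    and M steps of length 1 find its rank among at most M ^ 2 nodes
    (search_spec); the capped distances to its two neighbours yield its own
    coordinate and the amount by which to move the coordinates above it
    (ins_coords, insert_spec).  An insertion takes time O(n ^ 2), a product
    inserts n nodes, and there are n products: O(n ^ 4) in total.

    The swap needs to know whether a sum is an integer.  The terms with negative
    exponents are added by increasing exponent, and the partial sum, in units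
    of the current power of two, must be divisible by the ratio to the next
    power (divide_step, carry_spec).  The final quotient is at most the number
    of terms consumed, so these are replaced by as many copies of 1 or - 1 and
    the list does not grow (swap_spec).  It then has only nonnegative
    exponents, as required of the second component of a value, the one that is
    added to exponents.

    The algorithm is written in a language whose only loop is repetition
    exactly M times, and whose numbers are clipped to B.  The nesting depth of
    the loops, here 4, bounds the cost of a program (cost_weight), and the
    language compiles to the machine (cmd_reach, language_decides). *)

(** * A bounded loop language *)

(** Len is the length n of the input, Cap the number M of turns of a loop, and
    Inp reads a letter of the input.  Arrays have two indices. *)
Inductive iexp : Type :=
| Var of nat
| Cst of nat
| Len
| Cap
| Plus of iexp & iexp
| Minus of iexp & iexp
| Times of iexp & iexp
| Quo of iexp & iexp
| Get (a : nat) (i j : iexp)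
| Inp of iexp.

Inductive cmd : Type :=
| Skip
| Asgn (x : nat) (e : iexp)
| Put (a : nat) (i j e : iexp)
| Seq of cmd & cmd
| If (e : iexp) (c1 c2 : cmd)
| Rep of cmd.

Record store := Store { rg : nat -> nat; ar : nat -> nat -> nat -> nat }.

Definition setr (s : store) x v : store :=
  Store (fun y => if y == x then v else rg s y) (ar s).
Definition seta (s : store) a i j v : store :=
  Store (rg s) (fun a' => if a' == a
    then fun i' j' => if (i' == i) && (j' == j) then v else ar s a' i' j'
    else ar s a').

Section Language.

Variables (w : seq nat) (M B : nat).
Let n := size w.

Definition clip x := minn x B.

(** Clipping sums and products keeps all values at most B.  Positions beyond
    the input are mapped to the last letter, so that every read stays inside
    the input. *)
Fixpoint ev (s : store) (e : iexp) : nat :=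
  match e with
  | Var x => rg s x
  | Cst c => c
  | Len => n
  | Cap => M
  | Plus a b => clip (ev s a + ev s b)
  | Minus a b => ev s a - ev s b
  | Times a b => clip (ev s a * ev s b)
  | Quo a b => ev s a %/ ev s b
  | Get a i j => ar s a (ev s i) (ev s j)
  | Inp i => nth 0 w (minn (ev s i) n.-1)
  end.

Fixpoint denote (c : cmd) (s : store) : store :=
  match c with
  | Skip => s
  | Asgn x e => setr s x (ev s e)
  | Put a i j e => seta s a (ev s i) (ev s j) (ev s e)
  | Seq c1 c2 => denote c2 (denote c1 s)
  | If e c1 c2 => if ev s e == 0 then denote c2 s else denote c1 s
  | Rep c => iter M (denote c) s
  end.

Lemma rep_inv (I : nat -> store -> Prop) c s :
  I 0 s -> (forall k t, k < M -> I k t -> I k.+1 (denote c t)) ->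
  I M (denote (Rep c) s).
Proof.
move=> I0 IS /=; have: M <= M by []; elim: {-2}M => [|k IHk] //= ltkM.
by apply: IS => //; apply: IHk; apply: ltnW.
Qed.

Fixpoint wvar (c : cmd) : seq nat :=
  match c with
  | Asgn x _ => [:: x]
  | Seq a b | If _ a b => wvar a ++ wvar b
  | Rep a => wvar a
  | _ => [::]
  end.
Fixpoint warr (c : cmd) : seq nat :=
  match c with
  | Put a _ _ _ => [:: a]
  | Seq a b | If _ a b => warr a ++ warr b
  | Rep a => warr a
  | _ => [::]
  end.

(** Together with the next lemma, the frame rule: a program only changes the
    registers and arrays that occur in its text as targets. *)
Lemma sem_rg c s x : x \notin wvar c -> rg (denote c s) x = rg s x.
Proof.
elim: c s => //= [y e|c1 IH1 c2 IH2|e c1 IH1 c2 IH2|c IHc] s.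
- by rewrite inE => /negPf->.
- by rewrite mem_cat negb_or => /andP[? ?]; rewrite IH2 ?IH1.
- by rewrite mem_cat negb_or => /andP[? ?]; case: ifP; rewrite ?IH2 ?IH1.
by move=> xNc; elim: M => //= k <-; rewrite IHc.
Qed.

Lemma sem_ar c s a : a \notin warr c -> ar (denote c s) a = ar s a.
Proof.
elim: c s => //= [y i j e|c1 IH1 c2 IH2|e c1 IH1 c2 IH2|c IHc] s.
- by rewrite inE => /negPf->.
- by rewrite mem_cat negb_or => /andP[? ?]; rewrite IH2 ?IH1.
- by rewrite mem_cat negb_or => /andP[? ?]; case: ifP; rewrite ?IH2 ?IH1.
by move=> xNc; elim: M => //= k <-; rewrite IHc.
Qed.

(** * Compilation to the RAM *)

(** Registers 0 to 6 hold the constants described by layout below.  The others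
    are shared according to their residue modulo 3 between variables, loop
    counters (one per nesting level) and temporaries (one per level of an
    expression). *)
Definition rV x := 3 * x + 7.
Definition rL d := 3 * d + 8.
Definition rT d := 3 * d + 9.

(** The eight arrays are interleaved above the input, and each row has room for
    the indices 0 to B. *)
Definition addr a i j := n + ((i * B.+1 + j) * 8 + a).

(** x - (x - B) is the minimum of x and B, subtraction being truncated. *)
Definition clip_code d :=
  [:: ISub (rT d.+1) (rT d) 2; ISub (rT d) (rT d) (rT d.+1)].
Definition addr_code d a :=
  [:: IMul (rT d) (rT d) 3; IAdd (rT d) (rT d) (rT d.+1);
      IMul (rT d) (rT d) 4; IConst (rT d.+1) a;
      IAdd (rT d) (rT d) (rT d.+1); IAdd (rT d) 0 (rT d)].

(** The value ends up in temporary d; temporaries below d are preserved. *)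
Fixpoint cexp (d : nat) (e : iexp) : program :=
  match e with
  | Var x => [:: IAdd (rT d) (rV x) 6]
  | Cst c => [:: IConst (rT d) c]
  | Len => [:: IAdd (rT d) 0 6]
  | Cap => [:: IAdd (rT d) 1 6]
  | Plus a b => cexp d a ++ cexp d.+1 b ++
      IAdd (rT d) (rT d) (rT d.+1) :: clip_code d
  | Minus a b => cexp d a ++ cexp d.+1 b ++ [:: ISub (rT d) (rT d) (rT d.+1)]
  | Times a b => cexp d a ++ cexp d.+1 b ++
      IMul (rT d) (rT d) (rT d.+1) :: clip_code d
  | Quo a b => cexp d a ++ cexp d.+1 b ++ [:: IDiv (rT d) (rT d) (rT d.+1)]
  | Get a i j => cexp d i ++ cexp d.+1 j ++
      addr_code d a ++ [:: ILoad (rT d) (rT d)]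
  | Inp i => cexp d i ++
      [:: ISub (rT d.+1) 0 5; ISub (rT d.+1) (rT d) (rT d.+1);
          ISub (rT d) (rT d) (rT d.+1); ILoad (rT d) (rT d)]
  end.

Fixpoint csize (c : cmd) : nat :=
  match c with
  | Skip => 0
  | Asgn _ e => (size (cexp 0 e)).+1
  | Put a i j e => size (cexp 0 i) + size (cexp 1 j) + size (cexp 2 e) + 7
  | Seq c1 c2 => csize c1 + csize c2
  | If e c1 c2 => size (cexp 0 e) + (csize c1 + csize c2).+2
  | Rep c => (csize c).+4
  end.

Fixpoint ccmd (p d : nat) (c : cmd) : program :=
  match c with
  | Skip => [::]
  | Asgn x e => cexp 0 e ++ [:: IAdd (rV x) (rT 0) 6]
  | Put a i j e => cexp 0 i ++ cexp 1 j ++ cexp 2 e ++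
      addr_code 0 a ++ [:: IStore (rT 0) (rT 2)]
  | Seq c1 c2 => ccmd p d c1 ++ ccmd (p + csize c1) d c2
  | If e c1 c2 =>
      let p1 := p + size (cexp 0 e) in
      let p2 := p1 + (csize c1).+2 in
      cexp 0 e ++ IJumpz (rT 0) p2 :: ccmd p1.+1 d c1 ++
      IJump (p2 + csize c2) :: ccmd p2 d c2
  | Rep c =>
      IAdd (rL d) 1 6 :: IJumpz (rL d) (p + (csize c).+4) ::
      ccmd p.+2 d.+1 c ++ [:: ISub (rL d) (rL d) 5; IJump p.+1]
  end.

Lemma size_ccmd p d c : size (ccmd p d c) = csize c.
Proof.
elim: c p d => //= [x e|a i j e|c1 IH1 c2 IH2|e c1 IH1 c2 IH2|c IH] p d;
  rewrite ?size_cat /= ?size_cat /= ?IH ?IH1 ?IH2 ?addnS ?addn0 ?addnA ?size_cat //=.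
all: lia.
Qed.

(** Both branches of a conditional are charged, so that the cost depends on M
    alone and not on the data. *)
Fixpoint cost (c : cmd) : nat :=
  match c with
  | Skip => 0
  | Asgn _ e => (size (cexp 0 e)).+1
  | Put a i j e => size (cexp 0 i) + size (cexp 1 j) + size (cexp 2 e) + 7
  | Seq c1 c2 => cost c1 + cost c2
  | If e c1 c2 => size (cexp 0 e) + (cost c1 + cost c2).+2
  | Rep c => (M * (cost c).+3).+2
  end.

Fixpoint depth (c : cmd) : nat :=
  match c with
  | Seq a b | If _ a b => maxn (depth a) (depth b)
  | Rep a => (depth a).+1
  | _ => 0
  end.
(** The coefficient in the bound on the cost by a power of M: each turn of a
    loop has three steps of overhead, and the loop itself two. *)
Fixpoint weight (c : cmd) : nat :=
  match c with
  | Skip => 0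
  | Asgn _ e => (size (cexp 0 e)).+1
  | Put a i j e => size (cexp 0 i) + size (cexp 1 j) + size (cexp 2 e) + 7
  | Seq c1 c2 => weight c1 + weight c2
  | If e c1 c2 => size (cexp 0 e) + (weight c1 + weight c2).+2
  | Rep c => weight c + 5
  end.

Lemma cost_weight c : 0 < M -> cost c <= weight c * M ^ depth c.
Proof.
move=> M_gt0; have Mp k : 0 < M ^ k by rewrite expn_gt0 M_gt0.
elim: c => //= [x e|a i j e|c1 IH1 c2 IH2|e c1 IH1 c2 IH2|c IH].
- by rewrite expn0 muln1.
- by rewrite expn0 muln1.
- rewrite mulnDl leq_add //.
    by rewrite (leq_trans IH1) // leq_mul // leq_pexp2l // leq_maxl.
  by rewrite (leq_trans IH2) // leq_mul // leq_pexp2l // leq_maxr.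
- rewrite mulnDl leq_add ?leq_pmulr // -addn2 -[X in _ <= X * _]addn2.
  rewrite mulnDl leq_add ?leq_pmulr // mulnDl leq_add //.
    by rewrite (leq_trans IH1) // leq_mul // leq_pexp2l // leq_maxl.
  by rewrite (leq_trans IH2) // leq_mul // leq_pexp2l // leq_maxr.
rewrite expnS mulnCA -addn2.
apply: (@leq_trans (M * (weight c * M ^ depth c + 3) + M * 2)); last first.
  by rewrite -mulnDr leq_mul // -addnA mulnDl leq_add2l leq_pmulr.
by rewrite leq_add ?leq_pmull // leq_mul // -addn3 leq_add2r.
Qed.

(** Constants up to 8 and arrays numbered below 8, so that constants respect the
    bound B and addresses of different arrays do not clash. *)
Fixpoint eok (e : iexp) : bool :=
  match e with
  | Cst c => c <= 8
  | Plus a b | Minus a b | Times a b | Quo a b => eok a && eok b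
  | Get a i j => [&& a < 8, eok i & eok j]
  | Inp i => eok i
  | _ => true
  end.
Fixpoint cok (c : cmd) : bool :=
  match c with
  | Skip => true
  | Asgn _ e => eok e
  | Put a i j e => [&& a < 8, eok i, eok j & eok e]
  | Seq c1 c2 => cok c1 && cok c2
  | If e c1 c2 => [&& eok e, cok c1 & cok c2]
  | Rep c => cok c
  end.

Definition sbound (s : store) :=
  (forall x, rg s x <= B) /\ (forall a i j, ar s a i j <= B).

Hypotheses (B8 : 8 <= B) (n_gt0 : 0 < n) (nB : n <= B) (MB : M <= B).
Hypothesis (wB : forall i, nth 0 w i <= B).

Lemma ev_bound s e : sbound s -> eok e -> ev s e <= B.
Proof.
case=> [sr sa]; elim: e => //= [c c8|a _ b _ _|a IHa b IHb|a _ b _ _|a IHa b IHb].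
- exact: leq_trans B8.
- exact: geq_minr.
- by case/andP=> /IHa aB _; apply: leq_trans (leq_subr _ _) aB.
- exact: geq_minr.
by case/andP=> /IHa aB _; apply: leq_trans (leq_div _ _) aB.
Qed.

Lemma sem_bound c s : sbound s -> cok c -> sbound (denote c s).
Proof.
elim: c s => //= [x e|a i j e|c1 IH1 c2 IH2|e c1 IH1 c2 IH2|c IH] s sB.
- move=> eB; split=> [y|]; last by case: sB.
  by rewrite /=; case: ifP => _; [apply: ev_bound | case: sB].
- case/and4P=> _ _ _ eB; split=> [|b k l]; first by case: sB.
  rewrite /=; case: eqP => _; last by case: sB.
  by case: ifP => _; [apply: ev_bound | case: sB].
- by case/andP=> c1B c2B; apply: IH2 => //; apply: IH1.
- by case/and3P=> _ c1B c2B; case: ifP => _; [apply: IH2 | apply: IH1].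
by move=> cB; elim: M => //= k ?; apply: IH.
Qed.

(** * Correctness of the compiled code *)

Variable P : program.
Variable W : nat.
Hypothesis W_ge : B.+1 ^ 2 * 16 <= W.

Fixpoint code_at p (C : program) : Prop :=
  if C is i :: C' then onth P p = Some i /\ code_at p.+1 C' else True.

Lemma code_at_cat p C1 C2 :
  code_at p (C1 ++ C2) <-> code_at p C1 /\ code_at (p + size C1) C2.
Proof.
elim: C1 p => [|i C1 IH] p /=; first by rewrite addn0; tauto.
by rewrite IH addSnnS; tauto.
Qed.

(** Total correctness with a time bound.  The bound W on the words is demanded
    all along the run, since it has to hold at every step of the machine. *)
Definition reach t c (Q : config -> Prop) : Prop :=
  exists t', [/\ t' <= t, Q (run P t' c)
    & forall u, u <= t' -> word_bounded W (run P u c)].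

Lemma reach_stop t c (Q : config -> Prop) : word_bounded W c -> Q c -> reach t c Q.
Proof. by move=> cW Qc; exists 0; split=> // [[]]. Qed.

Lemma reach_mono t1 t2 c Q : t1 <= t2 -> reach t1 c Q -> reach t2 c Q.
Proof. by move=> le [u [leu Qu b]]; exists u; split=> //; apply: leq_trans le. Qed.

Lemma reach_seq t1 t2 c (Q1 Q : config -> Prop) :
  reach t1 c Q1 -> (forall c1, Q1 c1 -> reach t2 c1 Q) -> reach (t1 + t2) c Q.
Proof.
case=> u1 [le1 /[swap] b1 /[swap] /[apply]] [u2 [le2 Qc b2]].
exists (u2 + u1); split; first by rewrite addnC leq_add.
  by rewrite /run iterD.
move=> u le_u; have [|/ltnW le_u1] := leqP u u1; first exact: b1.
by rewrite -(subnK le_u1) /run iterD; apply: b2; rewrite leq_subLR addnC.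
Qed.

Lemma reach_step p r m i t (Q : config -> Prop) :
  onth P p = Some i -> word_bounded W (Config p r m) ->
  reach t (exec i (Config p r m)) Q -> reach t.+1 (Config p r m) Q.
Proof.
move=> Pi cW rQ; rewrite -add1n; set c := Config p r m in cW rQ *.
apply: (reach_seq (Q1 := eq (exec i c))); last by move=> _ <-.
exists 1; split=> //; first by rewrite /= /step Pi.
case=> [|[|]] // _; rewrite /= /step Pi.
by case: rQ => u [_ _ /(_ 0)]; apply.
Qed.

Lemma wb_reg p r m p' d v : word_bounded W (Config p r m) -> v < W ->
  word_bounded W (Config p' (upd r d v) m).
Proof.
by move=> b vW i; have [/= ri mi] := b i; rewrite /upd; split=> //=; case: ifP.
Qed.

Lemma wb_mem p r m p' a v : word_bounded W (Config p r m) -> v < W ->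
  word_bounded W (Config p' r (upd m a v)).
Proof.
by move=> b vW i; have [/= ri mi] := b i; rewrite /upd; split=> //=; case: ifP.
Qed.

Lemma upd_eq f i v : upd f i v i = v.
Proof. by rewrite /upd eqxx. Qed.

Lemma upd_ne f i v j : (j == i) = false -> upd f i v j = f j.
Proof. by rewrite /upd => ->. Qed.

Definition layout (r : nat -> nat) :=
  [/\ r 0 = n, r 1 = M, r 2 = B, r 3 = B.+1 & [/\ r 4 = 8, r 5 = 1 & r 6 = 0]].

(** Only the cells that programs can address are related; indices never exceed B
    because values are clipped. *)
Definition sim (s : store) (r m : nat -> nat) :=
  [/\ layout r, forall x, r (rV x) = rg s x,
      forall a i j, a < 8 -> i <= B -> j <= B -> m (addr a i j) = ar s a i j
    & forall i, i < n -> m i = nth 0 w i].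

(** The temporaries of level d and above, which are the registers from rT d on
    with residue 0, are free to change. *)
Definition same_regs d (r r' : nat -> nat) :=
  forall x, (x %% 3 != 0) || (x < rT d) -> r' x = r x.

Lemma sim_same s d r r' m : same_regs d r r' -> sim s r m -> sim s r' m.
Proof.
move=> e [[r0 r1 r2 r3 [r4 r5 r6]] hV rA rI].
have e' x : x < 9 -> r' x = r x.
  by move=> x9; apply: e; apply/orP; right; apply: leq_trans x9 _; rewrite /rT; lia.
split=> // [|x]; first by split; rewrite ?e' //; split; rewrite ?e'.
by rewrite e ?hV //; apply/orP; left; rewrite /rV; lia.
Qed.

Lemma same_upd d d' r v : d <= d' -> same_regs d r (upd r (rT d') v).
Proof.
by move=> le x xP; rewrite /upd; case: (x =P _) xP => // ->; rewrite /rT; lia.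
Qed.

Lemma same_trans d d' r r' r'' :
  d <= d' -> same_regs d r r' -> same_regs d' r' r'' -> same_regs d r r''.
Proof.
move=> le e e' x xP; rewrite e' ?e //.
by case/orP: xP => [->//|lt]; apply/orP; right; rewrite /rT in lt *; lia.
Qed.

Lemma addr_lt a i j : a < 8 -> i <= B -> j <= B -> addr a i j < W.
Proof.
move=> a8 iB jB; apply: leq_trans W_ge; rewrite /addr.
have: i * B.+1 <= B * B.+1 by rewrite leq_mul.
nia.
Qed.

Lemma lt_mulW x y : x <= B -> y <= B.+1 -> x * y < W.
Proof.
move=> xB yB; apply: leq_trans W_ge.
have: x * y <= B * B.+1 by rewrite leq_mul.
nia.
Qed.

Lemma leB_W x : x <= B -> x < W.
Proof. by move=> xB; apply: leq_trans W_ge; nia. Qed.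

Lemma clip_reach p d r m (Q : config -> Prop) t :
  code_at p (clip_code d) -> word_bounded W (Config p r m) ->
  r 2 = B ->
  (forall r', same_regs d r r' -> r' (rT d) = clip (r (rT d)) ->
     word_bounded W (Config p.+2 r' m) -> reach t (Config p.+2 r' m) Q) ->
  reach t.+2 (Config p r m) Q.
Proof.
move=> [p0 [p1 _]] wb r2 H.
have b1 : word_bounded W (Config p.+1 (upd r (rT d.+1) (r (rT d) - r 2)) m).
  by refine (wb_reg _ _ wb _); apply: leq_ltn_trans (leq_subr _ _) _; have [] := wb (rT d).
apply: (reach_step p0) => //=; apply: (reach_step p1) => //=.
apply: H.
- by apply: same_trans (leqnn d) (same_upd _ _ (leqnSn d)) (same_upd _ _ _).
- by rewrite /upd !eqxx /clip r2 ifF; [lia | rewrite /rT; lia].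
refine (wb_reg _ _ b1 _); apply: leq_ltn_trans (leq_subr _ _) _.
by have [] := b1 (rT d).
Qed.

Lemma addr_reach p d a r m (Q : config -> Prop) t :
  code_at p (addr_code d a) -> word_bounded W (Config p r m) -> layout r ->
  a < 8 -> r (rT d) <= B -> r (rT d.+1) <= B ->
  (forall r', (forall x, x != rT d -> x != rT d.+1 -> r' x = r x) ->
     r' (rT d) = addr a (r (rT d)) (r (rT d.+1)) ->
     word_bounded W (Config (p + 6) r' m) -> reach t (Config (p + 6) r' m) Q) ->
  reach (6 + t) (Config p r m) Q.
Proof.
move=> [p0 [p1 [p2 [p3 [p4 [p5 _]]]]]] wb [r0 _ _ r3 [r4 _ _]] a8 iB jB H.
have neT : (rT d.+1 == rT d) = false by rewrite /rT; lia.
have neT' : (rT d == rT d.+1) = false by rewrite eq_sym.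
have ne x : x < 9 -> ((x == rT d) = false) * ((x == rT d.+1) = false).
  by rewrite /rT; split; lia.
have aW := addr_lt a8 iB jB; rewrite /addr in aW.
do 6![apply: reach_step; first eassumption; first eassumption; rewrite /=;
   match goal with |- reach _ (Config ?p ?r ?m) _ =>
     have wb' : word_bounded W (Config p r m);
     [refine (wb_reg _ _ wb _); rewrite /upd ?eqxx ?neT ?neT' ?ne //= ?r0 ?r3 ?r4; nia
     |clear wb; rename wb' into wb] end].
rewrite !addnS addn0 in H; apply: H => //.
  by move=> x /negPf x1 /negPf x2; rewrite /upd x1 x2.
by rewrite /upd ?eqxx ?neT ?neT' ?ne //= ?r0 ?r3 ?r4.
Qed.

(** Stated in continuation style, so that successive pieces of code compose by
    plain application, with the time t of what follows. *)
Definition exp_spec s m e := forall d p r (Q : config -> Prop) t,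
  sim s r m -> eok e -> code_at p (cexp d e) -> word_bounded W (Config p r m) ->
  (forall r', same_regs d r r' -> r' (rT d) = ev s e ->
     word_bounded W (Config (p + size (cexp d e)) r' m) ->
     reach t (Config (p + size (cexp d e)) r' m) Q) ->
  reach (size (cexp d e) + t) (Config p r m) Q.

Lemma two_reach s m a b d p r C (Q : config -> Prop) t :
  exp_spec s m a -> exp_spec s m b -> sbound s ->
  sim s r m -> eok a && eok b -> code_at p (cexp d a ++ cexp d.+1 b ++ C) ->
  word_bounded W (Config p r m) ->
  (forall p' r', same_regs d r r' -> layout r' ->
     r' (rT d) = ev s a -> r' (rT d.+1) = ev s b -> ev s a <= B -> ev s b <= B ->
     code_at p' C -> p' + size C = p + size (cexp d a ++ cexp d.+1 b ++ C) ->
     word_bounded W (Config p' r' m) -> reach (size C + t) (Config p' r' m) Q) ->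
  reach (size (cexp d a ++ cexp d.+1 b ++ C) + t) (Config p r m) Q.
Proof.
move=> Ha Hb sB rs /andP[aB bB] /code_at_cat[pa /code_at_cat[pb pC]] wb H.
rewrite !size_cat -!addnA in H *; apply: Ha => // r1 s1 e1 wb1.
apply: Hb => //; first exact: sim_same s1 rs.
move=> r2 s2 e2 wb2; apply: H => //.
- exact: same_trans s2.
- by case: (sim_same s2 (sim_same s1 rs)).
- by rewrite s2 //; apply/orP; right; rewrite /rT; lia.
- exact: ev_bound.
- exact: ev_bound.
by rewrite !addnA.
Qed.

Lemma load_reach d p i r m v (Q : config -> Prop) t :
  code_at p [:: i] -> word_bounded W (Config p r m) ->
  exec i (Config p r m) = Config p.+1 (upd r (rT d) v) m -> v <= B ->
  (forall r', same_regs d r r' -> r' (rT d) = v ->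
     word_bounded W (Config (p + 1) r' m) -> reach t (Config (p + 1) r' m) Q) ->
  reach (1 + t) (Config p r m) Q.
Proof.
move=> [p0 _] wb ei vB H; rewrite addn1 in H; apply: (reach_step p0) => //; rewrite ei.
apply: H; [exact: same_upd | exact: upd_eq | ].
by refine (wb_reg _ _ wb _); apply: leB_W.
Qed.

Lemma exp_reach s m e : sbound s -> exp_spec s m e.
Proof.
move=> sB; elim: e => /=
  [x|c|||a IHa b IHb|a IHa b IHb|a IHa b IHb|a IHa b IHb|a i IHi j IHj|i IHi]
  d p r Q t rs; have [[n0 n1 _ _ [_ _ n6]] rVx _ _] := rs.
- move=> _ c wb; apply: (load_reach c wb); last by apply: ev_bound.
  by rewrite /= n6 addn0 rVx.
- by move=> c8 i wb; apply: (load_reach i wb); last exact: leq_trans c8 B8.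
- by move=> _ i wb; apply: (load_reach i wb); rewrite /= ?n6 ?n0 ?addn0.
- by move=> _ i wb; apply: (load_reach i wb); rewrite /= ?n6 ?n1 ?addn0.
- move=> ok ca wb H; apply: (two_reach IHa IHb sB rs ok ca wb).
  move=> p1 r1 s1 lr1 e1 e2 aB bB [p0 pC] ep wb1.
  have [_ _ r2 _ _] := lr1.
  apply: (reach_step p0) => //=; rewrite e1 e2; apply: (clip_reach pC).
  + by refine (wb_reg _ _ wb1 _); apply: leq_trans W_ge; nia.
  + by rewrite /upd ifF // /rT; lia.
  move=> r3 s3 e3 wb3; rewrite -[p1.+3]addn3 ep in wb3 *; apply: H => //.
  + apply: (same_trans (leqnn d) s1).
    exact: (same_trans (leqnn d) (same_upd _ _ (leqnn d)) s3).
  + by rewrite e3 /upd eqxx.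
- move=> ok ca wb H; apply: (two_reach IHa IHb sB rs ok ca wb).
  move=> p1 r1 s1 lr1 e1 e2 aB bB [p0 pC] ep wb1.
  apply: (reach_step p0) => //=; rewrite e1 e2 -addn1 ep; apply: H.
  + exact: (same_trans (leqnn d) s1 (same_upd _ _ (leqnn d))).
  + by rewrite /upd eqxx.
  refine (wb_reg _ _ wb1 _); apply: leB_W; exact: leq_trans (leq_subr _ _) aB.
- move=> ok ca wb H; apply: (two_reach IHa IHb sB rs ok ca wb).
  move=> p1 r1 s1 lr1 e1 e2 aB bB [p0 pC] ep wb1.
  have [_ _ r2 _ _] := lr1.
  apply: (reach_step p0) => //=; rewrite e1 e2; apply: (clip_reach pC).
  + by refine (wb_reg _ _ wb1 _); apply: lt_mulW => //; apply: leqW.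
  + by rewrite /upd ifF // /rT; lia.
  move=> r3 s3 e3 wb3; rewrite -[p1.+3]addn3 ep in wb3 *; apply: H => //.
  + apply: (same_trans (leqnn d) s1).
    exact: (same_trans (leqnn d) (same_upd _ _ (leqnn d)) s3).
  + by rewrite e3 /upd eqxx.
- move=> ok ca wb H; apply: (two_reach IHa IHb sB rs ok ca wb).
  move=> p1 r1 s1 lr1 e1 e2 aB bB [p0 pC] ep wb1.
  apply: (reach_step p0) => //=; rewrite e1 e2 -addn1 ep; apply: H.
  + exact: (same_trans (leqnn d) s1 (same_upd _ _ (leqnn d))).
  + by rewrite /upd eqxx.
  refine (wb_reg _ _ wb1 _); apply: leB_W; exact: leq_trans (leq_div _ _) aB.
- case/andP=> a8 ok ca wb H; apply: (two_reach IHi IHj sB rs ok ca wb).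
  move=> p1 r1 s1 lr1 e1 e2 iB jB /(@code_at_cat _ (addr_code d a))[pA [p0 _]] ep wb1.
  rewrite -[X in reach X](addnA 6 1).
  apply: (addr_reach pA wb1 lr1 a8); rewrite ?e1 ?e2 // => r2 s2 e3 wb2.
  apply: (reach_step p0) => //=; rewrite -addnS ep.
  have [_ _ /(_ a _ _ a8 iB jB) mA _] := rs.
  rewrite e3 mA; apply: H.
  + apply: (same_trans (leqnn d) s1) => x xP; rewrite /upd.
    have [xd xd1] : (x == rT d) = false /\ (x == rT d.+1) = false.
      by case/orP: xP; rewrite /rT; split; lia.
    by rewrite xd s2 ?xd ?xd1.
  + by rewrite /upd eqxx.
  by refine (wb_reg _ _ wb2 _); apply: leB_W; case: sB.
move=> ok /code_at_cat[ci [p0 [p1 [p2 [p3 _]]]]] wb H.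
rewrite size_cat -addnA in H *; apply: IHi => // r1 s1 e1 wb1.
have sim1 := sim_same s1 rs; have [[r0 _ _ _ [_ r5 _]] _ _ mI] := sim1.
have iB := @ev_bound s i sB ok.
have neT : (rT d.+1 == rT d) = false by rewrite /rT; lia.
have neT' : (rT d == rT d.+1) = false by rewrite eq_sym.
apply: (reach_step p0) => //=; rewrite r0 r5.
have wb2 : word_bounded W (Config (p + size (cexp d i)).+1 (upd r1 (rT d.+1) (n - 1)) m).
  by refine (wb_reg _ _ wb1 _); apply: leB_W; lia.
apply: (reach_step p1) => //=; rewrite upd_eq upd_ne ?neT' // e1.
have wb3 : word_bounded W (Config (p + size (cexp d i)).+2
    (upd (upd r1 (rT d.+1) (n - 1)) (rT d.+1) (ev s i - (n - 1))) m).
  by refine (wb_reg _ _ wb2 _); apply: leB_W; apply: leq_trans (leq_subr _ _) iB.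
apply: (reach_step p2) => //=; rewrite upd_eq !upd_ne ?neT' // e1.
have wb4 : word_bounded W (Config (p + size (cexp d i)).+3
    (upd (upd (upd r1 (rT d.+1) (n - 1)) (rT d.+1) (ev s i - (n - 1)))
       (rT d) (ev s i - (ev s i - (n - 1)))) m).
  by refine (wb_reg _ _ wb3 _); apply: leB_W; apply: leq_trans (leq_subr _ _) iB.
apply: (reach_step p3) => //=; rewrite upd_eq.
have -> : m (ev s i - (ev s i - (n - 1))) = nth 0 w (minn (ev s i) n.-1).
  have -> : ev s i - (ev s i - (n - 1)) = minn (ev s i) n.-1.
    by move: (ev s i) n => x k; rewrite subn1; have [/eqP->|le] := leqP x k.-1; rewrite ?subn0 ?subKn // ltnW.
  by apply: mI; apply: leq_ltn_trans (geq_minr _ _) _; rewrite ltn_predL.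
rewrite /= !(addnS, addn0) in H; apply: H.
- apply: (same_trans (leqnn d) s1) => x xP.
  have [xd xd1] : (x == rT d) = false /\ (x == rT d.+1) = false.
    by case/orP: xP; rewrite /rT; split; lia.
  by rewrite !upd_ne.
- by rewrite upd_eq.
by refine (wb_reg _ _ wb4 _); apply: leB_W.
Qed.

Lemma addr_inj a i j a' i' j' : a < 8 -> a' < 8 -> j <= B -> j' <= B ->
  addr a i j = addr a' i' j' -> [/\ a = a', i = i' & j = j'].
Proof.
move=> a8 a'8 jB j'B /addnI e.
have ea : a = a' by move: (congr1 (modn^~ 8) e); rewrite !modnMDl !modn_small.
have {}e : i * B.+1 + j = i' * B.+1 + j' by lia.
have ej : j = j' by move: (congr1 (modn^~ B.+1) e); rewrite !modnMDl !modn_small.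
by split=> //; move: e; rewrite ej => /addIn /eqP; rewrite eqn_pmul2r // => /eqP.
Qed.

Lemma sim_setr s r m x v : sim s r m -> sim (setr s x v) (upd r (rV x) v) m.
Proof.
case=> [[r0 r1 r2 r3 [r4 r5 r6]] hV rA rI].
have ne y : y < 7 -> (y == rV x) = false by rewrite /rV; lia.
split=> // [|y].
  by do !split; rewrite upd_ne ?ne.
rewrite /upd /=; have -> : (rV y == rV x) = (y == x) by rewrite /rV; lia.
by case: ifP => // _; apply: hV.
Qed.

Lemma sim_seta s r m a i j v : sim s r m -> a < 8 -> i <= B -> j <= B ->
  sim (seta s a i j v) r (upd m (addr a i j) v).
Proof.
case=> [lr hV rA rI] a8 iB jB; split=> // [a' i' j' a'8 i'B j'B|k kn].
  rewrite /upd; case: (addr a' i' j' =P _) => [/addr_inj[]// -> -> ->|ne].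
    by rewrite /= !eqxx.
  rewrite rA //=; case: (a' =P a) => // ea.
  case: (i' =P i) => //= ei; case: (j' =P j) => //= ej.
  by case: ne; rewrite ea ei ej.
by rewrite upd_ne ?rI // /addr; lia.
Qed.

(** A command at nesting depth d preserves the counters of the enclosing loops,
    which are those below d. *)
Definition cmd_spec c := forall d p s r m (Q : config -> Prop) t,
  sim s r m -> sbound s -> cok c -> code_at p (ccmd p d c) ->
  word_bounded W (Config p r m) ->
  (forall r' m', sim (denote c s) r' m' ->
     (forall d', d' < d -> r' (rL d') = r (rL d')) ->
     word_bounded W (Config (p + csize c) r' m') ->
     reach t (Config (p + csize c) r' m') Q) ->
  reach (cost c + t) (Config p r m) Q.

Lemma same_rL d r r' k : same_regs d r r' -> r' (rL k) = r (rL k).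
Proof. by apply; apply/orP; left; rewrite /rL; lia. Qed.

Lemma cmd_reach c : cmd_spec c.
Proof.
elim: c => [|x e|a i j e|c1 IH1 c2 IH2|e c1 IH1 c2 IH2|c IH] d p s r m Q t rs sB /=.
- by move=> _ _ wb; rewrite addn0; apply.
- move=> eB /code_at_cat[ce [p0 _]] wb H; rewrite -addn1 -addnA.
  apply: (exp_reach sB rs eB ce wb) => r1 s1 e1 wb1.
  have sim1 := sim_same s1 rs; have [[_ _ _ _ [_ _ r6]] _ _ _] := sim1.
  apply: (reach_step p0) => //=; rewrite e1 r6 addn0.
  rewrite addnS in H; apply: H.
  + exact: sim_setr.
  + by move=> d' _; rewrite upd_ne ?(same_rL _ s1) // /rL /rV; lia.
  by refine (wb_reg _ _ wb1 _); apply: leB_W; apply: ev_bound.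
- case/and4P=> a8 iB jB eB /code_at_cat[ci /code_at_cat[cj /code_at_cat[ce]]].
  move=> /(@code_at_cat _ (addr_code 0 a))[cA [p0 _]] wb H.
  rewrite -!addnA; apply: (exp_reach sB rs iB ci wb) => r1 s1 e1 wb1.
  have rs1 := sim_same s1 rs.
  apply: (exp_reach sB rs1 jB cj wb1) => r2 s2 e2 wb2.
  have rs2 := sim_same s2 rs1.
  apply: (exp_reach sB rs2 eB ce wb2) => r3 s3 e3 wb3.
  have rs3 := sim_same s3 rs2; have [lr3 _ _ _] := rs3.
  have e1' : r3 (rT 0) = ev s i by rewrite s3 // s2 // s1.
  have e2' : r3 (rT 1) = ev s j by rewrite s3.
  rewrite -[7]/(6 + 1) -addnA; apply: (addr_reach cA wb3 lr3 a8).
  + by rewrite e1'; apply: ev_bound.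
  + by rewrite e2'; apply: ev_bound.
  move=> r4 s4 e4 wb4; apply: (reach_step p0) => //=.
  have s4' : same_regs 0 r3 r4.
    by move=> x xP; apply: s4; case/orP: xP; rewrite /rT; lia.
  rewrite e4 e1' e2' s4 // e3 -!addnS.
  rewrite -!addnA /= in H *; apply: H.
  + by apply: sim_seta; rewrite ?ev_bound //; apply: sim_same s4' rs3.
  + by move=> d' _; rewrite (same_rL _ s4') !(same_rL _ s3, same_rL _ s2, same_rL _ s1).
  by refine (wb_mem _ _ wb4 _); apply: leB_W; apply: ev_bound.
- case/andP=> ok1 ok2 /code_at_cat[ca1 ca2] wb H.
  rewrite -addnA; apply: (IH1 _ _ _ _ _ _ _ rs sB ok1 ca1 wb) => r1 m1 rs1 l1 wb1.
  rewrite size_ccmd in ca2.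
  apply: (IH2 _ _ _ _ _ _ _ rs1 (sem_bound sB ok1) ok2 ca2 wb1).
  move=> r2 m2 rs2 l2 wb2; rewrite -addnA in wb2 *; apply: H => // d' ltd.
  by rewrite l2 ?l1.
- case/and3P=> eB ok1 ok2 /code_at_cat[ce [p0]] /=.
  rewrite -cat_rcons => /code_at_cat[]; rewrite -cats1 => /code_at_cat[ca1 [p1 _]] ca2.
  move=> wb H; rewrite -addnA; apply: (exp_reach sB rs eB ce wb) => r1 s1 e1 wb1.
  have rs1 := sim_same s1 rs.
  rewrite !addSn; apply: (reach_step p0) => //=; rewrite e1.
  rewrite size_cat size_ccmd /= addn1 in ca2.
  have ep : p + size (cexp 0 e) + (csize c1).+2 = (p + size (cexp 0 e)).+1 + (csize c1).+1.
    by rewrite addSnnS.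
  case: (ifP (ev s e == 0)) => e0; rewrite e0 in H.
    apply: (@reach_mono (cost c2 + t)); first lia.
    rewrite -ep in ca2.
    apply: (IH2 _ _ _ _ _ _ _ rs1 sB ok2 ca2 wb1) => r2 m2 rs2 l2 wb2.
    have -> : p + size (cexp 0 e) + (csize c1).+2 + csize c2
              = p + (size (cexp 0 e) + (csize c1 + csize c2).+2) by lia.
    by apply: H => // d' ltd; rewrite l2 // (same_rL _ s1).
  apply: (@reach_mono (cost c1 + t.+1)); first lia.
  apply: (IH1 _ _ _ _ _ _ _ rs1 sB ok1 ca1 wb1) => r2 m2 rs2 l2 wb2.
  rewrite size_ccmd in p1; apply: (reach_step p1) => //=.
  have -> : p + size (cexp 0 e) + (csize c1).+2 + csize c2
            = p + (size (cexp 0 e) + (csize c1 + csize c2).+2) by lia.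
  by apply: H => // d' ltd; rewrite l2 // (same_rL _ s1).
move=> okc [p0 [p1 /code_at_cat[cc [p2 [p3 _]]]]] wb H.
rewrite size_ccmd in p2 p3.
have p1' : onth P p.+1 = Some (IJumpz (rL d) (p + (csize c).+4)) by [].
have [[r0 r1 r2 r3 [r4 r5 r6]] hV rA rI] := rs.
rewrite !addSn; apply: (reach_step p0) => //=; rewrite r1 r6 addn0.
have simL r' m' s' v : sim s' r' m' -> sim s' (upd r' (rL d) v) m'.
  move=> [[? ? ? ? [? ? ?]] hV' ? ?].
  have ne x : x < 7 -> (x == rL d) = false by rewrite /rL; lia.
  split=> //; first by do !split; rewrite upd_ne ?ne.
  by move=> x; rewrite upd_ne // /rV /rL; lia.
have wbL : word_bounded W (Config p.+1 (upd r (rL d) M) m).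
  by refine (wb_reg _ _ wb _); apply: leB_W.
(* the counter runs downwards, so k is the number of turns left *)
have loop k : forall r' m', k <= M -> sim (iter (M - k) (denote c) s) r' m' ->
  r' (rL d) = k -> (forall d', d' < d -> r' (rL d') = r (rL d')) ->
  word_bounded W (Config p.+1 r' m') ->
  reach ((k * (cost c).+3).+1 + t) (Config p.+1 r' m') Q.
  elim: k => [|k IHk] r' m' lekM rs' rk ld wb'.
    rewrite mul0n add1n; apply: (reach_step p1') => //=; rewrite rk /=.
    by apply: H; rewrite ?subn0 // in rs' *.
  rewrite addSn; apply: (reach_step p1') => //=; rewrite rk /=.
  rewrite mulSn -addnA.
  rewrite (_ : (cost c).+3 + _ = cost c + ((k * (cost c).+3).+1 + t).+2); last by lia.
  have sB' : sbound (iter (M - k.+1) (denote c) s).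
    by elim: (M - k.+1) => //= j IHj; apply: sem_bound.
  apply: (IH _ _ _ _ _ _ _ rs' sB' okc cc wb') => r2' m2 rs2 l2 wb2.
  have [[_ _ _ _ [_ r25 _]] _ _ _] := rs2.
  have b2 : r2' (rL d) = k.+1 by rewrite l2.
  apply: (reach_step p2) => //=; rewrite b2 r25 subn1 /=.
  have wb3 : word_bounded W (Config (p.+2 + csize c).+1 (upd r2' (rL d) k) m2).
    by refine (wb_reg _ _ wb2 _); apply: leB_W; lia.
  apply: (reach_step p3) => //=; apply: IHk.
  - exact: ltnW.
  - by apply: simL; move: rs2; rewrite -iterS subnS prednK // subn_gt0.
  - by rewrite upd_eq.
  - by move=> d' ltd; rewrite upd_ne ?l2 ?ld // ?(leqW ltd) // /rL; lia.
  by [].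
apply: loop => //.
- by rewrite subnn; apply: simL.
- by rewrite upd_eq.
by move=> d' ltd; rewrite upd_ne // /rL; lia.
Qed.

End Language.

(** * Deciding a language with a program of loops *)

(** The number of turns is linear in n and exceeds the lengths of all lists that
    are merged; its square exceeds the number of nodes. *)
Definition capof n := 8 * n.+1.
Definition clipof n := capof n ^ 8.
Definition store0 := Store (fun _ => 0) (fun _ _ _ => 0).

(** Registers 1, 2 and 3 receive 8 (n + 1), its eighth power by three
    squarings, and the successor of that. *)
Definition prologue : program :=
  [:: IConst 5 1; IConst 4 8; IAdd 1 0 5; IMul 1 1 4; IMul 2 1 1;
      IMul 2 2 2; IMul 2 2 2; IAdd 3 2 5].

Definition epilogue p x : program :=
  [:: IJumpz (rV x) p.+2; IHalt true; IHalt false].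

Definition compile (c : cmd) (x : nat) : program :=
  prologue ++ ccmd 8 0 c ++ epilogue (8 + csize c) x.

Lemma clip_bound n : 0 < n -> (clipof n).+1 ^ 2 * 16 <= n.+1 ^ 96.
Proof.
move=> n0; have M_le : capof n <= n.+1 ^ 4.
  rewrite /capof (expnS _ 3) mulnC leq_mul //.
  by rewrite (@leq_trans (2 ^ 3)) // leq_exp2r.
have -> : 96 = 4 * 24 by [].
rewrite expnM; apply: (@leq_trans (capof n ^ 24)); last by rewrite leq_exp2r.
have -> : 24 = 8 * 3 by [].
rewrite expnM -/(clipof n).
have: 16 ^ 2 <= clipof n.
  have M16 : 16 <= capof n by rewrite /capof; lia.
  by apply: leq_trans (leq_pexp2l _ (_ : 2 <= 8)); rewrite ?leq_exp2r // (leq_trans _ M16).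
by move: (clipof n) => b; nia.
Qed.

Lemma prologue_run P w M B W t r m (Q : config -> Prop) :
  let n := size w in
  8 * n.+1 = M -> M * M * (M * M) * (M * M * (M * M)) = B ->
  B.+1 ^ 2 * 16 <= W -> code_at P 0 prologue ->
  (forall i, r i = if i == 0 then n else 0) -> (forall i, m i <= 8) ->
  (forall r', layout w M B r' ->
     (forall i, 7 <= i -> r' i = 0) -> word_bounded W (Config 8 r' m) ->
     reach P W t (Config 8 r' m) Q) ->
  reach P W (8 + t) (Config 0 r m) Q.
Proof.
move=> n eM eB WB [p0 [p1 [p2 [p3 [p4 [p5 [p6 [p7 _]]]]]]]] er m8 H.
have M8 : 8 <= M by rewrite -eM leq_pmulr.
have sq x : 0 < x -> x <= x * x by move=> x0; rewrite leq_pmulr.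
have M2 : M <= M * M by apply: sq; lia.
have M4 : M * M <= M * M * (M * M) by apply: sq; lia.
have MB : M * M * (M * M) <= B by rewrite -eB; apply: sq; lia.
have BW x : x <= B.+1 -> x < W by move=> ?; apply: leq_trans WB; nia.
have wb : word_bounded W (Config 0 r m).
  move=> i; split=> /=; apply: BW; last by apply: leq_trans (m8 i) _; lia.
  by rewrite er; case: ifP => // _; lia.
have nM : n.+1 <= M by rewrite -eM; lia.
have r0 : r 0 = n by rewrite er.
have rn k : r k.+1 = 0 by rewrite er.
have set_reg p i r' d v u : onth P p = Some i -> word_bounded W (Config p r' m) ->
    exec i (Config p r' m) = Config p.+1 (upd r' d v) m -> v <= B.+1 ->
    (word_bounded W (Config p.+1 (upd r' d v) m) ->
     reach P W u (Config p.+1 (upd r' d v) m) Q) ->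
    reach P W u.+1 (Config p r' m) Q.
  move=> pi wb' ei vB k; apply: (reach_step pi wb'); rewrite ei; apply: k.
  by refine (wb_reg _ _ wb' _); apply: BW.
apply: (set_reg _ _ _ 5 1 _ p0 wb) => // wb1.
apply: (set_reg _ _ _ 4 8 _ p1 wb1) => // [|wb2]; first lia.
apply: (set_reg _ _ _ 1 n.+1 _ p2 wb2) => [||wb3]; last 1 first.
apply: (set_reg _ _ _ 1 M _ p3 wb3) => [||wb4]; last 1 first.
apply: (set_reg _ _ _ 2 (M * M) _ p4 wb4) => // [|wb5]; first lia.
apply: (set_reg _ _ _ 2 (M * M * (M * M)) _ p5 wb5) => // [|wb6]; first lia.
apply: (set_reg _ _ _ 2 B _ p6 wb6) => [||wb7]; last 1 first.
apply: (set_reg _ _ _ 3 B.+1 _ p7 wb7) => [||wb8]; last 1 first.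
- apply: H => //; first by do !split; rewrite /upd //= ?rn ?er.
  by do 7?[case=> //]; move=> i _; rewrite /upd /= rn.
- by congr (Config _ (upd _ _ _) _); rewrite /upd /= addn1.
- by [].
- by congr (Config _ (upd _ _ _) _); rewrite -eB.
- exact: leqnSn.
- by congr (Config _ (upd _ _ _) _); rewrite /upd /= mulnC.
- lia.
- by congr (Config _ (upd _ _ _) _); rewrite /upd /= r0 addn1.
lia.
Qed.

(** Each clipped quantity is at most B = (8 (n + 1)) ^ 8, and addresses are
    O(B ^ 2), whence a word bound that is a fixed power of n + 1. *)
Theorem language_decides (X : Type) (enc : X -> seq nat) (L : X -> Prop) c x :
  cok c -> (forall u, 0 < size (enc u)) -> (forall u i, nth 0 (enc u) i <= 8) ->
  (forall u, let n := size (enc u) in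
     rg (denote (enc u) (capof n) (clipof n) c store0) x != 0 <-> L u) ->
  decidable_in_time enc L
    (fun n => weight c * capof n ^ depth c + 9).
Proof.
move=> okc enc_gt0 enc8 decL; exists (compile c x), 96 => u n.
set P := compile c x; set w := enc u in n *.
have n0 : 0 < n := enc_gt0 u.
have M0 : 16 <= capof n by rewrite /capof; lia.
have MB : capof n <= clipof n by rewrite -{1}[capof n]expn1 leq_pexp2l // (leq_trans _ M0).
have B8 : 8 <= clipof n by apply: leq_trans MB; apply: leq_trans M0.
have nB : n <= clipof n by apply: leq_trans MB; rewrite /capof; lia.
have wB i : nth 0 w i <= clipof n by apply: leq_trans (enc8 _ _) B8.
have WB := clip_bound n0.
have eM8 : capof n * capof n * (capof n * capof n)
    * (capof n * capof n * (capof n * capof n)) = clipof n.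
  by rewrite -[X in X * X * (X * X)]/(capof n ^ 2) -!expnD.
have eM : 8 * n.+1 = capof n by [].
have decu := decL u; rewrite /= -/w -/n in decu.
move: (n.+1 ^ 96) (capof n) (clipof n) WB M0 MB B8 nB wB eM8 eM decu.
move=> W M B WB M0 MB B8 nB wB eM8 eM decu.
have codeP : code_at P 0 (compile c x).
  rewrite -[0]/(size (@nil instr)) /P.
  have cat_code : forall C1 C2, code_at (C1 ++ C2) (size C1) C2.
    move=> C1 C2; elim: C2 C1 => //= i C2 IH C1; split; last first.
      by rewrite -cat_rcons -(size_rcons C1 i).
    by elim: C1 {IH} => //=.
  exact: (cat_code [::]).
have [cp /code_at_cat[cc [p0 [p1 [p2 _]]]]] := (code_at_cat _ _ _ _).1 codeP.
rewrite size_ccmd in p0 p1 p2.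
pose Q (cf : config) := halted P cf = Some (rg (denote w M B c store0) x != 0).
have sB0 : sbound B store0 by [].
have rch : reach P W (8 + (cost M c + 1)) (init w) Q.
  apply: (@prologue_run P w M B) => //; first exact: enc8.
  move=> r lr r7 wb.
  have s0 : sim w M B store0 r (nth 0 w).
    split=> // [y|a i j a8 iB jB]; first by rewrite r7 // /rV; lia.
    by rewrite nth_default // /addr leq_addr.
  apply: (cmd_reach B8 n0 nB MB wB WB s0 sB0 okc cc wb) => r1 m1 s1 _ wb1.
  have [_ hV _ _] := s1.
  apply: (reach_step p0) => //=; rewrite hV.
  apply: reach_stop => //; rewrite /Q /halted /=.
  by case: (rg _ x == 0); rewrite ?p1 ?p2.
case: rch => t [le_t Qt bt]; exists t, (rg (denote w M B c store0) x != 0); split=> //.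
  apply: leq_trans le_t _; rewrite [_ + 9](addnS _ 8) addnA addn1 ltnS addnC leq_add2r.
  by apply: cost_weight; apply: leq_trans M0.
Qed.

(** * Signed sums of powers of two *)

Definition term := (nat * nat)%type.

Section Values.
Local Open Scope ring_scope.
Variable e : nat -> int.

(** A term is a node with a sign bit, 1 meaning negative.  The exponents are
    given by an abstract assignment e, since they are not stored as numbers. *)
Definition term_val (x : term) : rat := (-1) ^+ x.2 * 2%:R ^ e x.1.
Definition val_of (l : seq term) : rat := \sum_(x <- l) term_val x.
Definition flip (x : term) : term := (x.1, 1 - x.2)%N.
Definition sgn_ok (l : seq term) := all (fun x : term => x.2 <= 1)%N l.
Definition desc : rel term := fun x y => e y.1 <= e x.1.

Lemma desc_total : total desc.
Proof. by move=> x y; apply: le_total. Qed.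
Lemma desc_trans : transitive desc.
Proof. by move=> y x z xy yz; apply: le_trans yz xy. Qed.

Lemma val_cat l1 l2 : val_of (l1 ++ l2) = val_of l1 + val_of l2.
Proof. by rewrite /val_of big_cat. Qed.
Lemma val_nil : val_of [::] = 0.
Proof. by rewrite /val_of big_nil. Qed.
Lemma val_cons x l : val_of (x :: l) = term_val x + val_of l.
Proof. by rewrite /val_of big_cons. Qed.
Lemma val_rcons l x : val_of (rcons l x) = val_of l + term_val x.
Proof. by rewrite -cats1 val_cat val_cons val_nil addr0. Qed.

Lemma val_merge l1 l2 : val_of (merge desc l1 l2) = val_of l1 + val_of l2.
Proof. by rewrite -val_cat /val_of; apply: perm_big; rewrite perm_merge. Qed.

Lemma val_flip l : sgn_ok l -> val_of (map flip l) = - val_of l.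
Proof.
rewrite /val_of big_map -sumrN => /allP ok; rewrite big_seq [RHS]big_seq.
apply: eq_bigr => -[v [|[|k]]] /ok //= _; rewrite /term_val /= ?expr0 ?expr1 ?mulN1r ?mul1r ?opprK //.
Qed.

Lemma val_nseq k x : val_of (nseq k x) = k%:R * term_val x.
Proof. by rewrite /val_of big_nseq -Monoid.iteropE /= -/(GRing.natmul _ _) mulr_natl. Qed.

Lemma two_gt0 (z : int) : 0 < 2%:R ^ z :> rat.
Proof. exact: exprz_gt0. Qed.
Lemma two_neq0 (z : int) : 2%:R ^ z != 0 :> rat.
Proof. by rewrite gt_eqF ?two_gt0. Qed.

Lemma two_split (a b : int) : b <= a ->
  2%:R ^ a = (2 ^ `|a - b|)%N%:R * 2%:R ^ b :> rat.
Proof.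
move=> le; rewrite -[in LHS](subrK b a) expfzDr //; congr (_ * _).
by rewrite natrX -[in LHS](gez0_abs (_ : 0 <= a - b)) ?subr_ge0.
Qed.
End Values.

(** Values only depend on the exponents of the nodes that occur, so they survive
    the creation of further nodes. *)
Lemma val_ext e e' l : {in [seq x.1 | x <- l], e =1 e'} -> val_of e l = val_of e' l.
Proof.
move=> ee; rewrite /val_of big_seq [RHS]big_seq; apply: eq_bigr => x xl.
by rewrite /term_val ee // map_f.
Qed.

(** * Saturated differences *)

Section Saturation.
Variable B : nat.
Local Notation clip := (fun x => minn x B).

Lemma clip_mul p g : minn (p * minn g B) B = minn (p * g) B.
Proof.
have [le|/ltnW le] := leqP g B; first by [].
case: p => [|p]; first by rewrite !mul0n.
by rewrite !mulSn; lia.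
Qed.

(** The pair (p, q) of naturals, one of which is 0, stands for the integer t.
    Either t is p - q, or saturation has occurred: then t and p - q have the
    same sign and both are at least B - j in absolute value, where j counts the
    units added so far. *)
Definition sat (j : nat) (t : int) (p q : nat) : Prop :=
  (t = p%:Z - q%:Z)%R /\ (p = 0 \/ q = 0) \/
  (B - j <= p /\ q = 0 /\ ((B - j)%:Z <= t)%R) \/
  (B - j <= q /\ p = 0 /\ (t <= - (B - j)%:Z)%R).

Lemma sat_scale j t p q g :
  sat j t p q -> 0 < g ->
  sat j (t * g%:Z)%R (minn (p * minn g B) B) (minn (q * minn g B) B).
Proof.
rewrite !clip_mul => + g0.
have mono x : x <= x * g by rewrite leq_pmulr.
case=> [[et [e0|e0]]|[[le [e0 le']]|[le [e0 le']]]]; subst.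
- rewrite /sat mul0n min0n sub0r mulNr -PoszM; lia.
- rewrite /sat mul0n min0n subr0 -PoszM; lia.
- by right; left; have := mono p; rewrite mul0n; nia.
by right; right; have := mono q; rewrite mul0n; nia.
Qed.

(** A unit of either sign lowers the absolute values of t and of the difference
    by at most one. *)
Lemma sat_add j t p q s : p <= B -> q <= B ->
  sat j t p q -> j < B -> s <= 1 ->
  let p1 := minn (p + (1 - s)) B in let q1 := minn (q + s) B in
  sat j.+1 (t + (-1) ^+ s)%R (p1 - q1) (q1 - p1).
Proof.
move=> pB qB + jB s1; rewrite /sat; case: s s1 => [|[|]] //= _;
  rewrite ?expr0 ?expr1; case=> [[et [e0|e0]]|[[le [e0 le']]|[le [e0 le']]]]; subst.
all: lia.
Qed.

Lemma sat_min j t p q K : sat j t p q -> K <= B - j -> 0 < B - j ->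
  [/\ (0 <= t)%R = (q == 0), (t == 0%R) = (p == 0) && (q == 0),
      (0 <= t)%R -> minn p K = minn `|t| K
    & (t <= 0)%R -> minn q K = minn `|t| K].
Proof.
move=> + KB B0; case=> [[et [e0|e0]]|[[le [e0 le']]|[le [e0 le']]]]; subst; split; lia.
Qed.
End Saturation.

(** * Compressed coordinates of the exponents *)

(** Here x <= y <= z are exponents.  A coordinate obtained from that of a
    neighbour by a capped distance compares correctly with those beyond this
    neighbour, because a difference which exceeds the cap still does after a
    nonnegative addition. *)
Lemma cap_above K a b (x y z : int) : (x <= y <= z)%R -> a <= b ->
  minn (b - a) K = minn `|y - x| K ->
  a <= b + minn `|z - y| K /\ minn (b + minn `|z - y| K - a) K = minn `|z - x| K.
Proof. lia. Qed.

Lemma cap_below K a b d (x y z : int) : (x <= y <= z)%R -> a <= b ->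
  minn (b - a) K = minn `|z - y| K ->
  d <= b + (d + minn `|y - x| K) - a /\
  minn (b + (d + minn `|y - x| K) - a - d) K = minn `|z - x| K.
Proof. lia. Qed.

Lemma cap_trans K a b d (x y z : int) : (x <= y <= z)%R -> a <= b <= d ->
  minn (b - a) K = minn `|y - x| K -> minn (d - b) K = minn `|z - y| K ->
  minn (d - a) K = minn `|z - x| K.
Proof. lia. Qed.

Lemma cap_sym K a b (x y : int) : 0 < K -> (x <= y)%R -> (y <= x)%R -> a <= b ->
  minn (b - a) K = minn `|y - x| K ->
  b <= a /\ minn (a - b) K = minn `|x - y| K.
Proof. lia. Qed.

Section Coordinates.
Local Open Scope ring_scope.
Variable K : nat.
Hypothesis K_gt0 : (0 < K)%N.

(** Coordinates are ordered like exponents, and their differences agree up to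
    the cap.  Capping the differences keeps coordinates polynomial while
    exponents are not. *)
Definition coords (o : seq nat) (c : nat -> nat) (e : nat -> int) :=
  forall v w : nat, v \in o -> w \in o -> e w <= e v ->
    (c w <= c v)%N /\ minn (c v - c w) K = minn `|e v - e w| K.

Lemma coords_le o c e v w : coords o c e -> v \in o -> w \in o ->
  (c w <= c v)%N = (e w <= e v).
Proof.
move=> co vo wo; have [le|lt] := leP (e w) (e v).
  by have [] := co v w vo wo le.
by have [] := co w v wo vo (ltW lt); lia.
Qed.

Definition up_by (o : seq nat) (e : nat -> int) := sorted (fun v w => e v <= e w) o.

Definition ins (p x : nat) (o : seq nat) := take p o ++ x :: drop p o.

Definition ext (e : nat -> int) x E v : int := if v == x then E else e v.
(** The new node goes to rank p with exponent E.  Its coordinate is that of its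
    predecessor plus their capped distance; the coordinates above are
    translated so that the successor lies at the capped distance of the new
    node. *)
Definition new_coord (o : seq nat) (c : nat -> nat) (e : nat -> int) p E :=
  if p == 0%N then 0%N else
    (c (nth 0%N o p.-1) + minn `|(E : int) - e (nth 0%N o p.-1)| K)%N.
Definition ins_coord o c e p x E v :=
  let C := new_coord o c e p E in
  if v == x then C else if v \in drop p o
  then (c v + (C + minn `|e (nth 0%N o p) - E| K) - c (nth 0%N o p))%N else c v.

Section Insert.
Variables (o : seq nat) (c : nat -> nat) (e : nat -> int) (p x : nat) (E : int).
Hypotheses (x_new : x \notin o) (uo : uniq o) (so : up_by o e) (co : coords o c e).
Hypothesis (p_le : (p <= size o)%N).
Hypothesis low : forall i, (i < p)%N -> e (nth 0%N o i) <= E.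
Hypothesis high : forall i, (p <= i < size o)%N -> E <= e (nth 0%N o i).

Local Notation pred := (nth 0%N o p.-1).
Local Notation succ := (nth 0%N o p).
Local Notation C := (new_coord o c e p E).
Local Notation Z := (C + minn `|e succ - E| K)%N.
Local Notation c' := (ins_coord o c e p x E).
Local Notation e' := (ext e x E).

Lemma ins_uniq : uniq (ins p x o).
Proof.
by rewrite /ins -cat1s uniq_catCA /= cat_take_drop x_new.
Qed.

Lemma mem_ins (v : nat) : (v \in ins p x o) = (v == x) || (v \in o).
Proof.
by rewrite /ins mem_cat inE orbCA -[in RHS](cat_take_drop p o) mem_cat.
Qed.

Lemma size_ins : size (ins p x o) = (size o).+1.
Proof. by rewrite size_cat /= addnS -size_cat cat_take_drop. Qed.

Lemma e_old (v : nat) : v \in o -> e' v = e v.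
Proof. by rewrite /ext; case: eqP => // ->; rewrite (negPf x_new). Qed.

Lemma mem_take_nth (v : nat) : v \in take p o -> exists2 i, (i < p)%N & v = nth 0%N o i.
Proof.
move=> vt; exists (index v (take p o)).
  by move: (vt); rewrite -index_mem size_take_min ltn_min => /andP[].
have lt: (index v (take p o) < p)%N by move: (vt); rewrite -index_mem size_take_min ltn_min => /andP[].
by rewrite -(nth_take 0%N lt) nth_index.
Qed.

Lemma mem_drop_nth (v : nat) : v \in drop p o -> exists2 i, (p <= i < size o)%N & v = nth 0%N o i.
Proof.
move=> vd; exists (p + index v (drop p o))%N; last by rewrite -nth_drop nth_index.
by rewrite leq_addr /= -ltn_subRL -size_drop index_mem.
Qed.

Lemma low_e (v : nat) : v \in take p o -> e v <= E.
Proof. by case/mem_take_nth=> i /low + ->. Qed.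
Lemma high_e (v : nat) : v \in drop p o -> E <= e v.
Proof. by case/mem_drop_nth=> i /high + ->. Qed.

Lemma le_nth i j : (i <= j < size o)%N -> e (nth 0%N o i) <= e (nth 0%N o j).
Proof.
case/andP=> ij js.
apply: (@sorted_leq_nth _ (fun v w => e v <= e w)) => //.
  by move=> b a d; apply: le_trans.
exact: leq_ltn_trans ij js.
Qed.

Lemma pred_e (v : nat) : v \in take p o -> [/\ pred \in o, e v <= e pred, e pred <= E & (0 < p)%N].
Proof.
case/mem_take_nth=> i ip ->; have p0 : (0 < p)%N by apply: leq_ltn_trans ip.
have lt : (p.-1 < size o)%N by apply: leq_trans p_le; rewrite prednK.
split=> //; first exact: mem_nth.
  by apply: le_nth; rewrite lt andbT -ltnS prednK.
by apply: low; rewrite prednK.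
Qed.

Lemma succ_e (v : nat) : v \in drop p o -> [/\ succ \in o, e succ <= e v & E <= e succ].
Proof.
case/mem_drop_nth=> i /andP[pi io] ->; have lt := leq_ltn_trans pi io.
by split; [apply: mem_nth | apply: le_nth; rewrite pi | apply: high; rewrite leqnn].
Qed.

Lemma ins_sorted : up_by (ins p x o) e'.
Proof.
rewrite /up_by /ins (@sorted_pairwise _ (fun v w => e' v <= e' w)); last first.
  by move=> b a d; apply: le_trans.
have := so; rewrite /up_by (@sorted_pairwise _ (fun v w => e v <= e w)); last first.
  by move=> b a d; apply: le_trans.
have xt : x \notin take p o by apply: contra x_new => /mem_take.
have xd : x \notin drop p o by apply: contra x_new => /mem_drop.
rewrite -{1}(cat_take_drop p o) !pairwise_cat /= => /and3P[r t d].
have eo (v : nat) : v \in o -> e' v = e v by apply: e_old.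
have pw s : {subset s <= o} -> pairwise (fun v w => e v <= e w) s -> pairwise (fun v w => e' v <= e' w) s.
  move=> sub; rewrite (@eq_in_pairwise _ (mem o) (fun v w => e' v <= e' w)
    (fun v w => e v <= e w)) //; last by apply/allP.
  by move=> v w vo wo /=; rewrite !eo.
have takeS : {subset take p o <= o} by move=> v; apply: mem_take.
have dropS : {subset drop p o <= o} by move=> v; apply: mem_drop.
rewrite (pw _ takeS t) (pw _ dropS d) andbT /=; apply/andP; split; last first.
  by apply/allP=> v vd; rewrite {1}/ext eqxx eo ?(mem_drop vd) // high_e.
apply/allrelP=> v w vt; rewrite inE => /orP[/eqP->|wd].
  by rewrite {2}/ext eqxx eo ?(mem_take vt) // low_e.
by rewrite !eo ?(mem_take vt) ?(mem_drop wd) //; apply: le_trans (low_e vt) (high_e wd).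
Qed.

(** Two nodes on the same side of the new one keep their difference, being
    fixed or translated together.  Two nodes on different sides are compared
    through the new node, by transitivity of capped distances. *)
Lemma ins_coords : coords (ins p x o) c' e'.
Proof.
have xt : x \notin take p o by apply: contra x_new => /mem_take.
have xd : x \notin drop p o by apply: contra x_new => /mem_drop.
have cl (v : nat) : v \in take p o -> c' v = c v /\ e' v = e v.
  move=> vt; rewrite /ins_coord /ext; case: eqP => [vx|_]; first by rewrite -vx vt in xt.
  case: ifP => // vd; move: uo; rewrite -(cat_take_drop p o) cat_uniq => /and3P[_ /hasPn/(_ _ vd)].
  by rewrite /= vt.
have cx : c' x = C /\ e' x = E by rewrite /ins_coord /ext eqxx.
have ch (v : nat) : v \in drop p o -> c' v = (c v + Z - c succ)%N /\ e' v = e v.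
  by move=> vd; rewrite /ins_coord /ext vd; case: eqP => [vx|//]; rewrite -vx vd in xd.
have lowx (v : nat) : v \in take p o -> (c v <= C)%N /\ minn (C - c v) K = minn `|E - e v| K.
  move=> vt; have [po le le' p0] := pred_e vt.
  have [l1 m1] := co po (mem_take vt) le.
  rewrite /new_coord ifF; last by case: p p0.
  by apply: cap_above => //; rewrite le.
have highx (v : nat) : v \in drop p o ->
    (C <= c v + Z - c succ)%N /\ minn (c v + Z - c succ - C) K = minn `|e v - E| K.
  move=> vd; have [po le le'] := succ_e vd.
  have [l1 m1] := co (mem_drop vd) po le.
  by apply: cap_below => //; rewrite le'.
have lowhigh (v w : nat) : v \in take p o -> w \in drop p o ->
    (c v <= c w + Z - c succ)%N /\
    minn (c w + Z - c succ - c v) K = minn `|e w - e v| K.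
  move=> vt wd; have [l1 m1] := lowx v vt; have [l2 m2] := highx w wd.
  have := low_e vt; have := high_e wd => le2 le1; split; first exact: leq_trans l1 l2.
  by apply: (cap_trans (y := E) _ _ m1 m2); rewrite ?le1 ?l1.
have insP (v : nat) : v \in ins p x o -> [\/ v \in take p o, v = x | v \in drop p o].
  by rewrite mem_cat inE => /orP[|/orP[/eqP|]]; [constructor 1|constructor 2|constructor 3].
move=> v w /insP vP /insP wP.
case: wP => [wt|->|wd]; case: vP => [vt|->|vd].
- have [-> ->] := cl v vt; have [-> ->] := cl w wt.
  by apply: co; [apply: mem_take vt|apply: mem_take wt].
- by have [-> ->] := cx; have [-> ->] := cl w wt; move=> _; apply: lowx.
- by have [-> ->] := ch v vd; have [-> ->] := cl w wt; move=> _; apply: lowhigh.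
- have [-> ->] := cx; have [-> ->] := cl v vt => le; have [l1 m1] := lowx v vt.
  by apply: cap_sym; rewrite // low_e.
- by move=> _; rewrite !subnn subrr.
- by have [-> ->] := cx; have [-> ->] := ch v vd; move=> _; apply: highx.
- have [-> ->] := ch w wd; have [-> ->] := cl v vt => le.
  have [l1 m1] := lowhigh v w vt wd.
  by apply: cap_sym; rewrite // (le_trans (low_e vt) (high_e wd)).
- have [-> ->] := cx; have [-> ->] := ch w wd => le; have [l1 m1] := highx w wd.
  by apply: cap_sym; rewrite // high_e.
have [-> ->] := ch v vd; have [-> ->] := ch w wd => le.
have [l1 m1] := co (mem_drop vd) (mem_drop wd) le.
have [so' le1 _] := succ_e wd; have [l2 _] := co (mem_drop wd) so' le1.
by rewrite -m1; move: l1 l2; move: (c v) (c w) (c succ) Z => *; lia.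
Qed.

(** An insertion creates at most two capped distances, so coordinates grow by at
    most 2 K each time. *)
Lemma ins_bound b : (forall v : nat, v \in o -> c v <= b)%N ->
  forall v : nat, v \in ins p x o -> (c' v <= b + 2 * K)%N.
Proof.
move=> cb v; rewrite mem_ins /ins_coord /=.
have Cb (u : nat) : u \in drop p o -> (C <= c succ + K)%N.
  move=> ud; have [so' le le'] := succ_e ud; rewrite /new_coord; case: eqP => // p0.
  have lt : (p.-1 < size o)%N by apply: leq_trans p_le; lia.
  have po : pred \in o by apply: mem_nth.
  have : e pred <= e succ by apply: le_trans le'; apply: low; lia.
  by case/(co so' po); lia.
case: eqP => [_ _|_ /= vo].
  rewrite /new_coord; case: eqP => // p0; have lt : (p.-1 < size o)%N by apply: leq_trans p_le; lia.
  rewrite leq_add ?cb ?mem_nth //.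
  by rewrite (leq_trans (geq_minr _ _)) // leq_pmull.
case: ifP => vd; last by rewrite (leq_trans (cb _ vo)) // leq_addr.
have := Cb _ vd; have := cb _ vo; have := geq_minr `|e succ - E| K.
move: (minn _ _) C => g D; lia.
Qed.
End Insert.
End Coordinates.

(** * The algorithm *)

Declare Scope iexp_scope.
Delimit Scope iexp_scope with I.
Bind Scope iexp_scope with iexp.
Notation "a + b" := (Plus a b) : iexp_scope.
Notation "a - b" := (Minus a b) : iexp_scope.
Notation "a * b" := (Times a b) : iexp_scope.
Notation "a / b" := (Quo a b) : iexp_scope.
Notation "x ::= e" := (Asgn x e%I) (at level 70).
Notation "c1 ;; c2" := (Seq c1 c2) (at level 90, right associativity).
Coercion Var : nat >-> iexp.

Notation "'#' c" := (Cst c) (at level 2, format "'#' c").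

(** The registers.  vAcc is the answer.  vA, vB, vD are the two operands and the
    destination of a merge, vI and vJ its positions.  vP, vQ hold a saturated
    difference, in units of a power of two of coordinate vL; vX, vF, vT, vW
    are auxiliary.  For insertions, vNew is the new node, vPos its rank, vN the
    number of nodes, vC the new coordinate, and vZ, vY what is added to and
    subtracted from the coordinates above.  vH is the first unused handle; vK
    and vG run along lists.  vIn counts the letters read, vTok is the last one,
    vSP is the height of the stack and vFail records an undefined swap.  vR, vM,
    vS, vE, vHS hold handles during a product. *)
Notation vAcc := 0 (only parsing).
Notation vA := 1 (only parsing).
Notation vB := 2 (only parsing).
Notation vD := 3 (only parsing).
Notation vI := 4 (only parsing).
Notation vJ := 5 (only parsing).
Notation vP := 6 (only parsing).
Notation vQ := 7 (only parsing).
Notation vL := 8 (only parsing).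
Notation vX := 9 (only parsing).
Notation vF := 10 (only parsing).
Notation vT := 11 (only parsing).
Notation vPos := 12 (only parsing).
Notation vN := 13 (only parsing).
Notation vH := 14 (only parsing).
Notation vC := 15 (only parsing).
Notation vZ := 16 (only parsing).
Notation vY := 17 (only parsing).
Notation vK := 18 (only parsing).
Notation vW := 19 (only parsing).
Notation vIn := 20 (only parsing).
Notation vSP := 21 (only parsing).
Notation vFail := 22 (only parsing).
Notation vTok := 23 (only parsing).
Notation vR := 24 (only parsing).
Notation vM := 25 (only parsing).
Notation vS := 26 (only parsing).
Notation vE := 27 (only parsing).
Notation vNew := 28 (only parsing).
Notation vHS := 29 (only parsing).
Notation vG := 30 (only parsing).

(** The arrays.  A handle h denotes a list of aLen h terms with nodes aId h i and
    signs aSg h i.  A node is the handle of the list of its exponent, aCo is its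
    coordinate, and aOrd lists the nodes by increasing exponent.  aSR and aSM are
    the stacks of first and second components, and aPow holds the powers of
    two. *)
Notation aId := 0 (only parsing).
Notation aSg := 1 (only parsing).
Notation aLen := 2 (only parsing).
Notation aCo := 3 (only parsing).
Notation aOrd := 4 (only parsing).
Notation aSR := 5 (only parsing).
Notation aSM := 6 (only parsing).
Notation aPow := 7 (only parsing).

Definition len (h : iexp) := Get aLen h #0.
Definition coord (v : iexp) := Get aCo v #0.
Definition capped (e : iexp) : iexp := (e - (e - Cap * Cap))%I.
Definition pow2 (e : iexp) : iexp := Get aPow (capped e) #0.

Definition merge_body (neg : bool) : cmd :=
  let take_a :=
    Put aId vD (vI + vJ) (Get aId vA vI) ;;
    Put aSg vD (vI + vJ) (Get aSg vA vI) ;;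
    vI ::= vI + #1 in
  let take_b :=
    Put aId vD (vI + vJ) (Get aId vB vJ) ;;
    Put aSg vD (vI + vJ)
      (if neg then #1 - Get aSg vB vJ else Get aSg vB vJ)%I ;;
    vJ ::= vJ + #1 in
  If (len vB - vJ)
    (If (len vA - vI)
       (If (coord (Get aId vB vJ) - coord (Get aId vA vI)) take_b take_a)
       take_b)
    (If (len vA - vI) take_a Skip).

Definition merge_cmd (neg : bool) : cmd :=
  vI ::= #0 ;; vJ ::= #0 ;; Rep (merge_body neg) ;; Put aLen vD #0 (vI + vJ).

(** Restores the invariant that vP or vQ is 0, without changing vP - vQ. *)
Definition norm_cmd : cmd := vT ::= vP - vQ ;; vQ ::= vQ - vP ;; vP ::= vT.

Definition horner_body : cmd :=
  If (len vA - vI)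
    (vX ::= coord (Get aId vA vI) ;; vF ::= pow2 (vL - vX) ;;
     vP ::= vP * vF + (#1 - Get aSg vA vI) ;;
     vQ ::= vQ * vF + Get aSg vA vI ;;
     norm_cmd ;; vL ::= vX ;; vI ::= vI + #1)
    Skip.

Definition horner_cmd : cmd :=
  vP ::= #0 ;; vQ ::= #0 ;; vL ::= #0 ;; vI ::= #0 ;; Rep horner_body ;;
  vX ::= coord #0 ;; vF ::= pow2 (vL - vX) ;; vP ::= vP * vF ;; vQ ::= vQ * vF.

(** The difference of two exponents is the sum of a merge, built in the scratch
    list 1. *)
Definition compare_cmd : cmd :=
  vA ::= vNew ;; vD ::= #1 ;; merge_cmd true ;; vA ::= #1 ;; horner_cmd.

(** Advances vPos by k when the node at rank vPos + k - 1 does not exceed the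
    new one. *)
Definition jump_cmd (k : iexp) : cmd :=
  If (vN + #1 - (vPos + k))
    (vB ::= Get aOrd (vPos + k - #1) #0 ;; compare_cmd ;;
     If vQ Skip (vPos ::= vPos + k))
    Skip.

(** The order and the coordinates above vPos are moved from the top down; the
    loop over up to M ^ 2 nodes is a double repetition. *)
Definition shift_body : cmd :=
  If (vK - vPos)
    (vW ::= Get aOrd (vK - #1) #0 ;; Put aOrd vK #0 vW ;;
     Put aCo vW #0 (coord vW + vZ - vY) ;; vK ::= vK - #1)
    Skip.

Definition insert_cmd : cmd :=
  vPos ::= #0 ;; Rep (jump_cmd Cap) ;; Rep (jump_cmd #1) ;;
  vC ::= #0 ;;
  If vPos (vB ::= Get aOrd (vPos - #1) #0 ;; compare_cmd ;;
           vC ::= coord vB + capped vP) Skip ;;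
  vZ ::= vC ;; vY ::= #0 ;;
  If (vN - vPos) (vB ::= Get aOrd vPos #0 ;; compare_cmd ;;
                  vZ ::= vC + capped vQ ;; vY ::= coord vB) Skip ;;
  vK ::= vN ;; Rep (Rep shift_body) ;;
  Put aOrd vPos #0 vNew ;; Put aCo vNew #0 vC ;; vN ::= vN + #1.

Definition node_cmd : cmd := merge_cmd false ;; vH ::= vH + #1 ;; insert_cmd.

Definition scale_body : cmd :=
  If (len vS - vG)
    (vNew ::= vH ;; vA ::= Get aId vS vG ;; vB ::= vM ;; vD ::= vNew ;;
     node_cmd ;;
     Put aId vHS vG vNew ;; Put aSg vHS vG (Get aSg vS vG) ;;
     vG ::= vG + #1)
    Skip.

Definition scale_cmd : cmd :=
  vHS ::= vH ;; vH ::= vH + #1 ;; Put aLen vHS #0 (len vS) ;; vG ::= #0 ;;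
  Rep scale_body.

Definition add_cmd (a b : iexp) : cmd :=
  vA ::= a ;; vB ::= b ;; vD ::= vH ;; merge_cmd false ;; vH ::= vH + #1.

Definition mul_cmd : cmd :=
  vR ::= Get aSR (vSP - #1) #0 ;; vM ::= Get aSM (vSP - #1) #0 ;;
  vS ::= Get aSR (vSP - #2) #0 ;; vE ::= Get aSM (vSP - #2) #0 ;;
  scale_cmd ;;
  add_cmd vR vHS ;; Put aSR (vSP - #2) #0 vD ;;
  add_cmd vM vE ;; Put aSM (vSP - #2) #0 vD ;;
  vSP ::= vSP - #1.

(** The quotient by 2 ^ (vX - vL) saturated at B; a nonzero remainder makes the
    swap undefined. *)
Definition divide_cmd : cmd :=
  vF ::= pow2 (vX - vL) ;;
  If (vP - vP / vF * vF) (vFail ::= #1) Skip ;;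
  If (vQ - vQ / vF * vF) (vFail ::= #1) Skip ;;
  vP ::= vP / vF ;; vQ ::= vQ / vF.

(** Consumes the last terms of the list, those of smallest exponent, as long as
    they are below the coordinate of node 0, whose exponent is 0. *)
Definition carry_body : cmd :=
  If vK
    (vX ::= coord (Get aId vR (vK - #1)) ;;
     If (coord #0 - vX)
       (divide_cmd ;;
        vP ::= vP + (#1 - Get aSg vR (vK - #1)) ;;
        vQ ::= vQ + Get aSg vR (vK - #1) ;;
        norm_cmd ;; vL ::= vX ;; vK ::= vK - #1)
       Skip)
    Skip.

(** The new list is the part of the old one that was not consumed, followed by
    copies of 1 or - 1.  More cells than the final length are written. *)
Definition copy_body : cmd :=
  If (vK - vG)
    (Put aId vH vG (Get aId vR vG) ;; Put aSg vH vG (Get aSg vR vG))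
    (Put aId vH vG #0 ;; Put aSg vH vG (#1 - (#1 - vQ))) ;;
  vG ::= vG + #1.

Definition swap_cmd : cmd :=
  vR ::= Get aSR (vSP - #1) #0 ;; vK ::= len vR ;;
  vP ::= #0 ;; vQ ::= #0 ;; vL ::= #0 ;;
  Rep carry_body ;;
  vX ::= coord #0 ;; divide_cmd ;;
  vG ::= #0 ;; Rep copy_body ;;
  Put aLen vH #0 (vK + (vP + vQ)) ;;
  Put aSR (vSP - #1) #0 (Get aSM (vSP - #1) #0) ;;
  Put aSM (vSP - #1) #0 vH ;;
  vH ::= vH + #1.

(** Letters 0 and 1 are 1 and - 1 in the first component, 2 and 3 in the
    second. *)
Definition leaf_cmd : cmd :=
  vW ::= vTok / #2 ;;
  Put aId (vH + vW) #0 #0 ;; Put aSg (vH + vW) #0 (vTok - vW * #2) ;;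
  Put aLen (vH + vW) #0 #1 ;; Put aLen (vH + (#1 - vW)) #0 #0 ;;
  Put aSR vSP #0 vH ;; Put aSM vSP #0 (vH + #1) ;;
  vSP ::= vSP + #1 ;; vH ::= vH + #2.

(** Reading a prefix notation from right to left meets the operands of a symbol
    before the symbol, so a stack suffices; the left operand ends up on
    top. *)
Definition token_body : cmd :=
  If (Len - vIn)
    (vTok ::= Inp (Len - #1 - vIn) ;; vIn ::= vIn + #1 ;;
     If vFail Skip (If (#4 - vTok) leaf_cmd (If (#5 - vTok) mul_cmd swap_cmd)))
    Skip.

(** The powers of two saturate at B.  Initially node 0 is the only one; its list
    is empty since its exponent is 0, and handle 1 is the scratch list. *)
Definition init_cmd : cmd :=
  Put aPow #0 #0 #1 ;; vK ::= #0 ;;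
  Rep (Rep (Put aPow (vK + #1) #0 (Get aPow vK #0 * #2) ;; vK ::= vK + #1)) ;;
  vN ::= #1 ;; vH ::= #2.

Definition final_cmd : cmd :=
  vAcc ::= #0 ;;
  If vFail Skip
    (vA ::= Get aSR #0 #0 ;; horner_cmd ;;
     If (vP + vQ) Skip
       (vA ::= Get aSM #0 #0 ;; horner_cmd ;;
        If (vP + vQ) Skip (vAcc ::= #1))).

Definition main_cmd : cmd := init_cmd ;; Rep token_body ;; final_cmd.

Lemma depth_main : depth main_cmd = 4.
Proof. by []. Qed.
Lemma cok_main : cok main_cmd.
Proof. by []. Qed.

(** * Merging lists of terms *)

Section Correctness.
Variables (w : seq nat) (M B : nat).
Local Notation n := (size w).
Local Notation K := (M * M).
Local Notation sem := (denote w M B).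
Local Notation ev := (ev w M B).

Hypotheses (n_gt0 : 0 < n) (eM : M = 8 * n.+1) (BD : 64 * (K * K) <= B).
Hypothesis B_pow : B <= 2 ^ K.

Lemma clip_id x : x <= B -> clip B x = x.
Proof. by move=> ?; apply/minn_idPl. Qed.

Definition item s h i : term := (ar s aId h i, ar s aSg h i).
Definition lst s h : seq term := mkseq (item s h) (ar s aLen h 0).
Definition co s v := ar s aCo v 0.
Definition dco s : rel term := fun x y => co s y.1 <= co s x.1.

Lemma size_lst s h : size (lst s h) = ar s aLen h 0.
Proof. exact: size_mkseq. Qed.

Lemma nth_lst x0 s h i : i < size (lst s h) -> nth x0 (lst s h) i = item s h i.
Proof. by rewrite size_lst => ?; rewrite nth_mkseq. Qed.

Lemma lst_eq s s' h : ar s' aLen h 0 = ar s aLen h 0 ->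
  (forall i, i < ar s aLen h 0 -> item s' h i = item s h i) -> lst s' h = lst s h.
Proof.
move=> el ei; rewrite /lst el; apply/eq_in_map => i.
by rewrite mem_iota => /ei.
Qed.

Lemma M_facts : [/\ 16 <= M, 8 * n <= M, 16 * M <= K, 16 * K <= K * K & K * K <= B].
Proof. rewrite eM; split; try nia. Qed.

Lemma lst_sem c s h : all (fun a => a \notin warr c) [:: aId; aSg; aLen] ->
  lst (sem c s) h = lst s h.
Proof. by case/and4P=> c0 c1 c2 _; rewrite /lst /item !sem_ar. Qed.

Lemma rg_setr s x v : rg (setr s x v) x = v.
Proof. by rewrite /= eqxx. Qed.

Definition sgf (neg : bool) (x : term) := if neg then flip x else x.

Definition put_item s h k (x : term) := seta (seta s aId h k x.1) aSg h k x.2.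

Lemma item_put s h k x h' k' :
  item (put_item s h k x) h' k' =
  if (h' == h) && (k' == k) then x else item s h' k'.
Proof. by rewrite /item /=; case: ifP; case: x. Qed.

Lemma item_setr s x v h k : item (setr s x v) h k = item s h k.
Proof. by []. Qed.

Lemma item_seta s a h' k' v h k : 1 < a -> item (seta s a h' k' v) h k = item s h k.
Proof. by case: a => [|[|a]]. Qed.

Lemma mkseq_put s h k x i v :
  mkseq (item (setr (put_item s h k x) i v) h) k.+1 = rcons (mkseq (item s h) k) x.
Proof.
rewrite mkseqS item_setr item_put !eqxx /=; congr rcons.
apply/eq_in_map => l; rewrite mem_iota /= add0n => lt.
by rewrite item_setr item_put (ltn_eqF lt) andbF.
Qed.

(** The loop invariant says that what has been written, followed by the merge of
    the remaining parts, is the whole merge.  M turns are enough as each writes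
    one term. *)
Lemma merge_spec neg s (a := rg s vA) (b := rg s vB) (d := rg s vD)
    (s' := sem (merge_cmd neg) s) (lb := map (sgf neg) (lst s b)) :
  a != d -> b != d -> size (lst s a) + size (lst s b) <= M ->
  lst s' d = merge (dco s) (lst s a) lb /\
  forall h, h != d -> lst s' h = lst s h.
Proof.
move=> ad bd leM; have [M16 _ M2 K2 KB] := M_facts.
have slb : size lb = size (lst s b) by rewrite size_map.
pose I k t := exists i j,
  [/\ rg t vI = i, rg t vJ = j, i <= size (lst s a), j <= size lb &
   [/\ [/\ rg t vA = a, rg t vB = b & rg t vD = d],
      (k <= i + j) || (i + j == size (lst s a) + size lb),
      (forall h l, h != d -> item t h l = item s h l),
      ar t aLen = ar s aLen /\ ar t aCo = ar s aCo &
      mkseq (item t d) (i + j) ++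
        merge (dco s) (drop i (lst s a)) (drop j lb) = merge (dco s) (lst s a) lb]].
have [] : exists t, I M t /\ s' = sem (Put aLen vD #0 (vI + vJ)) t.
  pose s0 := sem (vJ ::= #0) (sem (vI ::= #0) s).
  exists (sem (Rep (merge_body neg)) s0); split=> //.
  apply: rep_inv; first by exists 0, 0; rewrite !drop0.
  move=> k t ltk [i [j [ti tj li lj [[tA tB tD] prog fr [eL eC] em]]]].
  have ea l : item t a l = item s a l by apply: fr.
  have eb l : item t b l = item s b l by apply: fr.
  pose put x := put_item t d (i + j) x.
  have take_a : i < size (lst s a) ->
    merge (dco s) (drop i (lst s a)) (drop j lb) =
      item s a i :: merge (dco s) (drop i.+1 (lst s a)) (drop j lb) ->
    I k.+1 (setr (put (item s a i)) vI i.+1).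
    move=> lti emi; exists i.+1, j; split=> //; split=> //.
    - by case/orP: prog => [le|/eqP e]; lia.
    - by move=> h l hd; rewrite item_setr item_put (negPf hd) fr.
    by rewrite addSn mkseq_put cat_rcons -emi.
  have take_b : j < size lb ->
    merge (dco s) (drop i (lst s a)) (drop j lb) =
      sgf neg (item s b j) :: merge (dco s) (drop i (lst s a)) (drop j.+1 lb) ->
    I k.+1 (setr (put (sgf neg (item s b j))) vJ j.+1).
    move=> ltj emj; exists i, j.+1; split=> //; split=> //.
    - by case/orP: prog => [le|/eqP e]; lia.
    - by move=> h l hd; rewrite item_setr item_put (negPf hd) fr.
    by rewrite addnS mkseq_put cat_rcons -emj.
  have drop_a : i < size (lst s a) -> drop i (lst s a) = item s a i :: drop i.+1 (lst s a).
    by move=> lt; rewrite (drop_nth (0, 0)) // nth_lst.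
  have drop_b : j < size lb -> drop j lb = sgf neg (item s b j) :: drop j.+1 lb.
    move=> lt; rewrite (drop_nth (0, 0)) // (nth_map (0, 0)) -?slb //.
    by rewrite nth_lst // -slb.
  have Ea1 : ar t aId a i = (item s a i).1 by rewrite -ea.
  have Ea2 : ar t aSg a i = (item s a i).2 by rewrite -ea.
  have Eb1 : ar t aId b j = (sgf neg (item s b j)).1 by rewrite -eb; case: (neg).
  have Eb2 : ev (seta t aId d (i + j) (ar t aId b j))
      (if neg then #1 - Get aSg vB vJ else Get aSg vB vJ)%I = (sgf neg (item s b j)).2.
    by rewrite -eb; case: (neg); rewrite /= tB tj.
  have clipij : i < size (lst s a) \/ j < size lb -> clip B (i + j) = i + j.
    by move=> ?; apply: clip_id; lia.
  have clipi : i < size (lst s a) -> clip B (i + 1) = i.+1 by rewrite addn1 => ?; apply: clip_id; lia.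
  have clipj : j < size lb -> clip B (j + 1) = j.+1 by rewrite addn1 => ?; apply: clip_id; lia.
  rewrite /merge_body /= ti tj tA tB tD eL eC -!size_lst -slb !subn_eq0.
  have [gej|ltj] := leqP (size lb) j.
    have [gei|lti] := leqP (size (lst s a)) i.
      exists i, j; split=> //; split=> //; apply/orP; right; lia.
    rewrite (clipij (or_introl lti)) clipi // Ea1 Ea2; apply: take_a => //.
    by rewrite drop_a // (drop_oversize gej); case: (drop _ _).
  rewrite (clipij (or_intror ltj)) clipj //.
  have [gei|lti] := leqP (size (lst s a)) i.
    rewrite Eb2 Eb1; apply: take_b => //.
    by rewrite drop_b // (drop_oversize gei).
  rewrite clipi //; case: ifP => cmp; rewrite Ea1 Eb1 in cmp.
    rewrite Ea1 Ea2; apply: take_a => //.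
    by rewrite drop_a // drop_b //= /dco /co cmp.
  rewrite Eb2 Eb1; apply: take_b => //.
  by rewrite drop_a // drop_b //= /dco /co cmp.
move=> t [[i [j [ti tj li lj [[tA tB tD] prog fr [eL eC] em]]]] ->].
have eij : i + j = size (lst s a) + size lb by case/orP: prog => [le|/eqP//]; lia.
have cij : clip B (i + j) = i + j by apply: clip_id; lia.
split.
  rewrite -em (drop_oversize (_ : size (lst s a) <= i)); last by lia.
  rewrite (drop_oversize (_ : size lb <= j)) ?cats0; last by lia.
  by rewrite /lst /= tD ti tj cij !eqxx.
move=> h hd; apply: lst_eq => [|l _]; last by rewrite item_seta // fr.
by rewrite /= tD (negPf hd) eL.
Qed.

(** * The table of nodes, and comparisons of exponents *)

Definition ords s := mkseq (fun i => ar s aOrd i 0) (rg s vN).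

(** Lists are sorted by decreasing exponent; o is the set of known nodes. *)
Definition wfl (e : nat -> int) (o : seq nat) (l : seq term) :=
  [/\ all (fun x : term => x.1 \in o) l, sgn_ok l & sorted (desc e) l].

Definition nonneg (e : nat -> int) (l : seq term) :=
  all (fun x : term => 0 <= e x.1)%R l.

(** The state represents the exponents e.  That the exponent of each node is the
    value of its own list makes the representation recursive; it is sound
    because it is a condition on an assignment e given beforehand, in which a
    new node is simply added. *)
Record table (s : store) (e : nat -> int) : Prop := Table {
  t_uniq : uniq (ords s);
  t_zero : 0 \in ords s;
  t_scr : 1 < rg s vH;
  t_nil : lst s 0 = [::];
  t_lt : all (fun v => (v < rg s vH) && (v != 1)) (ords s);
  t_sorted : up_by (ords s) e;
  t_coords : coords K (ords s) (co s) e;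
  t_e0 : e 0 = 0%R;
  t_pow : forall i, i <= K -> ar s aPow i 0 = minn (2 ^ i) B;
  t_val : forall v : nat, v \in ords s ->
    [/\ wfl e (ords s) (lst s v), nonneg e (lst s v),
        val_of e (lst s v) = (e v)%:~R%R & size (lst s v) <= n];
  t_co : forall v : nat, v \in ords s -> co s v <= 2 * K * rg s vN }.

Lemma ev_capped s x : ev s (capped x) = minn (ev s x) K.
Proof.
have [_ _ _ KD DB] := M_facts.
by rewrite /= clip_id ?minnE //; lia.
Qed.

Lemma pow_capped d : minn (2 ^ minn d K) B = minn (2 ^ d) B.
Proof.
have [//|/ltnW le] := leqP d K.
rewrite (minn_idPr B_pow); apply/esym/minn_idPr.
by apply: leq_trans B_pow _; rewrite leq_pexp2l.
Qed.

Lemma ev_pow2 s x : (forall i, i <= K -> ar s aPow i 0 = minn (2 ^ i) B) ->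
  ev s (pow2 x) = minn (2 ^ ev s x) B.
Proof.
move=> hp; rewrite /pow2 -[LHS]/(ar s aPow (ev s (capped x)) 0) ev_capped.
by rewrite hp ?geq_minr // pow_capped.
Qed.

(** Capping the coordinates at K does not change the saturated power, because
    2 ^ K is at least B. *)
Lemma pow_coords s e (v u : nat) : table s e -> v \in ords s -> u \in ords s ->
  (e u <= e v)%R -> minn (2 ^ (co s v - co s u)) B = minn (2 ^ `|e v - e u|) B.
Proof.
move=> ts vo uo le; have hc := t_coords ts.
by rewrite -pow_capped; have [_ ->] := hc v u vo uo le; rewrite pow_capped.
Qed.

Definition pow_ok s := forall i, i <= K -> ar s aPow i 0 = minn (2 ^ i) B.

Lemma horner_stepE u (i := rg u vI) (x := item u (rg u vA) i)
    (f := minn (2 ^ (rg u vL - co u x.1)) B)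
    (p := minn (minn (rg u vP * f) B + (1 - x.2)) B)
    (q := minn (minn (rg u vQ * f) B + x.2) B)
    (u' := sem horner_body u) :
  pow_ok u -> i < size (lst u (rg u vA)) ->
  [/\ rg u' vP = p - q, rg u' vQ = q - p, rg u' vL = co u x.1,
      rg u' vI = clip B i.+1 & ar u' = ar u /\ rg u' vA = rg u vA].
Proof.
move=> hp lt; have [_ _ _ KD DB] := M_facts.
have cK : clip B K = K by apply: clip_id; lia.
have fE : ar u aPow (rg u vL - co u x.1 - (rg u vL - co u x.1 - K)) 0 = f.
  by rewrite -minnE hp ?geq_minr // pow_capped.
move: lt; rewrite size_lst ltnNge -subn_eq0 => /negPf lt.
by rewrite /u' /= lt /= cK -/(co u x.1) fE addn1.
Qed.

Lemma horner_lastE u (f := minn (2 ^ (rg u vL - co u 0)) B)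
    (u' := sem (vX ::= coord #0 ;; vF ::= pow2 (vL - vX) ;;
                vP ::= vP * vF ;; vQ ::= vQ * vF) u) :
  pow_ok u ->
  rg u' vP = minn (rg u vP * f) B /\ rg u' vQ = minn (rg u vQ * f) B.
Proof.
move=> hp; have [_ _ _ KD DB] := M_facts.
have cK : clip B K = K by apply: clip_id; lia.
have fE : ar u aPow (rg u vL - co u 0 - (rg u vL - co u 0 - K)) 0 = f.
  by rewrite -minnE hp ?geq_minr // pow_capped.
by rewrite /u' /= cK -/(co u 0) fE.
Qed.

(** After i terms the running pair represents the sum of these in units of the
    exponent of the last one, saturated with margin i.  The sum is finally
    brought to unit 1 if the last exponent is positive; otherwise it stays in
    units of the last exponent, which is enough to test it for 0. *)
Lemma horner_spec s e (a := rg s vA) (s' := sem horner_cmd s) :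
  table s e -> wfl e (ords s) (lst s a) -> size (lst s a) <= M ->
  exists t z, [/\ val_of e (lst s a) = (t%:~R * 2%:R ^ z)%R,
    nonneg e (lst s a) -> z = 0%R,
    sat B (size (lst s a)) t (rg s' vP) (rg s' vQ),
    rg s' vP <= B & rg s' vQ <= B].
Proof.
move=> ts [la ls lso] leM; set l := lst s a in la ls lso leM *.
have [M16 _ M2 K2 KB] := M_facts.
have hpow := t_pow ts.
have B1 : 1 <= B by lia.
pose I k u := exists i t z,
  [/\ rg u vI = i, i <= size l, (k <= i) || (i == size l), rg u vA = a &
   [/\ ar u = ar s, val_of e (take i l) = (t%:~R * 2%:R ^ z)%R,
       sat B i t (rg u vP) (rg u vQ), rg u vP <= B /\ rg u vQ <= B &
       if i is i'.+1 then rg u vL = co s (item s a i').1 /\ z = e (item s a i').1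
       else [/\ t = 0%R, rg u vL = 0, rg u vP = 0 & rg u vQ = 0]]].
pose s0 := sem (vP ::= #0 ;; vQ ::= #0 ;; vL ::= #0 ;; vI ::= #0) s.
have : I M (sem (Rep horner_body) s0).
  apply: rep_inv.
    exists 0, 0%R, 0%R; split=> //; split=> //; first by rewrite take0 val_nil mul0r.
    by left; split; [|left].
  move=> k u ltk [i [t [z [ui li prog uA [uar vt st [pB qB] last]]]]].
  have [gei|lti] := leqP (size l) i.
    have -> : sem horner_body u = u.
      have z0 : ar u 2 (rg u 1) 0 - rg u 4 == 0.
        by rewrite uar uA ui subn_eq0 -size_lst.
      by rewrite /= z0.
    exists i, t, z; split=> //; apply/orP; right; lia.
  have hp : pow_ok u by rewrite /pow_ok uar.
  have lstu h : lst u h = lst s h by rewrite /lst /item uar.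
  have itemu h j : item u h j = item s h j by rewrite /item uar.
  have cou v : co u v = co s v by rewrite /co uar.
  have ltu : rg u vI < size (lst u (rg u vA)) by rewrite lstu ui uA.
  have [] := horner_stepE hp ltu.
  rewrite ui uA itemu cou; set x := item s a i; set f := minn (2 ^ _) B.
  have xl : nth (0, 0) l i = x by rewrite nth_lst.
  have xo : x.1 \in ords s by rewrite -xl; apply: (all_nthP (0, 0) la).
  have xs : x.2 <= 1 by rewrite -xl; apply: (all_nthP (0, 0) ls).
  have [g [g0 fE gz]] : exists g, [/\ 0 < g, f = minn g B &
      (t%:~R * 2%:R ^ z = (t * g%:Z)%:~R * 2%:R ^ e x.1 :> rat)%R].
    case: i ui li prog vt st last lti @x xl xo xs @f {ltu} => [|i] ui li prog vt st last lti x xl xo xs f.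
      case: last => t0 l0 _ _; exists 1; split=> //; last by rewrite t0 !mul0r.
      by rewrite /f l0 sub0n.
    case: last => lE ->.
    set y := item s a i.
    have yl : nth (0, 0) l i = y by rewrite nth_lst // ltnW.
    have yo : y.1 \in ords s by rewrite -yl; apply: (all_nthP (0, 0) la); apply: ltnW.
    have le : (e x.1 <= e y.1)%R.
      have := @sorted_leq_nth _ _ (@desc_trans e) (fun _ => lexx _) (0, 0) l lso i i.+1.
      by rewrite !inE yl xl; apply=> //; apply: ltnW.
    exists (2 ^ `|e y.1 - e x.1|); split; first by rewrite expn_gt0.
      by rewrite /f lE (pow_coords ts).
    by rewrite (two_split le) mulrA rmorphM /=.
  move=> uP uQ uL uI [uar' uA'].
  exists i.+1, (t * g%:Z + (-1) ^+ x.2)%R, (e x.1); split=> //.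
  - by rewrite uI clip_id //; lia.
  - by case/orP: prog => [le|/eqP e1]; lia.
  - split=> //; first by rewrite uar'.
    + rewrite (take_nth (0, 0)) // xl val_rcons vt gz rmorphD /= mulrDl.
      by congr (_ + _)%R; rewrite /term_val rmorphXn /= rmorphN1.
    + rewrite uP uQ fE; apply: sat_add => //; try exact: geq_minr; try lia.
      exact: sat_scale.
    + by rewrite uP uQ; split; apply: leq_trans (leq_subr _ _) (geq_minr _ _).
move=> [i [t [z [ui li prog uA [uar vt st [pB qB] last]]]]].
have ei : i = size l by case/orP: prog => [le|/eqP//]; lia.
set u := sem _ s0 in ui uA uar vt st pB qB last.
have hp : pow_ok u by rewrite /pow_ok uar.
pose f := minn (2 ^ (rg u vL - co s 0)) B.
have [sP sQ] : rg s' vP = minn (rg u vP * f) B /\ rg s' vQ = minn (rg u vQ * f) B.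
  by have := horner_lastE hp; rewrite /co uar.
have [g [g0 fE [zz [gz nz]]]] : exists g, [/\ 0 < g, f = minn g B & exists zz,
    (t%:~R * 2%:R ^ z = (t * g%:Z)%:~R * 2%:R ^ zz :> rat)%R /\
    (nonneg e l -> zz = 0%R)].
  case: i ui li prog vt st last ei => [|i] ui li prog vt st last ei.
    case: last => t0 l0 _ _; exists 1; split=> //; first by rewrite /f l0 sub0n.
    by exists 0%R; rewrite t0 !mul0r.
  case: last => lE ->; set y := item s a i.
  have yl : nth (0, 0) l i = y by rewrite nth_lst // -/l -ei.
  have yo : y.1 \in ords s by rewrite -yl; apply: (all_nthP (0, 0) la).
  have [le|lt] := leP 0%R (e y.1).
    exists (2 ^ `|e y.1 - e 0|); split; first by rewrite expn_gt0.
      by rewrite /f lE (pow_coords ts) // ?(t_zero ts) ?(t_e0 ts).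
    exists 0%R; split=> //.
    by rewrite (@two_split (e y.1) (e 0)) ?(t_e0 ts) // mulrA rmorphM /=.
  exists 1; split=> //.
    have : co s y.1 <= co s 0.
      by rewrite (coords_le _ (t_coords ts)) ?(t_zero ts) ?(t_e0 ts) ?ltW //; lia.
    by rewrite /f lE -subn_eq0 => /eqP->.
  exists (e y.1); split; first by rewrite mulr1.
  move=> /(all_nthP (0, 0))/(_ i); rewrite -ei => /(_ (ltnSn i)).
  by rewrite yl leNgt lt.
exists (t * g%:Z)%R, zz; split=> //.
- by rewrite -gz -vt ei take_size.
- by rewrite sP sQ fE -ei; apply: sat_scale.
- by rewrite sP geq_minr.
by rewrite sQ geq_minr.
Qed.

Lemma eq_in_merge (T : Type) (a : pred T) (r1 r2 : rel T) l1 l2 :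
  {in a &, r1 =2 r2} -> all a l1 -> all a l2 -> merge r1 l1 l2 = merge r2 l1 l2.
Proof.
move=> e12; elim: l1 l2 => // x l1 IH1 l2 /andP[ax al1] al2.
elim: l2 al2 => // y l2 IH2 /andP[ay al2] /=.
rewrite e12 //; case: ifP => _; first by rewrite IH1 //= ay.
by congr cons; apply: IH2.
Qed.

(** On nodes of the table, comparing coordinates amounts to comparing
    exponents. *)
Lemma merge_dco s e l1 l2 : table s e ->
  wfl e (ords s) l1 -> wfl e (ords s) l2 ->
  merge (dco s) l1 l2 = merge (desc e) l1 l2.
Proof.
move=> ts [a1 _ _] [a2 _ _]; apply: eq_in_merge a1 a2 => x y xo yo.
by rewrite /dco (coords_le _ (t_coords ts)) //; have [M16 _ M2 _ _] := M_facts; lia.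
Qed.

Lemma wfl_merge e o l1 l2 : wfl e o l1 -> wfl e o l2 -> wfl e o (merge (desc e) l1 l2).
Proof.
move=> [a1 s1 o1] [a2 s2 o2]; split.
- by rewrite (perm_all _ (permEl (perm_merge _ _ _))) all_cat a1.
- by rewrite /sgn_ok (perm_all _ (permEl (perm_merge _ _ _))) all_cat; apply/andP.
exact: merge_sorted (@desc_total e) _ _ o1 o2.
Qed.

Lemma nonneg_merge e l1 l2 : nonneg e l1 -> nonneg e l2 -> nonneg e (merge (desc e) l1 l2).
Proof.
by move=> a1 a2; rewrite /nonneg (perm_all _ (permEl (perm_merge _ _ _))) all_cat; apply/andP.
Qed.

Lemma wfl_flip e o l : wfl e o l -> wfl e o (map flip l).
Proof.
move=> [a s so]; split; rewrite ?all_map ?sorted_map //.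
by rewrite /sgn_ok all_map; apply/allP=> x _ /=; apply: leq_subr.
Qed.

(** The steps that only write into list d; d is the scratch list or a fresh
    handle. *)
Definition keeps (d : nat) s s' :=
  [/\ ar s' aCo = ar s aCo, ar s' aOrd = ar s aOrd, ar s' aPow = ar s aPow,
      rg s' vN = rg s vN & forall h, h != d -> lst s' h = lst s h].

Lemma keeps_trans d s1 s2 s3 : keeps d s1 s2 -> keeps d s2 s3 -> keeps d s1 s3.
Proof.
move=> [e1 e2 e3 e4 k1] [f1 f2 f3 f4 k2]; split; try congruence.
by move=> h hd; rewrite k2 // k1.
Qed.

Lemma keeps_ords d s s' : keeps d s s' -> ords s' = ords s.
Proof. by case=> _ eo _ eN _; rewrite /ords eo eN. Qed.

Lemma table_keeps d s s' e : table s e -> keeps d s s' -> d \notin ords s ->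
  rg s vH <= rg s' vH -> table s' e.
Proof.
move=> [t1 t2 t0 tn t3 t4 t5 t6 t7 t8 t9] k dN leH; have eo := keeps_ords k.
case: k => eC eO eP eN el.
have ec : co s' = co s by rewrite /co eC.
split; rewrite ?eo ?ec ?eP ?eN //.
- exact: leq_trans leH.
- by rewrite el //; apply: contraNneq dN => <-.
- by apply: sub_all t3 => v /andP[lt ->]; rewrite (leq_trans lt).
- by move=> v vo; rewrite el; [apply: t8 | apply: contraNneq dN => <-].
Qed.

Lemma scratch_notin s e : table s e -> 1 \notin ords s.
Proof. by move=> ts; apply/negP=> /(allP (t_lt ts)); rewrite andbF. Qed.

(** Both lists have nonnegative exponents, so Horner's rule returns the
    difference itself in unit 1, with its sign exact and its size known up to
    K. *)
Lemma compare_spec s e (v := rg s vB) (x := rg s vNew) E (s' := sem compare_cmd s) :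
  table s e -> (v : nat) \in ords s -> x != 1 ->
  wfl e (ords s) (lst s x) -> nonneg e (lst s x) ->
  val_of e (lst s x) = E%:~R%R -> size (lst s x) <= n ->
  [/\ keeps 1 s s', (0 <= E - e v)%R = (rg s' vQ == 0),
      (0 <= E - e v)%R -> minn (rg s' vP) K = minn `|E - e v| K
    & (E - e v <= 0)%R -> minn (rg s' vQ) K = minn `|e v - E| K].
Proof.
move=> ts vo x1 wx nx vx sx; have [M16 Mn M2 K2 KB] := M_facts.
have [wv nv vv sv] := t_val ts vo.
have v1 : v != 1 by apply: contraTneq vo => ->; apply: scratch_notin ts.
set s1 := sem (merge_cmd true) (setr (setr s vA x) vD 1).
have es' : s' = sem horner_cmd (setr s1 vA 1) by [].
have leM : size (lst s x) + size (lst s v) <= M by lia.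
have [l1 lo] := @merge_spec true (setr (setr s vA x) vD 1) x1 v1 leM.
rewrite -/s1 /= -/x in l1 lo.
have k1 : keeps 1 s s1 by split=> //; rewrite /s1 ?sem_ar ?sem_rg.
have el : lst s1 1 = merge (desc e) (lst s x) (map flip (lst s v)).
  by rewrite l1 -[dco _]/(dco s) (merge_dco ts wx (wfl_flip wv)).
have k2 : keeps 1 s (setr s1 vA 1) by [].
have t2 : table (setr s1 vA 1) e.
  have eH : rg s1 vH = rg s vH by rewrite /s1 sem_rg.
  apply: (table_keeps ts k2); first exact: (scratch_notin ts).
  by rewrite -[X in _ <= X]/(rg s1 vH) eH.
have w2 : wfl e (ords (setr s1 vA 1)) (lst (setr s1 vA 1) 1).
  rewrite -[lst _ 1]/(lst s1 1) el (keeps_ords k2); apply: wfl_merge => //.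
  exact: wfl_flip.
have size2 : size (lst s1 1) = size (lst s x) + size (lst s v).
  by rewrite el size_merge size_cat size_map.
have [|t [z [vt nz st _ _]]] := horner_spec t2 w2; first by rewrite /= size2.
rewrite -es' -[lst _ _]/(lst s1 1) in vt nz st.
have n2 : nonneg e (lst s1 1).
  by rewrite el; apply: nonneg_merge => //; rewrite /nonneg all_map.
have tE : t = (E - e v)%R.
  move: vt; rewrite (nz n2) mulr1 el val_merge val_flip; last by case: wv.
  by rewrite vx vv -rmorphB /= => /intr_inj.
have [] := @sat_min B (size (lst s1 1)) t (rg s' vP) (rg s' vQ) K st; rewrite ?size2; try lia.
rewrite tE => h1 _ h3 h4; split=> //; last by rewrite -[(e v - E)%R]opprB abszN.
apply: keeps_trans k2 _; rewrite es'; split; rewrite ?sem_ar ?sem_rg //.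
by move=> h _; apply: lst_sem.
Qed.

(** * Insertion of a node *)

Lemma sem_seq c1 c2 s : sem (c1 ;; c2) s = sem c2 (sem c1 s). Proof. by []. Qed.
Lemma sem_asgn x e s : sem (Asgn x e) s = setr s x (ev s e). Proof. by []. Qed.
Lemma sem_put a i j e s :
  sem (Put a i j e) s = seta s a (ev s i) (ev s j) (ev s e).
Proof. by []. Qed.
Lemma sem_if e c1 c2 s :
  sem (If e c1 c2) s = if ev s e == 0 then sem c2 s else sem c1 s.
Proof. by []. Qed.
Lemma sem_skip s : sem Skip s = s. Proof. by []. Qed.
(* programs are long, and unfolding their meaning by conversion is expensive *)
Opaque denote.

(** The new node goes after the nodes of the same exponent. *)
Definition rank (e : nat -> int) (E : int) (o : seq nat) :=
  find (fun v => E < e v)%R o.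

Lemma rankP e E o i : up_by o e -> i < size o ->
  (e (nth 0 o i) <= E)%R = (i < rank e E o).
Proof.
move=> so io; have [lt|le] := ltnP i (rank e E o).
  by have := before_find 0 lt; rewrite ltNge => /negbFE.
have lts : rank e E o < size o by apply: leq_ltn_trans io.
have : (E < e (nth 0%N o (rank e E o)))%R.
  by apply: (@nth_find _ 0 (fun v => E < e v)%R); rewrite has_find.
move/lt_le_trans => H; apply/negbTE; rewrite -ltNge; apply: H.
by apply: le_nth => //; rewrite le.
Qed.

(** The list of the new node is ready, but the node is not yet in the table. *)
Record new_node s e E : Prop := NewNode {
  nn_table : table s e;
  nn_notin : rg s vNew \notin ords s;
  nn_scratch : rg s vNew != 1;
  nn_lt : rg s vNew < rg s vH;
  nn_wfl : wfl e (ords s) (lst s (rg s vNew));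
  nn_nonneg : nonneg e (lst s (rg s vNew));
  nn_val : val_of e (lst s (rg s vNew)) = E%:~R%R;
  nn_size : size (lst s (rg s vNew)) <= n;
  nn_count : rg s vN < K }.

Lemma new_node_keeps s s' e E : new_node s e E -> keeps 1 s s' ->
  rg s' vNew = rg s vNew -> rg s' vH = rg s vH -> new_node s' e E.
Proof.
move=> nn k ex eh; have [ts h1 h2 h3 h4 h5 h6 h7 h8] := nn.
have eo := keeps_ords k; have [_ _ _ eN el] := k.
split; rewrite ?eo ?ex ?eh ?eN ?el //.
by apply: (table_keeps ts k); rewrite ?(scratch_notin ts) // eh.
Qed.

Lemma size_ords s : size (ords s) = rg s vN.
Proof. exact: size_mkseq. Qed.

Lemma nth_ords s i : i < rg s vN -> nth 0 (ords s) i = ar s aOrd i 0.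
Proof. exact: nth_mkseq. Qed.

Lemma new_node_compare s e E i (s1 := setr s vB (ar s aOrd i 0))
   (v := nth 0 (ords s) i) (s' := sem compare_cmd s1) :
  new_node s e E -> i < rg s vN ->
  [/\ keeps 1 s s', (e v <= E)%R = (rg s' vQ == 0),
      (e v <= E)%R -> minn (rg s' vP) K = minn `|E - e v| K
    & (E <= e v)%R -> minn (rg s' vQ) K = minn `|e v - E| K].
Proof.
move=> nn iN; have [ts h1 h2 h3 h4 h5 h6 h7 h8] := nn.
have ov : ar s aOrd i 0 = v by rewrite /v nth_ords.
have vo : v \in ords s by apply: mem_nth; rewrite size_ords.
have t1 : table s1 e by apply: (@table_keeps 1 s) => //; apply: (scratch_notin ts).
have vo1 : (rg s1 vB : nat) \in ords s1 by rewrite [rg s1 vB]ov.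
have [] := compare_spec t1 vo1 h2 h4 h5 h6 h7.
by rewrite [rg s1 vB]ov subr_ge0 subr_le0.
Qed.

Lemma jumpE ke u :
  sem (jump_cmd ke) u = if clip B (rg u vN + 1) - clip B (rg u vPos + ev u ke) == 0
    then u
    else let t := sem compare_cmd
           (setr u vB (ar u aOrd (clip B (rg u vPos + ev u ke) - 1) 0)) in
         if rg t vQ == 0 then setr t vPos (clip B (rg t vPos + ev t ke)) else t.
Proof. by rewrite sem_if sem_seq sem_asgn sem_seq sem_if sem_skip sem_asgn. Qed.

Lemma jump_spec ke kv u e E (r := rank e E (ords u)) (p := rg u vPos)
    (u' := sem (jump_cmd ke) u) :
  (forall t, ev t ke = kv) -> new_node u e E -> 0 < kv <= M -> p <= r ->
  keeps 1 u u' /\ rg u' vPos = if p + kv <= r then p + kv else p.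
Proof.
move=> evk nn /andP[k0 kM] pr; have [M16 Mn M2 K2 KB] := M_facts.
have [ts _ _ _ _ _ _ _ NK] := nn.
have rN : r <= rg u vN by rewrite -size_ords find_size.
have c1 : clip B (rg u vN + 1) = (rg u vN).+1 by rewrite addn1 clip_id; lia.
have c2 : clip B (p + kv) = p + kv by rewrite clip_id; lia.
have -> : u' = if (rg u vN).+1 - (p + kv) == 0 then u else
     let t := sem compare_cmd (setr u vB (ar u aOrd (p + kv - 1) 0)) in
     if rg t vQ == 0 then setr t vPos (clip B (rg t vPos + ev t ke)) else t.
  by rewrite /u' jumpE evk c1 c2.
rewrite subn_eq0; case: ltnP => [lt|le].
  by rewrite ifN -?ltnNge; [split; [split|]|lia].
have iN : p + kv - 1 < rg u vN by lia.
have [kp cmp _ _] := new_node_compare nn iN.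
have tP : rg (sem compare_cmd (setr u vB (ar u aOrd (p + kv - 1) 0))) vPos = p.
  by rewrite sem_rg.
move: kp cmp tP; move: (sem compare_cmd _) => t kp cmp tP; cbv zeta.
rewrite -cmp (rankP _ (t_sorted ts)) ?size_ords // -/r tP evk c2.
have -> : (p + kv - 1 < r) = (p + kv <= r) by lia.
by case: ifP => _; split.
Qed.
(** Jumps of length kv succeed as long as they stay below the rank r, hence
    there are (r - p) %/ kv of them, provided the loop has enough turns. *)
Lemma jump_loop ke kv u e E (r := rank e E (ords u)) (p := rg u vPos)
    (u' := sem (Rep (jump_cmd ke)) u) :
  (forall t, ev t ke = kv) -> new_node u e E -> 0 < kv <= M -> p <= r ->
  [/\ keeps 1 u u', new_node u' e E
    & rg u' vPos = p + kv * minn M ((r - p) %/ kv)].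
Proof.
move=> evk nn kM pr.
pose I k t := [/\ keeps 1 u t, new_node t e E
    & rg t vPos = p + kv * minn k ((r - p) %/ kv)].
apply: (rep_inv (I := I)); first by split=> //; rewrite min0n muln0 addn0.
move=> k t _ [kt nt pt]; have et := keeps_ords kt.
have kv0 : 0 < kv by case/andP: kM.
have le : kv * ((r - p) %/ kv) <= r - p by rewrite mulnC leq_trunc_div.
have ptr : rg t vPos <= rank e E (ords t).
  by rewrite et -/r pt -leq_subRL //; apply: leq_trans le; rewrite leq_mul2l geq_minr orbT.
have [kt' pt'] := jump_spec evk nt kM ptr; split.
- exact: keeps_trans kt'.
- by apply: (new_node_keeps nt kt'); rewrite sem_rg.
rewrite pt' et -/r pt.
have cmp q : (p + kv * q + kv <= r) = (q.+1 <= (r - p) %/ kv).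
  by rewrite leq_divRL // -addnA -mulnSr -leq_subRL // mulnC.
case: (boolP (k < (r - p) %/ kv)) => [lt|ge].
  have -> : minn k ((r - p) %/ kv) = k by lia.
  have -> : minn k.+1 ((r - p) %/ kv) = k.+1 by lia.
  by rewrite cmp lt -addnA -mulnSr.
have -> : minn k ((r - p) %/ kv) = (r - p) %/ kv by lia.
have -> : minn k.+1 ((r - p) %/ kv) = (r - p) %/ kv by lia.
by rewrite cmp ltnn.
Qed.

(** The rank is below M ^ 2, so its quotient and its remainder by M are both at
    most M. *)
Lemma search_spec s e E
    (s' := sem (Rep (jump_cmd #1)) (sem (Rep (jump_cmd Cap)) (setr s vPos 0))) :
  new_node s e E ->
  [/\ keeps 1 s s', new_node s' e E & rg s' vPos = rank e E (ords s)].
Proof.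
move=> nn; have [M16 Mn M2 K2 KB] := M_facts.
have k0 : keeps 1 s (setr s vPos 0) by [].
have n0 : new_node (setr s vPos 0) e E by apply: (new_node_keeps nn k0).
have M_ok : 0 < M <= M by lia.
have [//||k1 n1 p1] := @jump_loop Cap M _ e E _ n0 M_ok; first by rewrite rg_setr.
set s1 := sem _ _ in k1 n1 p1 s' *; set r := rank _ _ _ in p1.
rewrite rg_setr subn0 add0n in p1.
have e1 : ords s1 = ords s := keeps_ords k1.
have rK : r %/ M <= M.
  rewrite ltnW // ltn_divLR; last by lia.
  by apply: leq_ltn_trans (nn_count nn); rewrite -size_ords find_size.
rewrite (minn_idPr rK) in p1.
have one_ok : 0 < 1 <= M by lia.
have pr : rg s1 vPos <= rank e E (ords s1) by rewrite e1 p1 mulnC leq_trunc_div.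
have [//|k2 n2 p2] := @jump_loop #1 1 s1 e E _ n1 one_ok pr.
have k02 : keeps 1 s (sem (Rep (jump_cmd #1)) s1) by apply: (keeps_trans k1 k2).
split; [exact: k02 | exact: n2 | ].
rewrite p2 divn1 mul1n e1 -/r p1 (minn_idPr _).
  by rewrite subnKC // mulnC leq_trunc_div.
by rewrite {1}(divn_eq r M) mulnC addKn ltnW // ltn_mod; lia.
Qed.

Lemma iter_iter (T : Type) (f : T -> T) a b x : iter a (iter b f) x = iter (a * b) f x.
Proof. by elim: a => //= a ->; rewrite mulSn iterD. Qed.

Lemma rep2_inv (I : nat -> store -> Prop) c s :
  I 0 s -> (forall k t, k < K -> I k t -> I k.+1 (sem c t)) ->
  I K (sem (Rep (Rep c)) s).
Proof.
move=> I0 IS; have -> : sem (Rep (Rep c)) s = iter K (sem c) s by apply: iter_iter.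
have: K <= K by []; elim: {-2}K => [|k IHk] //= ltk.
by apply: IS => //; apply: IHk; apply: ltnW.
Qed.

Lemma shiftE u (k := rg u vK) :
  rg u vPos < k -> sem shift_body u =
  let v := ar u aOrd (k - 1) 0 in
  setr (seta (seta (setr u vW v) aOrd k 0 v) aCo v 0
    (clip B (co u v + rg u vZ) - rg u vY)) vK (k - 1).
Proof. by rewrite -subn_gt0 lt0n sem_if /= => /negPf->. Qed.

Lemma shift_end u : rg u vK <= rg u vPos -> sem shift_body u = u.
Proof. by rewrite -subn_eq0 sem_if /= => ->. Qed.

Lemma shift_spec s (p := rg s vPos) (o := ords s) (N := rg s vN)
    (s' := sem (Rep (Rep shift_body)) (setr s vK N)) :
  uniq o -> p <= N <= K ->
  (forall v : nat, v \in drop p o -> co s v + rg s vZ <= B) ->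
  [/\ forall i, i < p -> ar s' aOrd i 0 = ar s aOrd i 0,
      forall i, p < i <= N -> ar s' aOrd i 0 = ar s aOrd i.-1 0,
      forall v : nat, co s' v = if v \in drop p o
                          then co s v + rg s vZ - rg s vY else co s v,
      forall h, lst s' h = lst s h
    & ar s' aPow = ar s aPow].
Proof.
move=> uo /andP[pN NK] bnd.
pose I k u := exists m,
  [/\ rg u vK = m /\ rg u vPos = p, p <= m <= N, (k + m == N) || (m == p),
   rg u vZ = rg s vZ /\ rg u vY = rg s vY &
  [/\ forall i, i <= m -> ar u aOrd i 0 = ar s aOrd i 0,
      forall i, m < i <= N -> ar u aOrd i 0 = ar s aOrd i.-1 0 &
      forall v : nat, co u v = if v \in drop m o
                          then co s v + rg s vZ - rg s vY else co s v]].
have so : size o = N by apply: size_ords.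
have : I K s'.
  apply: rep2_inv.
    exists N; split; rewrite ?leqnn ?pN ?add0n ?eqxx //; split=> // [i|v].
      by case/andP=> /leq_trans h /h; rewrite ltnn.
    by rewrite drop_oversize // so.
  move=> k u kK [m [[um uP] /andP[pm mN] prog [uZ uY] [u1 u2 u3]]].
  have [le|lt] := leqP m p.
    rewrite shift_end ?um ?uP //; exists m; split=> //; first by rewrite pm.
    by rewrite [m == p]eqn_leq le pm orbT.
  have m0 : 0 < m by apply: leq_ltn_trans lt.
  have m1N : m.-1 < N by rewrite prednK.
  rewrite shiftE ?um ?uP // subn1 [ar u aOrd m.-1 0]u1 ?leq_pred //.
  set v := ar s aOrd m.-1 0.
  have vE : nth 0 o m.-1 = v by rewrite nth_ords.
  have dm : drop m.-1 o = v :: drop m o.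
    by rewrite (drop_nth 0) ?so // vE prednK.
  have vd : v \notin drop m o.
    by have := drop_uniq m.-1 uo; rewrite dm => /andP[].
  have vdp : v \in drop p o.
    rewrite -vE -(subnKC (_ : p <= m.-1)); last by rewrite -ltnS prednK.
    by rewrite -nth_drop mem_nth // size_drop so ltn_sub2r // (leq_ltn_trans _ m1N) // -ltnS prednK.
  have cv : clip B (co u v + rg u vZ) = co s v + rg s vZ.
    by rewrite u3 (negPf vd) uZ clip_id // bnd.
  cbv zeta; rewrite cv uY; exists m.-1; split=> //=.
  - by apply/andP; split; lia.
  - by case/orP: prog => /eqP e; lia.
  split.
  - by move=> i im; rewrite (ltn_eqF (_ : i < m)) /= ?u1; lia.
  - move=> i /andP[mi iN]; case: (i =P m) => [->//|im] /=.
    by apply: u2; lia.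
  move=> v'; rewrite /co /= dm inE andbT.
  by case: (v' =P v) => [->|ne] //=; apply: u3.
case=> m [[um uP] /andP[pm mN] prog _ [u1 u2 u3]].
have em : m = p by case/orP: prog => /eqP; lia.
rewrite em in u1 u2 u3; split=> //.
- by move=> i /ltnW; apply: u1.
- by move=> h; rewrite /s' lst_sem.
by rewrite /s' sem_ar.
Qed.

Lemma wfl_ext e (o : seq nat) x E p l : x \notin o -> wfl e o l ->
  wfl (ext e x E) (ins p x o) l.
Proof.
move=> xo [a s so]; split=> //.
  by apply: sub_all a => y yo; rewrite mem_ins yo orbT.
rewrite -(@eq_in_sorted _ (fun y => y.1 \in o) (desc e)) //.
move=> y z yo zo; rewrite /desc /ext.
by rewrite !ifN //; [apply: contraNneq xo => <- | apply: contraNneq xo => <-].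
Qed.

Lemma ext_old e (o : seq nat) x E (l : seq term) : x \notin o -> all (fun y : term => y.1 \in o) l ->
  {in [seq y.1 | y <- l], ext e x E =1 e}.
Proof.
move=> xo a _ /mapP[y yl ->]; rewrite /ext ifN //.
by apply: contraNneq xo => <-; apply: (allP a).
Qed.

Lemma val_of_ext e (o : seq nat) x E l : x \notin o -> wfl e o l -> val_of (ext e x E) l = val_of e l.
Proof. by move=> xo [a _ _]; apply: val_ext => v vl; apply: (ext_old _ _ xo a vl). Qed.

Lemma nonneg_ext e (o : seq nat) x E l : x \notin o -> wfl e o l ->
  nonneg e l -> nonneg (ext e x E) l.
Proof.
move=> xo [a _ _] /allP nn; apply/allP=> y yl.
by rewrite (ext_old _ _ xo a) ?map_f // nn.
Qed.

(** The part of the insertion that measures the distances to the two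
    neighbours. *)
Definition insert_gaps : cmd :=
  vC ::= #0 ;;
  If vPos (vB ::= Get aOrd (vPos - #1) #0 ;; compare_cmd ;;
           vC ::= coord vB + capped vP) Skip ;;
  vZ ::= vC ;; vY ::= #0 ;;
  If (vN - vPos) (vB ::= Get aOrd vPos #0 ;; compare_cmd ;;
                  vZ ::= vC + capped vQ ;; vY ::= coord vB) Skip.

Lemma compare_at t e E i (o := ords t) (t' := sem compare_cmd (setr t vB (ar t aOrd i 0))) :
  new_node t e E -> i < rg t vN ->
  [/\ keeps 1 t t', new_node t' e E,
      forall x, x != vB -> x \notin wvar compare_cmd -> rg t' x = rg t x &
   [/\ co t' (rg t' vB) = co t (nth 0 o i),
      (e (nth 0%N o i) <= E)%R -> minn (rg t' vP) K = minn `|E - e (nth 0%N o i)| K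
    & (E <= e (nth 0%N o i))%R -> minn (rg t' vQ) K = minn `|e (nth 0%N o i) - E| K]].
Proof.
move=> nn iN; have [k _ h1 h2] := new_node_compare nn iN.
have r1 x : x != vB -> x \notin wvar compare_cmd -> rg t' x = rg t x.
  by move=> xb xc; rewrite /t' sem_rg //= (negPf xb).
split; [exact: k | | exact: r1 | split; [| exact: h1 | exact: h2]].
  by apply: (new_node_keeps nn k); rewrite r1.
have [ec _ _ _ _] := k; have -> : rg t' vB = nth 0 o i.
  by rewrite /t' sem_rg // rg_setr nth_ords.
by rewrite /co ec.
Qed.

Lemma gaps_spec s e E (o := ords s) (p := rank e E o) (s' := sem insert_gaps s) :
  new_node s e E -> rg s vPos = p ->
  [/\ keeps 1 s s', new_node s' e E,
      rg s' vPos = p /\ rg s' vC = new_coord K o (co s) e p E &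
      p < rg s vN ->
        rg s' vZ = rg s' vC + minn `|(e (nth 0%N o p) - E)%R| K /\
        rg s' vY = co s (nth 0 o p)].
Proof.
move=> nn sP; have [M16 Mn M2 K2 KB] := M_facts.
have ts := nn_table nn.
have NK := nn_count nn.
have pN : p <= rg s vN by rewrite -size_ords find_size.
have cb i : i < rg s vN -> co s (nth 0 o i) <= 2 * K * rg s vN.
  by move=> iN; apply: (t_co ts); rewrite mem_nth // size_ords.
have NKK : 2 * K * rg s vN <= 2 * (K * K) by rewrite -mulnA leq_mul2l leq_mul2l (ltnW NK) !orbT.
pose s1 := sem (If vPos (vB ::= Get aOrd (vPos - #1) #0 ;; compare_cmd ;;
           vC ::= coord vB + capped vP) Skip) (setr s vC 0).
have [k1 n1 p1 c1] : [/\ keeps 1 s s1, new_node s1 e E, rg s1 vPos = p &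
   rg s1 vC = new_coord K o (co s) e p E].
  rewrite /s1 sem_if /= sP /new_coord; case: eqP => p0.
    by split; [|apply: (new_node_keeps nn)| |].
  rewrite sem_seq sem_asgn sem_seq /= sP subn1.
  have iN : p.-1 < rg s vN by lia.
  have n0 : new_node (setr s vC 0) e E by apply: (new_node_keeps nn).
  have [k n' r' [cB hP _]] := compare_at n0 iN.
  move: (sem compare_cmd _) k n' r' cB hP => t k n' r' cB hP; rewrite sem_asgn.
  have le : (e (nth 0%N o p.-1) <= E)%R.
    by rewrite (rankP _ (t_sorted ts)) ?size_ords // -/o -/p; lia.
  split; [exact: k | by apply: (new_node_keeps n') | by rewrite -[LHS]/(rg t vPos) r' |].
  rewrite rg_setr -[ev t _]/(clip B (co t (rg t vB) + ev t (capped vP))) ev_capped.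
  rewrite cB [minn _ _]hP // clip_id //.
  by apply: leq_trans (leq_add (cb _ iN) (geq_minr _ _)) _; lia.
have e1 : ords s1 = o := keeps_ords k1.
have es' : s' = sem (If (vN - vPos) (vB ::= Get aOrd vPos #0 ;; compare_cmd ;;
                  vZ ::= vC + capped vQ ;; vY ::= coord vB) Skip)
    (setr (setr s1 vZ (rg s1 vC)) vY 0) by [].
have [_ _ _ N1 _] := k1.
rewrite es' sem_if /= p1 N1 subn_eq0.
set s2 := setr (setr s1 _ _) _ _.
have n2 : new_node s2 e E by apply: (new_node_keeps n1).
case: leqP => [le|lt].
  by split; [exact: k1 | exact: n2 | | lia].
rewrite sem_seq sem_asgn sem_seq /= p1.
have iN : p < rg s2 vN by rewrite -[rg s2 vN]/(rg s1 vN) N1.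
have [k n' r' [cB _ hQ]] := compare_at n2 iN.
move: (sem compare_cmd _) k n' r' cB hQ => t k n' r' cB hQ; rewrite sem_seq !sem_asgn.
have tC : rg t vC = rg s1 vC by rewrite r'.
have le : (E <= e (nth 0%N (ords s2) p))%R.
  rewrite -[ords s2]/(ords s1) e1 leNgt; apply/negP => /ltW.
  by rewrite (rankP _ (t_sorted ts)) ?size_ords // -/o -/p ltnn.
rewrite -[ords s2]/(ords s1) e1 in cB hQ le.
split.
- by apply: (keeps_trans k1 k).
- by apply: (new_node_keeps n').
- by rewrite /= !r'.
move=> _ /=; split; last first.
  by rewrite -/(co t _) cB; case: k1 => eC _ _ _ _; rewrite /co eC.
have CB : rg s1 vC <= 2 * K * rg s vN + K.
  rewrite c1 /new_coord; case: eqP => // p0.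
  by apply: leq_add (geq_minr _ _); apply: cb; lia.
rewrite (clip_id (_ : K <= B)); last by lia.
rewrite -minnE hQ // tC clip_id //.
by apply: leq_trans (leq_add CB (geq_minr _ _)) _; lia.
Qed.

(** The program computes the insertion of the abstract table: order and
    coordinates of the new state are ins and ins_coord of the old ones, to
    which the results on coordinates apply. *)
Lemma insert_spec s e E (x := rg s vNew) (s' := sem insert_cmd s) :
  new_node s e E ->
  [/\ table s' (ext e x E), rg s' vN = (rg s vN).+1,
      forall v : nat, (v \in ords s') = (v == x) || (v \in ords s)
    & forall h, h != 1 -> lst s' h = lst s h].
Proof.
move=> nn; have [M16 Mn M2 K2 KB] := M_facts.
have H' : rg s' vH = rg s vH by rewrite /s' sem_rg.
have K0 : 0 < K by lia.
have [k1 n1 p1] := search_spec nn.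
have es' : s' = sem (vK ::= vN ;; Rep (Rep shift_body) ;;
  Put aOrd vPos #0 vNew ;; Put aCo vNew #0 vC ;; vN ::= vN + #1) (sem insert_gaps
    (sem (Rep (jump_cmd #1)) (sem (Rep (jump_cmd Cap)) (setr s vPos 0)))).
  by rewrite /s' /insert_cmd !sem_seq !sem_asgn.
have x1 : rg (sem (Rep (jump_cmd #1)) (sem (Rep (jump_cmd Cap)) (setr s vPos 0))) vNew = x.
  by rewrite !sem_rg.
move: (sem (Rep (jump_cmd #1)) _) es' k1 n1 p1 x1 => s1 es' k1 n1 p1 x1.
have p1' : rg s1 vPos = rank e E (ords s1) by rewrite (keeps_ords k1).
have [k2 n2 [p2 c2] z2] := gaps_spec n1 p1'.
have x2 : rg (sem insert_gaps s1) vNew = x by rewrite sem_rg.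
move: (sem insert_gaps _) es' k2 n2 p2 c2 z2 x2 => s2 es' k2 n2 p2 c2 z2 x2.
have k02 := keeps_trans k1 k2.
have e1 := keeps_ords k1; have e2 := keeps_ords k02.
have [eC1 _ _ N1 _] := k1; have [eC2 _ eP2 N2 el2] := k02.
have ec1 : co s1 = co s by rewrite /co eC1.
have ec2 : co s2 = co s by rewrite /co eC2.
rewrite e1 ec1 N1 in p2 c2 z2.
set o := ords s in e1 e2 p2 c2 z2; set p := rank e E o in p2 c2 z2.
have ts := nn_table nn; have NK := nn_count nn; have so : size o = rg s vN := size_ords s.
have pN : p <= rg s vN by rewrite -so find_size.
have cb (v : nat) : v \in o -> co s v <= 2 * K * rg s vN := @t_co _ _ ts v.
have NKK : 2 * K * rg s vN <= 2 * (K * K) by rewrite -mulnA leq_mul2l leq_mul2l (ltnW NK) !orbT.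
have CB : rg s2 vC <= 2 * K * rg s vN + K.
  rewrite c2 /new_coord; case: eqP => // p0.
  by apply: leq_add (geq_minr _ _); apply: cb; apply: mem_nth; rewrite so; lia.
have dropN (v : nat) : v \in drop p o -> p < rg s vN.
  by rewrite -so; apply: contraTltn => le; rewrite drop_oversize.
have bnd (v : nat) : v \in drop (rg s2 vPos) (ords s2) -> co s2 v + rg s2 vZ <= B.
  rewrite p2 e2 ec2 => vd; have [-> _] := z2 (dropN v vd).
  by apply: leq_trans (leq_add (cb v (mem_drop vd)) (leq_add CB (geq_minr _ _))) _; lia.
have pN2 : rg s2 vPos <= rg s2 vN <= K by rewrite p2 N2 pN ltnW.
have uo2 : uniq (ords s2) by rewrite e2; apply: t_uniq ts.
have [h1 h2 h3 h4 h5] := shift_spec uo2 pN2 bnd.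
have [r1 r2 r3 r4] : [/\ rg (sem (Rep (Rep shift_body)) (setr s2 vK (rg s2 vN))) vPos = p,
    rg (sem (Rep (Rep shift_body)) (setr s2 vK (rg s2 vN))) vNew = x,
    rg (sem (Rep (Rep shift_body)) (setr s2 vK (rg s2 vN))) vC = rg s2 vC &
    rg (sem (Rep (Rep shift_body)) (setr s2 vK (rg s2 vN))) vN = rg s vN].
  by rewrite !sem_rg.
rewrite sem_seq sem_asgn sem_seq [ev s2 _]/= N2 in es'.
rewrite p2 e2 ec2 N2 in h1 h2 h3 h4 h5; rewrite N2 in r1 r2 r3 r4.
move: (sem (Rep (Rep _)) _) es' h1 h2 h3 h4 h5 r1 r2 r3 r4 => s3 es' h1 h2 h3 h4 h5 r1 r2 r3 r4.
have NB : clip B (rg s vN + 1) = (rg s vN).+1 by rewrite addn1 clip_id; lia.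
rewrite sem_seq sem_put sem_seq sem_put sem_asgn /= r1 r2 r3 r4 NB in es'.
have N' : rg s' vN = (rg s vN).+1 by rewrite es'.
have xo : x \notin o by apply: nn_notin nn.
have eo' : ords s' = ins p x o.
  apply: (@eq_from_nth _ 0); rewrite size_ords N' ?size_ins ?so // => i iN.
  rewrite nth_ords ?N' // es' /= andbT nth_cat size_takel ?so //.
  case: ltngtP => [ip|ip|->]; last by rewrite subnn.
    by rewrite h1 // nth_take // nth_ords ?(leq_trans ip) // (_ : ar s2 aOrd = ar s aOrd) //; case: k02.
  have -> : i - p = (i - p).-1.+1 by lia.
  rewrite /= nth_drop (_ : p + (i - p).-1 = i.-1); last by lia.
  by rewrite h2 ?ip // nth_ords; [case: k02 => _ -> | lia].
have eco' (v : nat) : co s' v = ins_coord K o (co s) e p x E v.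
  rewrite /co es' /= andbT /ins_coord /= -c2; case: eqP => // _.
  rewrite -/(co s3 v) h3; case: ifP => // vd.
  by have [-> ->] := z2 (dropN v vd).
have es'l h : h != 1 -> lst s' h = lst s h.
  by move=> h1'; rewrite -[lst s' h]/(lst s' h) es' -[lst _ h]/(lst s3 h) h4 el2.
have [t1 t2 t0 tn t3 t4 t5 t6 t7 t8 t9] := ts.
have low i : i < p -> (e (nth 0%N o i) <= E)%R.
  by move=> ip; rewrite (rankP _ t4) // so (leq_trans ip).
have high i : p <= i < size o -> (E <= e (nth 0%N o i))%R.
  by case/andP=> pi io; rewrite leNgt; apply/negP => /ltW; rewrite (rankP _ t4) // ltnNge pi.
split=> //; last by move=> v; rewrite eo' mem_ins.
split.
- by rewrite eo'; apply: ins_uniq.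
- by rewrite eo' mem_ins [0 \in o]t2 orbT.
- by rewrite H'.
- by rewrite es'l.
- apply/allP => v; rewrite eo' mem_ins H' => /orP[/eqP->|vo].
    by rewrite (nn_lt nn) (nn_scratch nn).
  exact: (allP t3).
- by rewrite eo'; apply: ins_sorted; rewrite // so.
- rewrite eo' => v u vo uo; rewrite !eco'; apply: (ins_coords K0 xo t1) => //.
  by rewrite so.
- by rewrite /ext ifN //; apply: contraNneq xo => <-.
- by move=> i iK; rewrite es' /= h5 eP2 t7.
- have wx l : wfl e o l -> wfl (ext e x E) (ords s') l by rewrite eo'; apply: wfl_ext.
  move=> v vi; have v1 : v != 1.
    by move: vi; rewrite eo' mem_ins => /orP[/eqP->|/(allP t3)/andP[]//]; apply: nn_scratch nn.
  rewrite es'l //; move: vi; rewrite eo' mem_ins => /orP[/eqP->|vo].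
    have [_ _ _ _ wl nl vl sl _] := nn.
    split; [by rewrite -eo'; apply: wx | exact: nonneg_ext xo wl nl | | exact: sl].
    by rewrite (val_of_ext _ xo wl) vl /ext eqxx.
  have [wl nl vl sl] := t8 v vo.
  split; [by rewrite -eo'; apply: wx | exact: nonneg_ext xo wl nl | | exact: sl].
  by rewrite (val_of_ext _ xo wl) vl /ext ifN //; apply: contraNneq xo => <-.
move=> v vi; rewrite eco' N' mulnSr.
apply: (ins_bound K0 xo t1 t4 t5 _ low high) => //; first by rewrite so.
by rewrite -eo'.
Qed.

(** * Multiplication of a list of terms by a power of two *)

(** Handles are allocated once and their lists never change, except for the
    scratch list; the exponents of existing nodes do not change either.  So
    whatever was represented before is still represented. *)
Definition extends s (e : nat -> int) s' e' :=
  [/\ table s' e', forall v : nat, v \in ords s -> v \in ords s' /\ e' v = e v,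
      forall v : nat, v \in ords s' -> v \in ords s \/ rg s vH <= v,
      forall h, h < rg s vH -> h != 1 -> lst s' h = lst s h &
      rg s vH <= rg s' vH].

Lemma extends_trans s1 e1 s2 e2 s3 e3 :
  extends s1 e1 s2 e2 -> extends s2 e2 s3 e3 -> extends s1 e1 s3 e3.
Proof.
move=> [_ a1 n1 b1 c1] [t3 a2 n2 b2 c2]; split=> //; last exact: leq_trans c2.
- by move=> v /a1[/a2[-> ->] ->].
- move=> v /n2[/n1//|le]; right; exact: leq_trans le.
by move=> h lt h1; rewrite b2 ?b1 // (leq_trans lt).
Qed.

Lemma extends_keeps s e s' : table s e -> keeps 1 s s' -> rg s vH = rg s' vH ->
  extends s e s' e.
Proof.
move=> ts k eH; have o := keeps_ords k; have [_ _ _ _ el] := k.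
split; rewrite ?o -?eH //; first by apply: (table_keeps ts k); rewrite ?(scratch_notin ts) ?eH.
- by move=> v vo; left.
by move=> h _; apply: el.
Qed.

(** z bounds the number of terms, and q the number of terms in the exponents of
    its nodes.  Both are needed to keep the lists of new nodes short: the list
    of a shifted node has the length of an old one plus that of the shift. *)
Record vlist s (e : nat -> int) (z q h : nat) : Prop := Vlist {
  vl_lt : h < rg s vH;
  vl_scratch : h != 1;
  vl_wfl : wfl e (ords s) (lst s h);
  vl_size : size (lst s h) <= z;
  vl_deep : all (fun x : term => size (lst s x.1) <= q) (lst s h) }.

Lemma node_lt s e (v : nat) : table s e -> v \in ords s -> v < rg s vH /\ v != 1.
Proof. by move=> ts /(allP (t_lt ts))/andP. Qed.

Lemma vlist_mono s e z q z' q' h :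
  vlist s e z q h -> z <= z' -> q <= q' -> vlist s e z' q' h.
Proof.
move=> [l1 l2 l3 l4 l5] lez le; split=> //; first exact: leq_trans lez.
by apply: sub_all l5 => x /leq_trans; apply.
Qed.

Lemma extends_vlist s e s' e' z q h : table s e -> extends s e s' e' ->
  vlist s e z q h ->
  [/\ vlist s' e' z q h, lst s' h = lst s h,
      val_of e' (lst s' h) = val_of e (lst s h) &
      nonneg e (lst s h) -> nonneg e' (lst s' h)].
Proof.
move=> ts [t' eo _ el eH] [l1 l2 l3 l4 l5].
have elh : lst s' h = lst s h by apply: el.
have [a so st] := l3.
have ee x : x \in lst s h -> e' x.1 = e x.1 by move=> /(allP a)/eo[].
split=> //.
- split; rewrite ?elh //; first exact: leq_trans eH.
    split=> //; first by apply/allP => x /(allP a)/eo[].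
    rewrite (@eq_in_sorted _ (mem (lst s h)) _ (desc e)) //.
    by move=> x y xl yl; rewrite /desc !ee.
  apply/allP => x xl; have xo := allP a _ xl; have [xH x1] := node_lt ts xo.
  by rewrite el //; apply: (allP l5).
- by rewrite elh; apply: val_ext => v /mapP[x xl ->]; apply: ee.
by rewrite elh => /allP nn; apply/allP => x xl; rewrite ee ?nn.
Qed.

Lemma map_id_lst (l : seq term) : map (sgf false) l = l.
Proof. by rewrite -[RHS]map_id; apply: eq_map. Qed.

(** Merging the list of node v with the one of value mz yields a list for the
    exponent e v + mz. *)
Lemma shift_node u e (v : nat) z1 q z2 (mz : int) (x := rg u vH) (m := rg u vM)
    (u' := sem node_cmd
      (setr (setr (setr (setr u vNew x) vA v) vB m) vD x)) :
  table u e -> v \in ords u -> size (lst u v) <= z2 ->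
  vlist u e z1 q m -> nonneg e (lst u m) -> val_of e (lst u m) = mz%:~R%R ->
  z1 + z2 <= n -> rg u vN < K -> x < B ->
  exists e', [/\ extends u e u' e',
    rg u' vN = (rg u vN).+1 /\ rg u' vH = x.+1,
    x \in ords u', e' x = (e v + mz)%R & size (lst u' x) <= z1 + z2].
Proof.
move=> ts vo sv vm nm mE zn NK xB; have [M16 Mn M2 K2 KB] := M_facts.
have [ltv v1] := node_lt ts vo.
have [wv nv vv _] := t_val ts vo.
have [ltm m1 wm sm dm] := vm.
set u0 := setr _ vD x in u' *.
pose u1 := sem (merge_cmd false) u0.
have [l1 lo] : lst u1 x = merge (desc e) (lst u v) (lst u m) /\
    forall h, h != x -> lst u1 h = lst u h.
  have leM : size (lst u0 (rg u0 vA)) + size (lst u0 (rg u0 vB)) <= M.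
    by rewrite /= -[lst u0 v]/(lst u v) -[lst u0 m]/(lst u m); lia.
  have ad : rg u0 vA != rg u0 vD by rewrite /= neq_ltn ltv.
  have bd : rg u0 vB != rg u0 vD by rewrite /= neq_ltn ltm.
  have [l1 lo] := @merge_spec false u0 ad bd leM; split; last exact: lo.
  rewrite map_id_lst -[dco u0]/(dco u) /= in l1.
  by rewrite -[lst u0 v]/(lst u v) -[lst u0 m]/(lst u m) (merge_dco ts wv wm) in l1.
have xo : x \notin ords u.
  by apply/negP => /(node_lt ts)[]; rewrite ltnn.
have x1 : x != 1 by rewrite neq_ltn (t_scr ts) orbT.
have x_lt h : h < x -> h != x by move=> lt; rewrite neq_ltn lt.
have k1 : keeps x u u1.
  by split; rewrite /u1 ?sem_ar ?sem_rg.
have H1 : rg u1 vH = x by rewrite /u1 sem_rg.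
have New1 : rg u1 vNew = x by rewrite /u1 sem_rg.
have c1 : clip B (x + 1) = x.+1 by rewrite addn1 clip_id.
have eu' : u' = sem insert_cmd (setr u1 vH x.+1).
  rewrite /u' sem_seq sem_seq sem_asgn -/u1.
  by rewrite -[ev u1 _]/(clip B (rg u1 vH + 1)) H1 c1.
have RN : rg u1 vN = rg u vN by rewrite /u1 sem_rg.
clearbody u1 u'; rename u1 into t.
have k2 : keeps x u (setr t vH x.+1).
  by case: (k1) => ? ? ? ? ?; split; assumption.
have t2 : table (setr t vH x.+1) e by apply: (table_keeps ts k2 xo); apply: leqnSn.
have o2 : ords (setr t vH x.+1) = ords u := keeps_ords k2.
have w12 : wfl e (ords u) (merge (desc e) (lst u v) (lst u m)) by apply: wfl_merge.
have size12 : size (merge (desc e) (lst u v) (lst u m)) = size (lst u v) + size (lst u m).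
  by rewrite size_merge size_cat.
have nn : new_node (setr t vH x.+1) e (e v + mz)%R.
  have New2 : rg (setr t vH x.+1) vNew = x := New1.
  have l2 : lst (setr t vH x.+1) x = merge (desc e) (lst u v) (lst u m) := l1.
  split; rewrite ?New2 ?o2 ?l2; try assumption.
  - exact: ltnSn.
  - exact: nonneg_merge.
  - by rewrite val_merge vv mE rmorphD.
  - by rewrite size12; lia.
  by rewrite [rg _ _]RN.
have [t3 N3 s3 l3] := insert_spec nn.
rewrite -eu' in t3 N3 s3 l3; rewrite /= New1 in t3 s3.
have H3 : rg u' vH = x.+1 by rewrite eu' sem_rg.
exists (ext e x (e v + mz)%R); split=> //.
- split=> // [y yo|y|h hx h1|]; last by rewrite H3.
  + split; first by rewrite s3 o2 yo orbT.
    by rewrite /ext ifN //; apply: contraNneq xo => <-.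
  + by rewrite s3 o2 => /orP[/eqP->|]; [right | left].
  by rewrite l3 // -[lst _ h]/(lst t h); case: k1 => _ _ _ _ -> //; apply: x_lt.
- by rewrite N3 /= RN.
- by rewrite s3 eqxx.
- by rewrite /ext eqxx.
by rewrite l3 // -[lst _ x]/(lst t x) l1 size12; lia.
Qed.

Lemma scaleE u (j := rg u vG) (x := rg u vH)
  (t := sem node_cmd (setr (setr (setr (setr u vNew x)
     vA (ar u aId (rg u vS) j)) vB (rg u vM)) vD x)) :
  j < ar u aLen (rg u vS) 0 ->
  sem scale_body u =
    setr (put_item t (rg u vHS) j (x, ar t aSg (rg u vS) j)) vG (clip B (j + 1)).
Proof.
move=> lt; have r y : y \notin wvar node_cmd -> y \notin [:: vNew; vA; vB; vD] ->
  rg t y = rg u y.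
  by move=> y1 y2; rewrite /t sem_rg //; move: y2; rewrite !inE /=; do 4?[case: eqP => //].
rewrite sem_if /= -/j; case: eqP => [e|_]; first by move: lt; rewrite -subn_gt0 e.
rewrite sem_seq sem_asgn sem_seq sem_asgn sem_seq sem_asgn sem_seq sem_asgn sem_seq.
rewrite -[sem node_cmd _]/t sem_seq sem_put sem_seq sem_put sem_asgn /=.
have rN : rg t vNew = x by rewrite /t sem_rg.
by rewrite rN !r.
Qed.

Lemma scale_end u : ar u aLen (rg u vS) 0 <= rg u vG -> sem scale_body u = u.
Proof. by rewrite -subn_eq0 sem_if /= => ->. Qed.

(** The shift preserves the order of the exponents, so the new terms can be
    written in the order of the old ones. *)
Lemma scale_spec s e z1 q z2 (mz : int) (l := lst s (rg s vS)) (h := rg s vH)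
    (s' := sem scale_cmd s) :
  table s e -> vlist s e z2 z2 (rg s vS) -> vlist s e z1 q (rg s vM) ->
  nonneg e (lst s (rg s vM)) -> val_of e (lst s (rg s vM)) = mz%:~R%R ->
  z1 + z2 <= n -> rg s vN + size l <= K -> h + size l + 1 <= B ->
  exists e', [/\ extends s e s' e', vlist s' e' z2 (z1 + z2) h /\ rg s' vHS = h,
    val_of e' (lst s' h) = (2%:R ^ mz * val_of e l)%R,
    rg s' vH = h + size l + 1 & rg s' vN = rg s vN + size l].
Proof.
move=> ts vS' vM' nm mE zn NK HB; have [M16 Mn M2 K2 KB] := M_facts.
have lB : size l <= B by lia.
have lM : size l <= M by have := vl_size vS'; rewrite -/l; lia.
pose s0 := setr (seta (setr (setr s vHS h) vH h.+1) aLen h 0 (size l)) vG 0.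
have es' : s' = sem (Rep scale_body) s0.
  rewrite /s' /scale_cmd sem_seq sem_asgn sem_seq sem_asgn sem_seq sem_put sem_seq sem_asgn.
  by rewrite /= addn1 clip_id ?/s0 /l ?size_lst //; lia.
have hS := vl_lt vS'; have hM := vl_lt vM'.
have ho : h \notin ords s by apply/negP => /(node_lt ts)[]; rewrite ltnn.
have k0 : keeps h s s0.
  split=> // y yh; apply: lst_eq => //=.
  by rewrite (negPf yh).
have t0 : table s0 e by apply: (table_keeps ts k0 ho); apply: leqnSn.
have h1 : h != 1 by rewrite neq_ltn (t_scr ts) orbT.
pose I k u := exists e' j,
  [/\ extends s e u e', rg u vG = j /\ j <= size l, (k <= j) || (j == size l),
      [/\ rg u vHS = h, rg u vS = rg s vS, rg u vM = rg s vM,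
          rg u vH = h + j + 1 & rg u vN = rg s vN + j] &
  [/\ h \notin ords u, ar u aLen h 0 = size l &
    forall i, i < j -> let x := nth (0, 0) l i in
      [/\ (item u h i).1 \in ords u, e' (item u h i).1 = (e x.1 + mz)%R,
          (item u h i).2 = x.2 & size (lst u (item u h i).1) <= z1 + z2]]].
have : I M s'.
  rewrite es'; apply: rep_inv.
    exists e, 0; split.
    - split=> [|||y yh y1|]; [exact: t0 | by move=> v vo; rewrite (keeps_ords k0) |
      by move=> v; rewrite (keeps_ords k0); left | | exact: leqnSn].
      by case: k0 => _ _ _ _ -> //; rewrite neq_ltn yh.
    - by split.
    - by [].
    - by split; rewrite //= ?addn0 ?addn1.
    by split; rewrite ?(keeps_ords k0) //= !eqxx.
  move=> k u kM [e' [j [ext_u [uG jl] prog [uHS uS uM uH uN] [hu lenu IHu]]]].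
  have [vSu elS _ _] := extends_vlist ts ext_u vS'.
  have [vMu elM valM nMu] := extends_vlist ts ext_u vM'.
  have [ge|lt] := leqP (size l) j.
    rewrite scale_end ?uS ?uG -?size_lst ?elS //; exists e', j; split=> //.
    by apply/orP; right; rewrite eqn_leq jl.
  have [tu eou nou elu eHu] := ext_u.
  have ltj : rg u vG < ar u aLen (rg u vS) 0 by rewrite uG uS -size_lst elS.
  rewrite (scaleE ltj) uHS uS uG uM uH.
  set x := nth (0, 0) l j.
  have xl : x \in l by apply: mem_nth.
  have ix : item u (rg s vS) j = x by rewrite /x /l -elS nth_lst // elS.
  have idx : ar u aId (rg s vS) j = x.1 by rewrite -ix.
  have [ax sx sortx] := vl_wfl vSu.
  have xo : x.1 \in ords u by rewrite elS in ax; apply: (allP ax).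
  have xs : size (lst u x.1) <= z2.
    by have := vl_deep vSu; rewrite elS => /allP; apply.
  have NKu : rg u vN < K.
    by rewrite uN; apply: leq_trans NK; rewrite ltn_add2l.
  have HBu : rg u vH < B.
    by rewrite uH; apply: leq_trans HB; rewrite ltn_add2r ltn_add2l.
  have vMu1 : vlist u e' z1 q (rg u vM) by rewrite uM.
  have nMu1 : nonneg e' (lst u (rg u vM)) by rewrite uM; apply: nMu.
  have mEu : val_of e' (lst u (rg u vM)) = mz%:~R%R by rewrite uM valM.
  have [e'' [ext2 [N2 H2] yo ey ys]] := shift_node tu xo xs vMu1 nMu1 mEu zn NKu HBu.
  rewrite idx; rewrite uM uH in ext2 N2 H2 yo ey ys.
  set y := h + j + 1 in ext2 N2 H2 yo ey ys *.
  have rt z : z \notin wvar node_cmd -> z \notin [:: vNew; vA; vB; vD] ->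
     rg (sem node_cmd (setr (setr (setr (setr u vNew y) vA x.1) vB (rg s vM)) vD y)) z = rg u z.
    by move=> z1' z2'; rewrite sem_rg //; move: z2'; rewrite !inE /=; do 4?[case: eqP => //].
  have [[rHS rS] rM] := (rt vHS isT isT, rt vS isT isT, rt vM isT isT).
  clear rt; move: (sem node_cmd _) ext2 N2 H2 yo ey ys rHS rS rM => t.
  move=> ext2 N2 H2 yo ey ys rHS rS rM.
  have yh : h < y by rewrite /y addn1 ltnS leq_addr.
  have ext12 := extends_trans ext_u ext2.
  have [t2 eo2 no2 el2 eH2] := ext2.
  have hNt : h \notin ords t.
    by apply/negP => /no2[|]; [apply/negP | rewrite uH leqNgt yh].
  set u' := setr _ _ _.
  have k3 : keeps h t u'.
    split=> // z zh; apply: lst_eq => // i _.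
    by rewrite /u' item_setr item_put (negPf zh).
  have o3 := keeps_ords k3.
  have t3 : table u' e'' by apply: (table_keeps t2 k3 hNt).
  have sgt : ar t aSg (rg s vS) j = x.2.
    have e1 : lst t (rg s vS) = lst u (rg s vS).
      by apply: el2; [apply: vl_lt vSu | apply: vl_scratch vS'].
    have := @nth_lst (0, 0) t (rg s vS) j; rewrite e1 elS => /(_ lt).
    by rewrite -/l -/x => ->.
  have lenh : ar t aLen h 0 = size l.
    have : lst t h = lst u h by apply: el2; rewrite ?uH.
    by move=> e1; rewrite -size_lst e1 size_lst lenu.
  have itemt i : i < size l -> item t h i = item u h i.
    have e1 : lst t h = lst u h by apply: el2; rewrite ?uH.
    move=> il; have := @nth_lst (0, 0) t h i; rewrite e1 size_lst lenu => /(_ il) <-.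
    by rewrite nth_lst // size_lst lenu.
  exists e'', j.+1; split.
  - have [_ eo12 no12 el12 eH12] := ext12; split=> //.
    move=> z zh z1'; have [_ _ _ _ el3] := k3.
    by rewrite el3 ?el12 // neq_ltn zh.
  - by split; [rewrite /u' rg_setr addn1 clip_id // (leq_trans lt lB) | exact: lt].
  - case/orP: prog => [le|/eqP e1]; first by rewrite ltnS le.
    by move: lt; rewrite e1 ltnn.
  - by rewrite /u' /= rHS rS rM H2 N2 uHS uS uM uN /y !addnS !addn0.
  split; rewrite ?o3 // => i ij x'.
  have [_ _ _ _ el3] := k3.
  have idn v : v \in ords t -> lst u' v = lst t v.
    by move=> vo; apply: el3; apply: contraNneq hNt => <-.
  have -> : item u' h i = if i == j then (y, x.2) else item t h i.
    by rewrite /u' item_setr item_put eqxx sgt.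
  case: (i =P j) => [ij'|ij'].
    have ex : e' x.1 = e x.1.
      by have [a _ _] := vl_wfl vS'; case: (eou x.1) => //; apply: (allP a).
    by rewrite /x' ij' -/x; split; rewrite /= ?idn // ey ex.
  have {ij ij'} ij : i < j by move: ij ij'; rewrite ltnS leq_eqVlt => /orP[/eqP|].
  have [i1 i2 i3 i4] := IHu i ij.
  rewrite itemt; last exact: ltn_trans lt.
  have [io ie] := eo2 _ i1; split; [exact: io | by rewrite ie | exact: i3 |].
  by rewrite idn // el2 //; case: (node_lt tu i1).
case=> e' [j [[ts' eo no el eH] [_ jl] prog [uHS uS uM uH uN] [hu lenu IHu]]].
have ej : j = size l.
  case/orP: prog => [le|/eqP//].
  by apply/eqP; rewrite eqn_leq jl (leq_trans lM le).
rewrite ej in uH uN IHu.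
have lE : size (lst s' h) = size l by rewrite size_lst.
have itl i : i < size l -> nth (0, 0) (lst s' h) i = item s' h i.
  by move=> il; rewrite nth_lst // lE.
exists e'; split=> //.
  split=> //; split=> //.
  - by rewrite uH addn1 ltnS leq_addr.
  - split.
    + by apply/(all_nthP (0, 0)) => i; rewrite lE => il; rewrite itl //; case: (IHu i il).
    + apply/(all_nthP (0, 0)) => i; rewrite lE => il; rewrite itl //.
      have [_ _ -> _] := IHu i il.
      by have [_ ok _] := vl_wfl vS'; apply: (all_nthP (0, 0) ok).
    have [_ _ so] := vl_wfl vS'; apply/(sortedP (0, 0)) => i; rewrite lE => il.
    rewrite !itl //; last exact: ltnW.
    have [_ e1 _ _] := IHu i (ltnW il); have [_ e2 _ _] := IHu i.+1 il.
    rewrite /desc e1 e2 lerD2r.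
    by have := so => /(sortedP (0, 0))/(_ i il).
  - by rewrite lE; apply: (vl_size vS').
  by apply/(all_nthP (0, 0)) => i; rewrite lE => il; rewrite itl //; case: (IHu i il).
rewrite /val_of !(big_nth (0, 0)) lE mulr_sumr !big_mkord; apply: eq_bigr => [[i il]] _ /=.
rewrite itl // /term_val; have [_ -> -> _] := IHu i il.
by rewrite addrC expfzDr // mulrCA.
Qed.

(** * Products in the group *)

Lemma add_spec (a b : nat) u e z z' q (x := rg u vH) (u' := sem (add_cmd a b) u) :
  b != vA -> table u e -> vlist u e z q (rg u a) -> vlist u e z' q (rg u b) ->
  z + z' <= n -> x < B ->
  [/\ extends u e u' e, vlist u' e (z + z') q x /\ rg u' vD = x,
      val_of e (lst u' x) = (val_of e (lst u (rg u a)) + val_of e (lst u (rg u b)))%R,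
      nonneg e (lst u (rg u a)) -> nonneg e (lst u (rg u b)) -> nonneg e (lst u' x)
    & rg u' vH = x.+1].
Proof.
move=> bA ts la lb zn xB; have [M16 Mn M2 K2 KB] := M_facts.
have x1 : x != 1 by rewrite neq_ltn (t_scr ts) orbT.
have x_lt h : h < x -> h != x by move=> lt; rewrite neq_ltn lt.
have xo : x \notin ords u by apply/negP => /(node_lt ts)[]; rewrite ltnn.
pose u0 := setr (setr (setr u vA (rg u a)) vB (rg u b)) vD x.
pose t := sem (merge_cmd false) u0.
have eu' : u' = setr t vH x.+1.
  rewrite /u' sem_seq sem_asgn sem_seq sem_asgn sem_seq sem_asgn sem_seq sem_asgn.
  have -> : ev (setr u vA (ev u a)) b = rg u b by rewrite /= (negPf bA).
  rewrite -[sem (merge_cmd false) _]/t.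
  have -> : ev t (vH + #1)%I = clip B (x + 1) by rewrite -[LHS]/(clip B (rg t vH + 1)) /t sem_rg.
  by rewrite addn1 clip_id.
have [l1 lo] : lst t x = merge (desc e) (lst u (rg u a)) (lst u (rg u b)) /\
    forall h, h != x -> lst t h = lst u h.
  have leM : size (lst u0 (rg u0 vA)) + size (lst u0 (rg u0 vB)) <= M.
    have := vl_size la; have := vl_size lb.
    rewrite /= -![lst u0 _]/(lst u _); lia.
  have ad : rg u0 vA != rg u0 vD by apply: x_lt; apply: (vl_lt la).
  have bd : rg u0 vB != rg u0 vD by apply: x_lt; apply: (vl_lt lb).
  have [l1 lo] := @merge_spec false u0 ad bd leM; split; last exact: lo.
  rewrite map_id_lst -[dco u0]/(dco u) /= in l1.
  by rewrite -![lst u0 _]/(lst u _) (merge_dco ts (vl_wfl la) (vl_wfl lb)) in l1.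
have k1 : keeps x u t.
  by split; rewrite /t ?sem_ar ?sem_rg.
have D1 : rg t vD = x by rewrite /t sem_rg.
clearbody t u'.
have k2 : keeps x u (setr t vH x.+1).
  by case: (k1) => ? ? ? ? ?; split; assumption.
have t2 : table (setr t vH x.+1) e by apply: (table_keeps ts k2 xo); apply: leqnSn.
have o2 : ords (setr t vH x.+1) = ords u := keeps_ords k2.
have l2 : lst (setr t vH x.+1) x = merge (desc e) (lst u (rg u a)) (lst u (rg u b)) := l1.
rewrite eu' l2; split.
- split; [exact: t2 | by move=> v; rewrite o2 | by move=> v; rewrite o2; left | | exact: leqnSn].
  by move=> h hx _; apply: lo; apply: x_lt.
- split; last exact: D1.
  split; rewrite ?l2 ?o2; [exact: ltnSn | exact: x1 | | |].
  + exact: wfl_merge (vl_wfl la) (vl_wfl lb).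
  + by rewrite size_merge size_cat leq_add ?(vl_size la) ?(vl_size lb).
  rewrite (perm_all _ (permEl (perm_merge _ _ _))) all_cat.
  apply/andP; split; apply/allP => y yl.
    have [ay _ _] := vl_wfl la; have yo : y.1 \in ords u by apply: (allP ay).
    rewrite [lst _ _]lo; last by apply: x_lt; case: (node_lt ts yo).
    by apply: (allP (vl_deep la)).
  have [ay _ _] := vl_wfl lb; have yo : y.1 \in ords u by apply: (allP ay).
  rewrite [lst _ _]lo; last by apply: x_lt; case: (node_lt ts yo).
  by apply: (allP (vl_deep lb)).
- by rewrite val_merge.
- exact: nonneg_merge.
by rewrite rg_setr.
Qed.

(** Cell d of the stack represents the value g of a subexpression with z
    symbols.  The second component, which may be added to exponents, has
    nonnegative exponents itself. *)
Record entry s (e : nat -> int) (d z : nat) (g : ZhalfZ) : Prop := Entry {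
  en_r : vlist s e z z (ar s aSR d 0);
  en_m : vlist s e z z (ar s aSM d 0);
  en_rval : val_of e (lst s (ar s aSR d 0)) = val g.1;
  en_mval : val_of e (lst s (ar s aSM d 0)) = g.2%:~R%R;
  en_nonneg : nonneg e (lst s (ar s aSM d 0)) }.

Lemma extends_entry s e s' e' d z g : table s e -> extends s e s' e' ->
  ar s' aSR d 0 = ar s aSR d 0 -> ar s' aSM d 0 = ar s aSM d 0 ->
  entry s e d z g -> entry s' e' d z g.
Proof.
move=> ts ex er em [h1 h2 h3 h4 h5]; split; rewrite ?er ?em.
- by have [] := extends_vlist ts ex h1.
- by have [] := extends_vlist ts ex h2.
- by have [_ _ -> _] := extends_vlist ts ex h1.
- by have [_ _ -> _] := extends_vlist ts ex h2.
by have [_ _ _ ->] := extends_vlist ts ex h2.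
Qed.

Definition below d s s' := forall i, i < d ->
  ar s' aSR i 0 = ar s aSR i 0 /\ ar s' aSM i 0 = ar s aSM i 0.

(** The lengths of both lists, and of the exponents of their nodes, are
    additive under products; this is what bounds them by the number of
    symbols. *)
Lemma mul_spec s e d z1 z2 (g1 g2 : ZhalfZ) (s' := sem mul_cmd s) :
  table s e -> rg s vSP = d.+2 -> entry s e d.+1 z1 g1 -> entry s e d z2 g2 ->
  z1 + z2 <= n -> rg s vN + n <= K -> rg s vH + n + 3 <= B ->
  exists e', [/\ extends s e s' e', entry s' e' d (z1 + z2) (g1 * g2)%g,
    rg s' vSP = d.+1 /\ below d s s',
    rg s' vH <= rg s vH + n + 3 & rg s' vN <= rg s vN + n].
Proof.
move=> ts SPd en1 en2 zn NK HB; have [M16 Mn M2 K2 KB] := M_facts.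
pose s1 := setr (setr (setr (setr s vR (ar s aSR d.+1 0)) vM (ar s aSM d.+1 0))
  vS (ar s aSR d 0)) vE (ar s aSM d 0).
have es' : s' = sem (scale_cmd ;;
    add_cmd vR vHS ;; Put aSR (vSP - #2) #0 vD ;;
    add_cmd vM vE ;; Put aSM (vSP - #2) #0 vD ;;
    vSP ::= vSP - #1) s1.
  rewrite /s' /mul_cmd sem_seq sem_asgn sem_seq sem_asgn sem_seq sem_asgn sem_seq sem_asgn.
  by rewrite /= SPd subn1 subn2.
clearbody s'.
have k1 : keeps 1 s s1 by [].
have ex1 : extends s e s1 e by apply: (extends_keeps ts k1).
have t1 : table s1 e by case: ex1.
have [rR1 _ vR1 _] := extends_vlist ts ex1 (en_r en1).
have [rM1 _ vM1 nM1] := extends_vlist ts ex1 (en_m en1).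
have [rR2 _ vR2 _] := extends_vlist ts ex1 (en_r en2).
have [rM2 _ vM2 nM2] := extends_vlist ts ex1 (en_m en2).
move: (etrans vR1 (en_rval en1)) (etrans vM1 (en_mval en1)) => {}vR1 {}vM1.
move: (etrans vR2 (en_rval en2)) (etrans vM2 (en_mval en2)) => {}vR2 {}vM2.
move/(_ (en_nonneg en1)): nM1 => nM1; move/(_ (en_nonneg en2)): nM2 => nM2.
have sz : size (lst s (ar s aSR d 0)) <= n by apply: leq_trans (vl_size (en_r en2)) _; lia.
have [||e1 [ex2 [vl2 HS2] val2 H2 N2]] := scale_spec t1 rR2 rM1 nM1 vM1 zn.
- by apply: leq_trans NK; apply: leq_add.
- by apply: leq_trans HB; apply: leq_add => //; apply: leq_add.
rewrite sem_seq in es'.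
have SR2 : ar (sem scale_cmd s1) aSR = ar s aSR by rewrite sem_ar.
have SM2 : ar (sem scale_cmd s1) aSM = ar s aSM by rewrite sem_ar.
have SP2 : rg (sem scale_cmd s1) vSP = d.+2 by rewrite sem_rg.
have gR2 : rg (sem scale_cmd s1) vR = ar s aSR d.+1 0 by rewrite sem_rg.
have gM2 : rg (sem scale_cmd s1) vM = ar s aSM d.+1 0 by rewrite sem_rg.
have gE2 : rg (sem scale_cmd s1) vE = ar s aSM d 0 by rewrite sem_rg.
move: (sem scale_cmd s1) es' ex2 vl2 HS2 val2 H2 N2 SR2 SM2 SP2 gR2 gM2 gE2 => u2.
move=> es' ex2 vl2 HS2 val2 H2 N2 SR2 SM2 SP2 gR2 gM2 gE2.
have t2 : table u2 e1 by case: ex2.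
have q1 : z1 <= z1 + z2 by rewrite leq_addr.
have q2 : z2 <= z1 + z2 by rewrite leq_addl.
have [a1 _ va1 _] := extends_vlist t1 ex2 rR1.
have [a2 _ va2 na2] := extends_vlist t1 ex2 rM1.
have [a4 _ va4 na4] := extends_vlist t1 ex2 rM2.
have b1 : vlist u2 e1 z1 (z1 + z2) (rg u2 vR) by rewrite gR2; apply: (vlist_mono a1).
have b2 : vlist u2 e1 z2 (z1 + z2) (rg u2 vHS) by rewrite HS2.
have HuB : rg u2 vH < B.
  by rewrite H2 -addnS; apply: leq_trans HB; apply: leq_add => //; apply: leq_add.
have [//|ex3 [c1 D3] val3 _ H3] := add_spec _ t2 b1 b2 zn HuB.
rewrite sem_seq in es'.
have gM3 : rg (sem (add_cmd vR vHS) u2) vM = ar s aSM d.+1 0 by rewrite sem_rg.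
have gE3 : rg (sem (add_cmd vR vHS) u2) vE = ar s aSM d 0 by rewrite sem_rg.
have SP3 : rg (sem (add_cmd vR vHS) u2) vSP = d.+2 by rewrite sem_rg.
have N3 : rg (sem (add_cmd vR vHS) u2) vN = rg u2 vN by rewrite sem_rg.
have SR3 : ar (sem (add_cmd vR vHS) u2) aSR = ar s aSR by rewrite sem_ar.
have SM3 : ar (sem (add_cmd vR vHS) u2) aSM = ar s aSM by rewrite sem_ar.
move: (sem (add_cmd vR vHS) u2) es' ex3 c1 D3 val3 H3 gM3 gE3 SP3 N3 SR3 SM3 => u3.
move=> es' ex3 c1 D3 val3 H3 gM3 gE3 SP3 N3 SR3 SM3.
rewrite sem_seq sem_put /= SP3 D3 subn2 /= in es'.
set u4 := seta u3 _ _ _ _ in es'.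
have t3 : table u3 e1 by case: ex3.
have k4 : keeps 1 u3 u4 by [].
have ex4 : extends u3 e1 u4 e1 by apply: (extends_keeps t3 k4).
have t4 : table u4 e1 by case: ex4.
have ex24 := extends_trans ex3 ex4.
have [d2 _ vd2 nd2] := extends_vlist t2 ex24 a2.
have [d4 _ vd4 nd4] := extends_vlist t2 ex24 a4.
have [d1 _ vd1 _] := extends_vlist t3 ex4 c1.
have f2 : vlist u4 e1 z1 (z1 + z2) (rg u4 vM) by rewrite [rg u4 vM]gM3; apply: (vlist_mono d2).
have f4 : vlist u4 e1 z2 (z1 + z2) (rg u4 vE) by rewrite [rg u4 vE]gE3; apply: (vlist_mono d4).
have HuB4 : rg u4 vH < B.
  rewrite [rg u4 vH]H3 H2 -!addnS; apply: leq_trans HB.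
  by apply: leq_add => //; apply: leq_add.
have [//|ex5 [c5 D5] val5 nn5 H5] := add_spec _ t4 f2 f4 zn HuB4.
rewrite sem_seq in es'.
have SP5 : rg (sem (add_cmd vM vE) u4) vSP = d.+2 by rewrite sem_rg.
have N5 : rg (sem (add_cmd vM vE) u4) vN = rg u2 vN by rewrite sem_rg.
have SR5 : ar (sem (add_cmd vM vE) u4) aSR = ar u4 aSR by rewrite sem_ar.
have SM5 : ar (sem (add_cmd vM vE) u4) aSM = ar s aSM by rewrite sem_ar // [LHS]SM3.
move: (sem (add_cmd vM vE) u4) es' ex5 c5 D5 val5 nn5 H5 SP5 N5 SR5 SM5 => u5.
move=> es' ex5 c5 D5 val5 nn5 H5 SP5 N5 SR5 SM5.
rewrite sem_seq sem_put sem_asgn /= SP5 D5 subn2 subn1 /= in es'.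
have t5 : table u5 e1 by case: ex5.
have k6 : keeps 1 u5 s' by rewrite es'.
have H6 : rg s' vH = rg u5 vH by rewrite es'.
have ex6 : extends u5 e1 s' e1 by apply: (extends_keeps t5 k6); rewrite H6.
have ex46 := extends_trans ex5 ex6.
have [g1' _ vg1 _] := extends_vlist t4 ex46 d1.
have [g5' _ vg5 ng5] := extends_vlist t5 ex6 c5.
have srd : ar s' aSR d 0 = rg u2 vH by rewrite es' /= SR5 /= !eqxx.
have smd : ar s' aSM d 0 = rg u4 vH by rewrite es' /= !eqxx.
exists e1; split.
- exact: (extends_trans ex1 (extends_trans ex2 (extends_trans ex24 ex46))).
- split; rewrite ?srd ?smd; [exact: g1' | exact: g5' | | |].
  + rewrite vg1 vd1 val3 gR2 HS2 va1 vR1.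
    by rewrite [val_of e1 _]val2 vR2.
  + by rewrite vg5 val5 [rg u4 vM]gM3 [rg u4 vE]gE3 vd2 vd4 va2 va4 vM1 vM2 -rmorphD.
  apply: ng5; apply: nn5; rewrite ?[rg u4 vM]gM3 ?[rg u4 vE]gE3; [apply: nd2 | apply: nd4].
    by apply: na2.
  by apply: na4.
- split; first by rewrite es' rg_setr.
  move=> i id; rewrite es' /= SR5 SM5 /= (ltn_eqF id) /=.
  by rewrite SR3.
- rewrite H6 H5 [rg u4 vH]H3 H2 -!addnS; apply: leq_add => //; exact: leq_add.
by rewrite es' /= N5 N2; apply: leq_add.
Qed.

(** * The swap *)

(** For p < B, saturating the divisor at B does not affect exact division:
    when the divisor exceeds B, only p = 0 is divisible. *)
Lemma div_sat p g : p < B -> 0 < g ->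
  (p %/ minn g B * minn g B == p) = (g %| p) /\
  (g %| p -> p %/ minn g B = p %/ g).
Proof.
move=> pB g0; have [le|lt] := leqP g B.
  by split=> //; rewrite dvdn_eq.
rewrite [p %/ B]divn_small //; have [->|p0] := posnP p.
  by rewrite dvdn0 div0n.
have ng : (g %| p) = false by apply/negP => /(dvdn_leq p0); rewrite leqNgt (ltn_trans pB).
by rewrite ng mul0n eq_sym gtn_eqF.
Qed.

Lemma divideE u (f := minn (2 ^ (rg u vX - rg u vL)) B) (u' := sem divide_cmd u)
    (p := rg u vP) (q := rg u vQ) :
  pow_ok u -> p < B -> q < B ->
  [/\ rg u' vP = p %/ f, rg u' vQ = q %/ f
    & rg u' vFail = if (p %/ f * f == p) && (q %/ f * f == q) then rg u vFail else 1].
Proof.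
move=> hp pB qB; have [_ _ _ KD DB] := M_facts.
have cK : clip B K = K by apply: clip_id; lia.
have c x : x < B -> x - clip B (x %/ f * f) == 0 = (x %/ f * f == x).
  move=> xB; have le : x %/ f * f <= x by apply: leq_trunc_div.
  by rewrite clip_id ?(leq_trans le (ltnW xB)) // subn_eq0 eqn_leq le.
rewrite /u' sem_seq sem_asgn sem_seq sem_if sem_seq sem_if sem_seq !sem_asgn !sem_skip.
have fE : ev u (pow2 (vX - vL)%I) = f by rewrite ev_pow2.
rewrite fE; move: (c _ pB) (c _ qB); rewrite /p /q.
by case: (_ == rg u vP); case: (_ == rg u vQ) => cp cq; rewrite /= cp /= cq.
Qed.

Lemma carryE u (k := rg u vK) (x := item u (rg u vR) k.-1)
    (u1 := sem divide_cmd (setr u vX (co u x.1)))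
    (p := clip B (rg u1 vP + (1 - x.2))) (q := clip B (rg u1 vQ + x.2))
    (u' := sem carry_body u) :
  0 < k -> co u x.1 < co u 0 ->
  [/\ rg u' vP = p - q, rg u' vQ = q - p, rg u' vL = co u x.1, rg u' vK = k.-1
    & rg u' vFail = rg u1 vFail].
Proof.
move=> k0 lt.
have kx : (rg u vK == 0) = false by apply: gtn_eqF.
have cx : (ar u aCo 0 0 - co u x.1 == 0) = false.
  by rewrite subn_eq0 leqNgt -/(co u 0) lt.
have r1 y : y != vX -> y \notin wvar divide_cmd -> rg u1 y = rg u y.
  by move=> yx yd; rewrite /u1 sem_rg //= (negPf yx).
have [r1K r1R] := (r1 vK isT isT, r1 vR isT isT).
have rX : rg u1 vX = co u x.1 by rewrite /u1 sem_rg.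
have a1 : ar u1 aSg = ar u aSg by rewrite /u1 sem_ar.
rewrite /u' sem_if /= kx sem_seq sem_asgn sem_if /= -/k subn1 -/(co u x.1) cx sem_seq.
rewrite -[sem divide_cmd _]/u1.
clearbody u1.
have s1E : ar u1 aSg (rg u vR) k.-1 = x.2 by rewrite a1.
rewrite sem_seq sem_asgn sem_seq sem_asgn sem_seq /norm_cmd sem_seq sem_asgn.
rewrite sem_seq !sem_asgn sem_seq !sem_asgn /=.
by rewrite r1K r1R -/k !subn1 !s1E rX.
Qed.

Lemma carry_end u (k := rg u vK) :
  (0 < k -> co u 0 <= co u (ar u aId (rg u vR) k.-1)) ->
  sem carry_body u = u \/ sem carry_body u = setr u vX (co u (ar u aId (rg u vR) k.-1)).
Proof.
move=> h; rewrite sem_if /=; case: eqP => k0; first by left.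
rewrite sem_seq sem_asgn sem_if /= subn1.
have -> : ar u 3 0 0 - ar u 3 (ar u 0 (rg u 24) (rg u 18).-1) 0 == 0.
  by rewrite subn_eq0; apply: h; rewrite lt0n; apply/eqP.
by rewrite sem_skip; right.
Qed.

Lemma val_multiple e (l : seq term) (a : int) : all (fun x : term => a <= e x.1)%R l ->
  exists t : int, val_of e l = (t%:~R * 2%:R ^ a)%R.
Proof.
elim: l => [|x l IH] /=; first by exists 0%R; rewrite val_nil mul0r.
case/andP=> ax /IH[t et]; exists ((-1) ^+ x.2 * (2 ^ `|e x.1 - a|)%N%:Z + t)%R.
rewrite val_cons et /term_val (two_split ax) mulrA -mulrDl; congr (_ * _)%R.
by rewrite rmorphD rmorphM rmorphXn rmorphN1.
Qed.

Lemma lt_coords s e (v u : nat) : table s e -> v \in ords s -> u \in ords s ->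
  (co s v < co s u) = (e v < e u)%R.
Proof.
move=> ts vo uo; rewrite ltnNge (coords_le _ (t_coords ts)) -?ltNge //.
by have [M16 _ M2 _ _] := M_facts; lia.
Qed.

(** The terms of l are multiples of 2 ^ a, and so is an integer since a is not
    positive.  If r is an integer, then (p - q) 2 ^ z is therefore a multiple of
    2 ^ a and the division is exact, which rewrites the running sum in the
    larger unit 2 ^ a. *)
Lemma divide_step e z a (p q : nat) (l : seq term) (r : rat) :
  (z <= a)%R -> (a <= 0)%R -> p < B -> q < B -> (p == 0) || (q == 0) ->
  all (fun x : term => a <= e x.1)%R l ->
  r = (val_of e l + (p%:Z - q%:Z)%:~R * 2%:R ^ z)%R ->
  let f := minn (2 ^ `|a - z|) B in
  if (p %/ f * f == p) && (q %/ f * f == q)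
  then ((p%:Z - q%:Z)%:~R * 2%:R ^ z
         = ((p %/ f)%:Z - (q %/ f)%:Z)%:~R * 2%:R ^ a :> rat)%R
  else forall t : int, r <> t%:~R%R.
Proof.
move=> za a0 pB qB pq al er f.
set g := 2 ^ `|a - z|; have g0 : 0 < g by rewrite expn_gt0.
have [dp qp] := div_sat pB g0; have [dq qq] := div_sat qB g0.
rewrite /f dp dq; case: ifP => [/andP[gp gq]|ndvd].
  rewrite qp // qq // (two_split za) -/g mulrA; congr (_ * _)%R.
  have {1}-> : p = (p %/ g) * g by apply/esym/divnK.
  have {1}-> : q = (q %/ g) * g by apply/esym/divnK.
  by rewrite !PoszM -mulrBl rmorphM.
move=> t' et'; have [N eN] := val_multiple al.
have [D eD] : exists D : int, (p%:Z - q%:Z = D * g%:Z)%R.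
  exists (t' * (2 ^ `|0 - a|)%N%:Z - N)%R.
  apply: (@intr_inj rat); apply: (mulIf (two_neq0 z)).
  have one : (1 = (2 ^ `|0 - a|)%N%:R * (g%:R * 2%:R ^ z) :> rat)%R.
    by rewrite -(two_split za) -(two_split a0) expr0z.
  have -> : ((p%:Z - q%:Z)%:~R * 2%:R ^ z = t'%:~R - val_of e l :> rat)%R.
    by rewrite -et' er addrAC subrr add0r.
  have et : (t'%:~R = t'%:~R * (2 ^ `|0 - a|)%N%:R * (g%:R * 2%:R ^ z) :> rat)%R.
    by rewrite -mulrA -one mulr1.
  rewrite et eN (two_split za) -/g -mulrBl mulrA.
  by rewrite rmorphM rmorphB rmorphM.
case/negP: (negbT ndvd).
case/orP: pq => /eqP e0; move: eD; rewrite e0 ?sub0r ?subr0 dvdn0 ?andbT => h.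
  by have := dvdz_mull D (dvdzz (Posz g)); rewrite -h dvdzE abszN.
by have := dvdz_mull D (dvdzz (Posz g)); rewrite -h dvdzE.
Qed.

Definition not_int (r : rat) := forall t : int, r <> t%:~R%R.

(** The terms from position i on have been consumed.  Their sum is p - q in
    units of the last one consumed, unless the total is already known not to be
    an integer.  The bound on p + q keeps the sum below saturation and, in the
    end, the list from growing. *)
Definition carried s e (l : seq term) i fail p q last :=
  p + q <= size l - i /\
  if fail == 0 then
    ((p == 0) || (q == 0)) /\
      if i < size l
      then (val_of e (drop i l) = (p%:Z - q%:Z)%:~R * 2%:R ^ e (nth (0, 0)%N l i).1)%R
           /\ last = co s (nth (0, 0) l i).1
      else [/\ p = 0, q = 0 & last = 0]
  else not_int (val_of e l).

(** The next unit x is either the exponent of the next term, or 0 in the final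
    division. *)
Lemma carried_divide s e l i fail p q last (x : nat) (f := minn (2 ^ (co s x - last)) B)
    (fail' := if (p %/ f * f == p) && (q %/ f * f == q) then fail else 1) :
  table s e -> wfl e (ords s) l -> size l < B -> i <= size l ->
  carried s e l i fail p q last ->
  x \in ords s -> (e x <= 0)%R ->
  all (fun y : term => e x <= e y.1)%R (take i l) ->
  (i < size l -> (e (nth (0, 0)%N l i).1 <= e x)%R) ->
  if fail' == 0 then
    [/\ fail = 0, (p %/ f == 0) || (q %/ f == 0) &
      (val_of e (drop i l) = ((p %/ f)%:Z - (q %/ f)%:Z)%:~R * 2%:R ^ e x)%R]
  else not_int (val_of e l).
Proof.
move=> ts [al _ _] lB il; rewrite /carried /fail' => -[pql +] xo x0 tk lt.
case: (fail =P 0) => [f0|f0 nint]; last first.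
  have fne : (fail == 0) = false by apply/eqP.
  by case: (_ && _); rewrite /= ?fne.
case=> pq last_eq; rewrite f0.
have ple a b : a + b <= size l - i -> a < B.
  by move=> h; apply: leq_ltn_trans lB; apply: leq_trans (leq_subr i _); apply: leq_trans h; apply: leq_addr.
have pB := ple _ _ pql; have qB : q < B by rewrite addnC in pql; apply: ple pql.
have div0 a : a == 0 -> a %/ f == 0 by move/eqP->; rewrite div0n.
have pq' : (p %/ f == 0) || (q %/ f == 0) by case/orP: pq => /div0->; rewrite ?orbT.
have [ltl|gel] := ltnP i (size l); last first.
  rewrite ltnNge gel /= in last_eq; case: last_eq => -> -> _; rewrite !div0n mul0n eqxx /=.
  by split=> //; rewrite drop_oversize // val_nil subrr mul0r.
rewrite ltl in last_eq; case: last_eq => vd lastE.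
have yo : (nth (0, 0) l i).1 \in ords s by apply: (all_nthP (0, 0) al).
have fE : f = minn (2 ^ `|e x - e (nth (0, 0)%N l i).1|) B.
  by rewrite /f lastE (pow_coords ts xo yo (lt ltl)).
have vl : val_of e l = (val_of e (take i l) + (p%:Z - q%:Z)%:~R * 2%:R ^ e (nth (0, 0)%N l i).1)%R.
  by rewrite -vd -val_cat cat_take_drop.
have := divide_step (lt ltl) x0 pB qB pq tk vl; cbv zeta; rewrite -fE.
by case: ifP => _ h; [split=> //; rewrite vd h | exact: h].
Qed.

Lemma norm_arith p q b : b <= 1 ->
  let p1 := p + (1 - b) in let q1 := q + b in
  [/\ (p1 - q1) + (q1 - p1) <= (p + q).+1, (p1 - q1 == 0) || (q1 - p1 == 0) &
      ((p1 - q1)%N%:Z - (q1 - p1)%N%:Z = p%:Z - q%:Z + (-1) ^+ b)%R].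
Proof. by case: b => [|[|]] //= _; rewrite ?expr0 ?expr1; split; lia. Qed.

Lemma succ_bound p b : p < B -> b <= 1 -> p + b <= B.
Proof. lia. Qed.

Lemma sub_pred a i k : 0 < i -> i <= k -> a <= k - i -> a.+1 <= k - i.-1.
Proof. lia. Qed.

Lemma carry_spec s e z (r := rg s vR) (l := lst s r) (s' := sem (Rep carry_body) s) (i := rg s' vK) :
  table s e -> vlist s e z z r -> z <= n -> rg s vK = size l -> rg s vP = 0 ->
  rg s vQ = 0 -> rg s vL = 0 -> rg s vFail = 0 ->
  [/\ i <= size l, carried s e l i (rg s' vFail) (rg s' vP) (rg s' vQ) (rg s' vL),
      (i == 0) || (0 <= e (nth (0, 0)%N l i.-1).1)%R,
      all (fun x : term => e x.1 < 0)%R (drop i l)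
    & forall a, ar s' a = ar s a].
Proof.
move=> ts vl zn sK sP sQ sL sF; have [M16 Mn M2 K2 KB] := M_facts.
have [_ _ wl szl dl] := vl; have [al sl sol] := wl.
have lB : size l < B by apply: leq_ltn_trans szl _; lia.
have lM : size l <= M by apply: leq_trans szl _; lia.
have oi j : j < size l -> (nth (0, 0) l j).1 \in ords s.
  by move=> jl; apply: (all_nthP (0, 0) al).
have le_l j k : j <= k -> k < size l -> (e (nth (0, 0)%N l k).1 <= e (nth (0, 0)%N l j).1)%R.
  move=> jk kl.
  have := @sorted_leq_nth _ _ (@desc_trans e) (fun _ => lexx _) (0, 0) l sol j k.
  by rewrite !inE; apply=> //; apply: leq_ltn_trans kl.
pose stop i := (i == 0) || (0 <= e (nth (0, 0)%N l i.-1).1)%R.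
pose I k u := let i := rg u vK in
  [/\ i <= size l, carried s e l i (rg u vFail) (rg u vP) (rg u vQ) (rg u vL),
     (i + k == size l) || stop i,
     all (fun x : term => e x.1 < 0)%R (drop i l)
   & (forall a, ar u a = ar s a) /\ rg u vR = r].
have : I M s'.
  apply: rep_inv.
    rewrite /I sK sP sQ sL sF; split=> //.
    - by rewrite /carried eqxx /= subnn ltnn.
    - by rewrite addn0 eqxx.
    by rewrite drop_oversize.
  move=> k u _; rewrite /I; set i0 := rg u vK => [[il car prog neg [uar uR]]].
  have hp : pow_ok u by move=> j jK; rewrite uar; apply: (t_pow ts).
  have cou : co u = co s by rewrite /co uar.
  have itemu j : j < size l -> item u r j = nth (0, 0) l j.
    by move=> jl; rewrite nth_lst // /item !uar.
  have [st|nst] := boolP (stop i0).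
    have co_stop : 0 < i0 -> co u 0 <= co u (ar u aId (rg u vR) i0.-1).
      move=> i0p; have pl : i0.-1 < size l by rewrite prednK.
      have := itemu _ pl; rewrite uR => /(congr1 fst) /= ->.
      rewrite cou (coords_le _ (t_coords ts)) ?(t_zero ts) ?oi //; last by lia.
      by move: st; rewrite /stop eqn0Ngt i0p (t_e0 ts).
    by have [->|->] := carry_end co_stop; split=> //; rewrite /= ?st ?orbT.
  have [i0p neg0] : 0 < i0 /\ (e (nth (0, 0)%N l i0.-1).1 < 0)%R.
    by move: nst; rewrite /stop negb_or -ltNge lt0n => /andP[].
  have prog' : i0 + k == size l by move: prog; rewrite (negPf nst) orbF.
  have pl : i0.-1 < size l by rewrite prednK.
  set x := nth (0, 0) l i0.-1 in neg0.
  have ix : item u (rg u vR) i0.-1 = x by rewrite uR itemu.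
  have xo : x.1 \in ords s by apply: oi.
  have xs : x.2 <= 1 by apply: (all_nthP (0, 0) sl).
  have lt0 : co u x.1 < co u 0 by rewrite cou (lt_coords ts) ?(t_zero ts) // (t_e0 ts).
  have tk : all (fun y : term => e x.1 <= e y.1)%R (take i0 l).
    apply/(all_nthP (0, 0)) => j; rewrite size_takel // => ji.
    by rewrite nth_take //; apply: le_l => //; rewrite -ltnS prednK.
  have nx : i0 < size l -> (e (nth (0, 0)%N l i0).1 <= e x.1)%R.
    by move=> il'; apply: le_l => //; apply: leq_pred.
  have [pql _] := car.
  have [pB qB] : rg u vP < B /\ rg u vQ < B.
    split; apply: leq_ltn_trans lB; apply: leq_trans (leq_subr i0 _); apply: leq_trans _ pql.
      exact: leq_addr.
    exact: leq_addl.
  have hp1 : pow_ok (setr u vX (co u x.1)) := hp.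
  have [d1 d2 d3] := divideE hp1 pB qB.
  have := carried_divide ts wl lB il car xo (ltW neg0) tk nx.
  have := @carryE u; cbv zeta; rewrite -/i0 ix => /(_ i0p lt0) [c1 c2 c3 c4 c5] cd.
  have aru a : ar (sem carry_body u) a = ar s a by rewrite sem_ar.
  have ruR : rg (sem carry_body u) vR = r by rewrite sem_rg.
  rewrite /= cou in d1 d2 d3; rewrite cou in c1 c2 c3 c4 c5.
  move: (sem divide_cmd _) (sem carry_body u) d1 d2 d3 c1 c2 c3 c4 c5 aru ruR => t u'.
  move=> d1 d2 d3 c1 c2 c3 c4 c5 aru ruR; rewrite -d3 in cd.
  rewrite c4; set p := rg u vP %/ _ in d1 cd; set q := rg u vQ %/ _ in d2 cd.
  have pql' : p + q <= size l - i0 by apply: leq_trans pql; rewrite leq_add ?leq_div.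
  have pqB : p < B /\ q < B.
    by split; [apply: leq_ltn_trans pB | apply: leq_ltn_trans qB]; apply: leq_div.
  have dropx : drop i0.-1 l = x :: drop i0 l.
    by rewrite (drop_nth (0, 0)) // prednK.
  rewrite d1 in c1 c2; rewrite d2 in c1 c2.
  have [pB' qB'] := pqB.
  rewrite clip_id in c1; last by apply: succ_bound => //; apply: leq_subr.
  rewrite clip_id in c1; last exact: succ_bound.
  rewrite clip_id in c2; last exact: succ_bound.
  rewrite clip_id in c2; last by apply: succ_bound => //; apply: leq_subr.
  have [n1 n2 n3] := norm_arith p q xs.
  split.
  - exact: leq_trans (leq_pred _) il.
  - rewrite c1 c2 c3 c5; split.
      by apply: leq_trans n1 _; apply: sub_pred.
    case: (rg t vFail =P 0) => [f0|fne]; last first.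
      by move: cd; rewrite ifN //; apply/eqP.
    rewrite f0 eqxx in cd; case: cd => _ pq vd; split; first exact: n2.
    rewrite pl dropx val_cons vd -/x; split=> //.
    rewrite n3 /term_val -mulrDl; congr (_ * _)%R.
    by rewrite [in RHS]rmorphD addrC rmorphXn rmorphN1.
  - by apply/orP; left; rewrite addnS -addSn prednK.
  - by rewrite dropx /= neg0.
  by split.
move=> [il car prog neg [uar uR]]; split=> //.
rewrite -/(stop i); case/orP: prog => // /eqP e1.
rewrite /stop; have -> // : i = 0.
apply/eqP; rewrite -leqn0 -(leq_add2r M) add0n.
by rewrite [_ + M]e1.
Qed.

Lemma copy_spec s (r := rg s vR) (h := rg s vH) (m := rg s vK) (b := 1 - (1 - rg s vQ))
    (s' := sem (Rep copy_body) (setr s vG 0)) :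
  r != h ->
  (forall j, j < M -> item s' h j = if j < m then item s r j else (0, b)) /\
  (forall h' j, h' != h -> item s' h' j = item s h' j).
Proof.
move=> rh; have [M16 _ M2 K2 KB] := M_facts.
have MB : M < B by lia.
pose I k u := [/\ rg u vG = k,
  [/\ rg u vR = r, rg u vH = h, rg u vK = m & rg u vQ = rg s vQ],
  forall j, j < k -> item u h j = if j < m then item s r j else (0, b)
  & forall h' j, h' != h -> item u h' j = item s h' j].
have : I M s'.
  apply: rep_inv; first by split.
  move=> k u kM [uG [uR uH uK uQ] u1 u2].
  have E : sem copy_body u = setr (put_item u h k (if k < m then item s r k else (0, b))) vG k.+1.
    have ck : clip B (k + 1) = k.+1 by rewrite addn1 clip_id // (leq_trans kM) // ltnW.
    rewrite sem_seq sem_if sem_asgn /= uK uG subn_eq0 leqNgt.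
    have e1 : ar u aId r k = (item s r k).1 by rewrite -u2.
    have e2 : ar u aSg r k = (item s r k).2 by rewrite -u2.
    by case: ltnP => _ /=; rewrite sem_seq !sem_put /= ?uG ?uR ?uH ?uQ ck ?e1 ?e2.
  rewrite E; split; rewrite ?rg_setr //.
    move=> j; rewrite ltnS leq_eqVlt item_setr item_put eqxx /= => /orP[/eqP->|jk].
      by rewrite eqxx.
    by rewrite (ltn_eqF jk) u1.
  by move=> h' j hh; rewrite item_setr item_put (negPf hh) u2.
by case.
Qed.

(** The quotient p - q has p or q equal to 0, so p + q copies of one sign give
    its value. *)
Lemma val_int_split e l (t : int) (p q k : nat) (b := 1 - (1 - q)) (l' := take k l ++ nseq (p + q) (0, b)) :
  e 0 = 0%R -> (p == 0) || (q == 0) ->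
  (val_of e (drop k l) = (p%:Z - q%:Z)%:~R)%R -> val_of e l' = val_of e l.
Proof.
move=> e0 pq vd; rewrite /l' val_cat val_nseq -[in RHS](cat_take_drop k l) val_cat vd.
congr (_ + _)%R; rewrite /term_val /= e0 expr0z mulr1 /b.
case/orP: pq => /eqP->.
  by case: (q) => [|q']; rewrite ?mul0r ?subrr //= add0n sub0r subn0 expr1 mulrN1 rmorphN.
by rewrite addn0 /= expr0 mulr1 subr0.
Qed.

Lemma val_intr (m : int) : val (m%:~R : dyadic)%R = (m%:~R)%R.
Proof. exact: (rmorph_int \val). Qed.

(** The terms that were not consumed are integers, so the first component is
    one exactly when all divisions are exact, up to the one that brings the
    running sum to unit 1. *)
Lemma swap_spec s e d z (g : ZhalfZ) (h := rg s vH) (s' := sem swap_cmd s) :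
  table s e -> rg s vSP = d.+1 -> entry s e d z g -> z <= n -> h < B ->
  rg s vFail = 0 ->
  [/\ rg s' vSP = d.+1, below d s s', rg s' vH = h.+1, rg s' vN = rg s vN &
    if swap g is Some g' then
      [/\ rg s' vFail = 0, extends s e s' e & entry s' e d z g']
    else rg s' vFail != 0].
Proof.
move=> ts SPd en zn hB sF; have [M16 Mn M2 K2 KB] := M_facts.
set r := ar s aSR d 0.
pose s1 := setr (setr (setr (setr (setr s vR r) vK (size (lst s r))) vP 0) vQ 0) vL 0.
have es' : s' = sem (Rep carry_body ;;
  vX ::= coord #0 ;; divide_cmd ;;
  vG ::= #0 ;; Rep copy_body ;;
  Put aLen vH #0 (vK + (vP + vQ)) ;;
  Put aSR (vSP - #1) #0 (Get aSM (vSP - #1) #0) ;;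
  Put aSM (vSP - #1) #0 vH ;;
  vH ::= vH + #1) s1.
  rewrite /s1 size_lst /s' /swap_cmd; do 5!rewrite sem_seq sem_asgn.
  by rewrite /= SPd subn1 /= -/r.
have SP' : rg s' vSP = d.+1 by rewrite /s' sem_rg.
have N' : rg s' vN = rg s vN by rewrite /s' sem_rg.
clearbody s'.
have k1 : keeps 1 s s1 by [].
have ex1 : extends s e s1 e by apply: (extends_keeps ts k1).
have t1 : table s1 e by case: ex1.
have [v1 l1 val1 _] := extends_vlist ts ex1 (en_r en).
have [] := @carry_spec s1 e z t1 v1 zn => //.
rewrite sem_seq in es'.
have [rR2 rH2 rSP2] : [/\ rg (sem (Rep carry_body) s1) vR = r,
   rg (sem (Rep carry_body) s1) vH = h & rg (sem (Rep carry_body) s1) vSP = d.+1].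
  by split; rewrite sem_rg.
move: (sem (Rep carry_body) s1) es' rR2 rH2 rSP2 => s2 es' rR2 rH2 rSP2.
rewrite -[lst s1 (rg s1 vR)]/(lst s r); set l := lst s r; set k := rg s2 vK.
move=> kl car stop neg ar2.
rewrite sem_seq sem_asgn sem_seq in es'.
have hp2 : pow_ok (setr s2 vX (co s2 0)) by move=> j jK; rewrite /= ar2; apply: (t_pow ts).
have co2 : co s2 0 = co s 0 by rewrite /co ar2.
have wl : wfl e (ords s) l := vl_wfl (en_r en).
have sl : size l <= z := vl_size (en_r en).
have [al sgl sol] := wl.
have lB : size l < B by apply: leq_ltn_trans sl _; lia.
have lM : size l <= M by apply: leq_trans sl _; lia.
have oi j : j < size l -> (nth (0, 0) l j).1 \in ords s.
  by move=> jl; apply: (all_nthP (0, 0) al).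
have le_l j i : j <= i -> i < size l -> (e (nth (0, 0)%N l i).1 <= e (nth (0, 0)%N l j).1)%R.
  move=> jk il.
  have := @sorted_leq_nth _ _ (@desc_trans e) (fun _ => lexx _) (0, 0) l sol j i.
  by rewrite !inE; apply=> //; apply: leq_ltn_trans il.
have tk : all (fun y : term => e 0 <= e y.1)%R (take k l).
  apply/(all_nthP (0, 0)) => j; rewrite size_takel // => jk; rewrite nth_take // (t_e0 ts).
  case/orP: stop => [/eqP k0|]; first by rewrite k0 in jk.
  have k0 : 0 < k by apply: leq_ltn_trans jk.
  by move/le_trans; apply; apply: le_l; rewrite ?prednK // -ltnS prednK.
have nx : k < size l -> (e (nth (0, 0)%N l k).1 <= e 0)%R.
  move=> kl'; rewrite (t_e0 ts); apply: ltW.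
  by move: neg; rewrite (drop_nth (0, 0)) // => /andP[].
have [pql _] := car.
have [pB qB] : rg s2 vP < B /\ rg s2 vQ < B.
  split; apply: leq_ltn_trans lB; apply: leq_trans (leq_subr k _); apply: leq_trans _ pql.
    exact: leq_addr.
  exact: leq_addl.
have e00 : (e 0 <= 0)%R by rewrite (t_e0 ts).
have := carried_divide ts wl lB kl car (t_zero ts) e00 tk nx.
have [d1 d2 d3] := divideE hp2 pB qB.
rewrite /= co2 in d1 d2 d3; rewrite -d3.
have [rR3 rH3 rSP3 rK3] : [/\ rg (sem divide_cmd (setr s2 vX (co s2 0))) vR = r,
   rg (sem divide_cmd (setr s2 vX (co s2 0))) vH = h,
   rg (sem divide_cmd (setr s2 vX (co s2 0))) vSP = d.+1 &
   rg (sem divide_cmd (setr s2 vX (co s2 0))) vK = k].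
  by split; rewrite sem_rg.
have ar3 a : ar (sem divide_cmd (setr s2 vX (co s2 0))) a = ar s a.
  by rewrite sem_ar // /= ar2.
rewrite -[ev s2 _]/(co s2 0) in es'; rewrite co2 in es' rR3 rH3 rSP3 rK3 ar3 d1 d2.
move: (sem divide_cmd _) es' d1 d2 {d3} rR3 rH3 rSP3 rK3 ar3 => s3 es' d1 d2 rR3 rH3 rSP3 rK3 ar3.
have pql' : rg s3 vP + rg s3 vQ <= size l - k.
  by rewrite d1 d2; apply: leq_trans pql; rewrite leq_add ?leq_div.
rewrite -d1 -d2 => fin.
rewrite sem_seq sem_asgn sem_seq in es'.
have hr : r < h := vl_lt (en_r en).
have rh : rg s3 vR != rg s3 vH by rewrite rR3 rH3 neq_ltn hr.
have [cp1 cp2] := copy_spec rh; rewrite rR3 rH3 rK3 in cp1 cp2.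
have [rP4 rQ4 rK4 rH4 rSP4] : [/\ rg (sem (Rep copy_body) (setr s3 vG 0)) vP = rg s3 vP,
   rg (sem (Rep copy_body) (setr s3 vG 0)) vQ = rg s3 vQ,
   rg (sem (Rep copy_body) (setr s3 vG 0)) vK = k,
   rg (sem (Rep copy_body) (setr s3 vG 0)) vH = h &
   rg (sem (Rep copy_body) (setr s3 vG 0)) vSP = d.+1].
  by split; rewrite sem_rg.
have rF4 : rg (sem (Rep copy_body) (setr s3 vG 0)) vFail = rg s3 vFail by rewrite sem_rg.
have rN4 : rg (sem (Rep copy_body) (setr s3 vG 0)) vN = rg s' vN.
  by rewrite es' !(sem_seq, sem_put, sem_asgn).
have ar4 a : 1 < a -> ar (sem (Rep copy_body) (setr s3 vG 0)) a = ar s a.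
  by case: a => [|[|a]] // _; rewrite sem_ar //; apply: ar3.
move: (sem (Rep copy_body) _) es' cp1 cp2 rP4 rQ4 rK4 rH4 rSP4 rF4 rN4 ar4 => s4.
move=> es' cp1 cp2 rP4 rQ4 rK4 rH4 rSP4 rF4 rN4 ar4.
set p := rg s3 vP in pql' fin rP4; set q := rg s3 vQ in pql' fin rQ4 cp1.
set b := 1 - (1 - q) in cp1.
have pqB : clip B (p + q) = p + q.
  by rewrite clip_id //; apply: leq_trans pql' _; apply: leq_trans (leq_subr _ _) (ltnW lB).
have kpq : k + (p + q) <= size l by rewrite -leq_subRL.
have kB : clip B (k + (p + q)) = k + (p + q).
  by rewrite clip_id //; apply: leq_trans kpq (ltnW lB).
rewrite !(sem_seq, sem_put, sem_asgn) /= rP4 rQ4 rK4 rH4 rSP4 pqB kB subn1 addn1 clip_id //= in es'.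
have el h' : h' != h -> lst s' h' = lst s h'.
  move=> hh; apply: lst_eq => [|i _]; first by rewrite es' /= (negPf hh) /= ar4.
  rewrite es' -[LHS]/(item s4 h' i) cp2 //.
  by rewrite /item !ar3.
have eh : lst s' h = take k l ++ nseq (p + q) (0, b).
  have slh : ar s' aLen h 0 = k + (p + q) by rewrite es' /= !eqxx.
  apply: (@eq_from_nth _ (0, 0)); rewrite size_lst slh.
    by rewrite size_cat size_takel // size_nseq.
  move=> i il; rewrite nth_lst ?size_lst ?slh //.
  rewrite es' -[LHS]/(item s4 h i) cp1; last by apply: leq_trans (leq_trans kpq lM).
  rewrite nth_cat size_takel //; case: ltnP => ik.
    rewrite nth_take // [RHS](@nth_lst (0, 0) s r i (leq_trans ik kl)).
    by rewrite /item !ar3.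
  by rewrite nth_nseq ltn_subLR // il.
have ho : h \notin ords s by apply/negP => /(node_lt ts)[]; rewrite ltnn.
have kk : keeps h s s'.
  by split; [rewrite es' /= ar4 | rewrite es' /= ar4 | rewrite es' /= ar4 | | exact: el].
have H' : rg s' vH = h.+1 by rewrite es'.
have F' : rg s' vFail = rg s3 vFail by rewrite es' /= rF4.
have SRd : ar s' aSR d 0 = ar s aSM d 0 by rewrite es' /= !eqxx /= ar4.
have SMd : ar s' aSM d 0 = h by rewrite es' /= !eqxx.
have t' : table s' e by apply: (table_keeps ts kk ho); rewrite H'.
have o' := keeps_ords kk.
have h1 : h != 1 by rewrite neq_ltn (t_scr ts) orbT.
split=> //.
  by move=> i id; rewrite es' /= (ltn_eqF id) /= !ar4.
clear es'.
have b1 : b <= 1 by apply: leq_subr.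
have wl' : wfl e (ords s) (take k l ++ nseq (p + q) (0, b)).
  split.
  - rewrite all_cat; apply/andP; split; last by rewrite all_nseq /= (t_zero ts) orbT.
    by apply/allP => y /mem_take/(allP al).
  - rewrite /sgn_ok all_cat; apply/andP; split; last by rewrite all_nseq /= b1 orbT.
    by apply/allP => y /mem_take/(allP sgl).
  rewrite (sorted_pairwise (@desc_trans e)) pairwise_cat; apply/and3P; split.
  - apply/allrelP => y y' yt; rewrite mem_nseq => /andP[_ /eqP->].
    exact: (allP tk).
  - by rewrite -(sorted_pairwise (@desc_trans e)) take_sorted.
  rewrite -(sorted_pairwise (@desc_trans e)).
  by case: (p + q) => //= m; elim: m => //= m IHm; rewrite {1}/desc lexx.
have nn' : nonneg e (take k l ++ nseq (p + q) (0, b)).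
  rewrite /nonneg all_cat; apply/andP; split; last by rewrite all_nseq /= (t_e0 ts) lexx orbT.
  by apply/allP => y /(allP tk); rewrite (t_e0 ts).
rewrite F'; case: (rg s3 vFail =P 0) fin => [f3|f3] fin; last first.
  rewrite /swap; case: ifP => [/intrP[t et]|_]; last by apply/eqP.
  by case: (fin t); rewrite -et -(en_rval en).
case: fin => _ pq vd.
have vl' : val_of e (take k l ++ nseq (p + q) (0, b)) = val_of e l.
  apply: (val_int_split 0%R (t_e0 ts) pq).
  by rewrite vd (t_e0 ts) expr0z mulr1.
have [t et] : exists t : int, val_of e l = (t%:~R)%R.
  have [t et] := val_multiple nn'; exists t.
  by rewrite -vl' et expr0z mulr1.
have et' : val g.1 = (t%:~R)%R by rewrite -et -(en_rval en).
have ex : extends s e s' e.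
  split; [exact: t' | by move=> v; rewrite o' | by move=> v; rewrite o'; left | |].
    by move=> h' hh _; apply: el; rewrite neq_ltn hh.
  by rewrite H'.
rewrite /swap et' intr_int; split=> //.
have [w1 _ w2 _] := extends_vlist ts ex (en_m en).
split; rewrite ?SRd ?SMd /=.
- exact: w1.
- split; rewrite ?eh ?o' ?H' //.
    rewrite size_cat size_takel // size_nseq; exact: leq_trans kpq sl.
  rewrite all_cat; apply/andP; split.
    apply/allP => y /mem_take yl; have yo := allP al _ yl.
    have [yh y1] := node_lt ts yo.
    by rewrite el ?(allP (vl_deep (en_r en))) // neq_ltn yh.
  rewrite all_nseq /= el ?(t_nil ts) ?orbT // neq_ltn.
  by case: (node_lt ts (t_zero ts)) => ->.
- by rewrite w2 (en_mval en) -[RHS]/(val (g.2%:~R : dyadic)%R) val_intr.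
- by rewrite eh vl' et numq_int.
by rewrite eh.
Qed.

(** * Generators *)

Definition leaf_val (t : nat) : ZhalfZ :=
  nth gen_a [:: gen_a; (gen_a^-1)%g; gen_t; (gen_t^-1)%g] t.

Lemma leaf_spec s e d t (h := rg s vH) (s' := sem leaf_cmd s) :
  table s e -> rg s vSP = d -> d < B -> h + 2 <= B -> t < 4 -> rg s vTok = t ->
  [/\ extends s e s' e, entry s' e d 1 (leaf_val t), rg s' vSP = d.+1,
      below d s s' & rg s' vH = h + 2].
Proof.
move=> ts SPd dB hB t4 tok; have [M16 Mn M2 K2 KB] := M_facts.
pose W := t %/ 2; pose b := t - W * 2.
have W1 : W <= 1 by rewrite /W; case: t t4 {tok b W} => [|[|[|[|t]]]].
have b1 : b <= 1 by rewrite /b /W; case: t t4 {tok b W W1} => [|[|[|[|t]]]].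
pose s1 := seta (seta (seta (setr s vW W) aId (h + W) 0 0) aSg (h + W) 0 b) aLen (h + W) 0 1.
pose s2 := seta s1 aLen (h + (1 - W)) 0 0.
have es' : s' = setr (setr (seta (seta s2 aSR d 0 h) aSM d 0 h.+1) vSP d.+1) vH (h + 2).
  rewrite /s' /leaf_cmd !(sem_seq, sem_put, sem_asgn) /= tok SPd -/h -/W.
  have c x : x <= h + 2 -> clip B x = x by move=> ?; rewrite clip_id //; apply: leq_trans hB.
  rewrite (c (h + W)); last by rewrite leq_add2l (leq_trans W1).
  rewrite (c (h + (1 - W))); last by rewrite leq_add2l (leq_trans (leq_subr _ _)).
  rewrite (c (h + 1)) ?leq_add2l // (c (h + 2)) // !addn1 (clip_id dB) [clip B (W * 2)]clip_id //.
  by apply: leq_trans hB; apply: leq_trans (leq_addl _ _); rewrite -[X in _ <= X]mul1n leq_mul2r W1.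
clearbody s'; have h1 : 1 < h := t_scr ts.
have ha : h + W \notin ords s by apply/negP => /(node_lt ts)[]; rewrite ltnNge leq_addr.
have k1 : keeps (h + W) s s1.
  split=> // y yh; apply: lst_eq => [|i _]; rewrite /item /= (negPf yh) //.
have t1 : table s1 e by apply: (table_keeps ts k1 ha).
have hb : h + (1 - W) \notin ords s1.
  by rewrite (keeps_ords k1); apply/negP => /(node_lt ts)[]; rewrite ltnNge leq_addr.
have k2 : keeps (h + (1 - W)) s1 s2.
  by split=> // y yh; apply: lst_eq => [|i _]; rewrite /item /= ?(negPf yh).
have t2 : table s2 e by apply: (table_keeps t1 k2 hb).
have k3 : keeps 1 s2 s' by rewrite es'; split.
have H' : rg s' vH = h + 2 by rewrite es' rg_setr.
have t3 : table s' e.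
  by apply: (table_keeps t2 k3 (scratch_notin t2)); rewrite H'; apply: leq_addr.
have o3 : ords s' = ords s by rewrite (keeps_ords k3) (keeps_ords k2) (keeps_ords k1).
have el y : y < h -> y != 1 -> lst s' y = lst s y.
  move=> yh y1; have [_ _ _ _ el1] := k1; have [_ _ _ _ el2] := k2; have [_ _ _ _ el3] := k3.
  have ny i : y != h + i by rewrite neq_ltn ltn_addr.
  by rewrite (el3 _ y1) (el2 _ (ny _)) (el1 _ (ny _)).
have e1 : lst s' (h + W) = [:: (0, b)].
  rewrite es' /lst /item /= !eqxx /= eqn_add2l.
  have -> : (W == 1 - W) = false by move: W1; case: (W) => [|[|]].
  by rewrite /=.
have e2 : lst s' (h + (1 - W)) = [::] by rewrite es' /lst /= !eqxx.
clear k1 k2 k3 t1 t2.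
have wf1 : wfl e (ords s') [:: (0, b)] by split; rewrite /= ?o3 ?(t_zero ts) // /sgn_ok /= b1.
have hW i : i <= 1 -> h + i < rg s' vH /\ h + i != 1.
  by move=> i1; rewrite H' ltn_add2l ltnS i1 neq_ltn (leq_trans h1) ?orbT ?leq_addr.
have nil0 : lst s' 0 = [::] := t_nil t3.
have vlW : vlist s' e 1 1 (h + W).
  by have [lt1 ne1] := hW W W1; split; rewrite ?e1 //= nil0.
have vlW' : vlist s' e 1 1 (h + (1 - W)).
  by have [lt1 ne1] := hW (1 - W) (leq_subr _ _); split; rewrite ?e2.
have srd : ar s' aSR d 0 = h by rewrite es' /= !eqxx.
have smd : ar s' aSM d 0 = h.+1 by rewrite es' /= !eqxx.
have v1 : val_of e [:: (0, b)] = ((-1) ^+ b)%R.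
  by rewrite val_cons val_nil /term_val /= (t_e0 ts) expr0z mulr1 addr0.
split=> //.
- split; [exact: t3 | by move=> v; rewrite o3 | by move=> v; rewrite o3; left | exact: el |].
  by rewrite H' leq_addr.
- have [lr lm] : val_of e (lst s' h) = val (leaf_val t).1 /\
      val_of e (lst s' h.+1) = ((leaf_val t).2%:~R)%R.
    have E2 : val (exp2_mul 0 (-1))%R = (-1)%R :> rat by rewrite exp2_mul0.
    move: e1 e2 v1 => {wf1 hW vlW vlW' s1 s2 es' ha hb}; rewrite /b /W => {b1 W1 tok b W}.
    case: t t4 => [|[|[|[|]]]] // _.
    - by rewrite [1 - _]/= [0 %/ 2]/= addn0 addn1 => -> -> ->; rewrite val_nil.
    - by rewrite [1 - _]/= [1 %/ 2]/= addn0 addn1 => -> -> ->; rewrite val_nil -E2.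
    - by rewrite [2 %/ 2]/= [1 - 1]/= addn0 addn1 => -> -> ->; rewrite val_nil.
    by rewrite [3 %/ 2]/= [1 - 1]/= addn0 addn1 => -> -> ->; rewrite val_nil /= mulr0.
  have [vr vm] : vlist s' e 1 1 h /\ vlist s' e 1 1 h.+1.
    have [W0|] := eqVneq W 0.
      by move: vlW vlW'; rewrite W0 subn0 addn0 addn1.
    rewrite -lt0n => W0; have EW : W = 1 by apply/eqP; rewrite eqn_leq W1.
    by move: vlW vlW'; rewrite EW subnn addn0 addn1.
  split; rewrite ?srd ?smd //.
  have [W0|] := eqVneq W 0.
    by move: e2; rewrite W0 subn0 addn1 => ->.
  rewrite -lt0n => W0; have EW : W = 1 by apply/eqP; rewrite eqn_leq W1.
  by move: e1; rewrite EW addn1 => ->; rewrite /nonneg /= (t_e0 t3) lexx.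
- by rewrite es'.
by move=> i id; rewrite es' /= (ltn_eqF id).
Qed.

(** * Evaluation of an expression *)

Definition token i := nth 0 w (n - 1 - i).

Definition fetch s := setr (setr s vTok (token (rg s vIn))) vIn (rg s vIn).+1.

Lemma tokenE s (t := token (rg s vIn)) : rg s vIn < n ->
  sem token_body s =
    if rg s vFail == 0 then
      sem (if t < 4 then leaf_cmd else if t < 5 then mul_cmd else swap_cmd) (fetch s)
    else fetch s.
Proof.
move=> ltn; have [M16 Mn M2 K2 KB] := M_facts.
have nB : n <= B.
  apply: leq_trans KB; apply: leq_trans (leq_pmull _ _); last by nia.
  by nia.
pose c := If vFail Skip (If (#4 - vTok) leaf_cmd (If (#5 - vTok) mul_cmd swap_cmd)).
have e5 u : ev u (#5 - vTok)%I = 5 - rg u vTok by [].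
have e4 u : ev u (#4 - vTok)%I = 4 - rg u vTok by [].
have bodyE u : sem c u = if rg u vFail == 0 then
    sem (if rg u vTok < 4 then leaf_cmd else if rg u vTok < 5 then mul_cmd else swap_cmd) u
    else u.
  rewrite /c sem_if sem_skip; case: (_ =P 0) => // _.
  rewrite sem_if e4 subn_eq0 [4 <= _]leqNgt; case: (rg u vTok < 4) => //=.
  by rewrite sem_if e5 subn_eq0 [5 <= _]leqNgt; case: (rg u vTok < 5).
have eL : (ev s (Len - vIn)%I == 0) = false by rewrite /= subn_eq0 leqNgt ltn.
have eI : ev s (Inp (Len - #1 - vIn)%I) = t.
  rewrite /= (minn_idPl _) // -subn1; exact: leq_subr.
have eP : ev (setr s vTok t) (vIn + #1)%I = (rg s vIn).+1.
  by rewrite /= addn1 clip_id //; apply: leq_trans ltn nB.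
rewrite /token_body -/c sem_if eL sem_seq sem_asgn eI sem_seq sem_asgn eP.
by rewrite -[setr (setr s vTok t) vIn _]/(fetch s) bodyE.
Qed.

Lemma token_stop s : n <= rg s vIn -> sem token_body s = s.
Proof.
move=> le; have eL : ev s (Len - vIn)%I == 0 by rewrite /= subn_eq0.
by rewrite /token_body sem_if eL.
Qed.

(** Once a swap is undefined the remaining letters are skipped, which keeps
    the count of letters right for the enclosing expressions. *)
Lemma token_failed k s : rg s vFail != 0 -> rg s vIn + k <= n ->
  let s' := iter k (sem token_body) s in
  rg s' vIn = rg s vIn + k /\ rg s' vFail != 0.
Proof.
elim: k => [|k IHk] fs; first by rewrite addn0.
rewrite addnS => ltn; have [] := IHk fs (ltnW ltn).
rewrite iterS; move: (iter _ _ _) => t tI tF.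
by rewrite tokenE tI // (negPf tF); split=> //=; rewrite tI.
Qed.

(** A product adds at most n nodes and n + 3 handles, a swap or a generator
    fewer; counted per letter read, this bounds all resources. *)
Record good s e d : Prop := Good {
  g_table : table s e;
  g_sp : rg s vSP = d;
  g_ok : rg s vFail = 0;
  g_depth : d <= rg s vIn;
  g_H : rg s vH <= 2 + rg s vIn * (n + 3);
  g_N : rg s vN <= 1 + rg s vIn * n }.

Lemma below_trans d1 d2 s1 s2 s3 : d1 <= d2 -> below d1 s1 s2 -> below d2 s2 s3 -> below d1 s1 s3.
Proof.
move=> le b1 b2 i lti; have [-> ->] := b2 i (leq_trans lti le); exact: b1.
Qed.

Lemma fetch_extends s e : table s e -> extends s e (fetch s) e.
Proof. by move=> ts; apply: extends_keeps. Qed.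

Lemma entry_mono s e d z z' g : z <= z' -> entry s e d z g -> entry s e d z' g.
Proof. by move=> lez [h1 h2 h3 h4 h5]; split=> //; exact: (vlist_mono _ lez lez). Qed.

Lemma room i : i < n ->
  [/\ i < B, 2 + i * (n + 3) + n + 3 <= B & 1 + i * n + n <= K].
Proof.
move=> ltn; have [M16 Mn M2 K2 KB] := M_facts.
have : i.+1 * (n + 3) <= n * (n + 3) by rewrite leq_mul2r ltn orbT.
have : i.+1 * n <= n * n by rewrite leq_mul2r ltn orbT.
by split; nia.
Qed.

Lemma leaf_step s e d (t := token (rg s vIn)) (s' := sem token_body s) :
  rg s vIn < n -> good s e d -> t < 4 ->
  [/\ rg s' vIn = (rg s vIn).+1, extends s e s' e, good s' e d.+1,
      entry s' e d 1 (leaf_val t) & below d s s'].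
Proof.
move=> ltn [ts SPd ok dI bH bN] t4; have [iB rH rN] := room ltn.
have ex0 := fetch_extends ts; have [t0 _ _ _ _] := ex0.
rewrite /s' tokenE // ok eqxx -/t t4.
have hH : rg (fetch s) vH + 2 <= B.
  apply: leq_trans rH; rewrite -addnA; apply: leq_add => //.
  by rewrite addnC.
have dB : d < B := leq_ltn_trans dI iB.
have [ex en sp bl h'] := leaf_spec t0 SPd dB hH t4 (erefl : rg (fetch s) vTok = t).
have eI : rg (sem leaf_cmd (fetch s)) vIn = (rg s vIn).+1 by rewrite sem_rg.
have eF : rg (sem leaf_cmd (fetch s)) vFail = 0 by rewrite sem_rg.
have eN : rg (sem leaf_cmd (fetch s)) vN = rg s vN by rewrite sem_rg.
have ex' := extends_trans ex0 ex; have [t' _ _ _ _] := ex.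
split=> //; split=> //; rewrite ?eI ?eN.
  rewrite h' mulSn; apply: leq_trans (leq_add bH (leqnn 2)) _.
  by rewrite -addnA leq_add2l addnC leq_add2r addnC.
by apply: leq_trans bN _; rewrite mulSn leq_add2l leq_addl.
Qed.

Lemma mul_step s e d z1 z2 g1 g2 (s' := sem token_body s) :
  rg s vIn < n -> token (rg s vIn) = 4 -> good s e d.+2 ->
  entry s e d.+1 z1 g1 -> entry s e d z2 g2 -> z1 + z2 <= n ->
  rg s' vIn = (rg s vIn).+1 /\
  exists e', [/\ extends s e s' e', good s' e' d.+1,
      entry s' e' d (z1 + z2) (g1 * g2)%g & below d s s'].
Proof.
move=> ltn t4 [ts SPd ok dI bH bN] en1 en2 zn; have [iB rH rN] := room ltn.
have ex0 := fetch_extends ts; have [t0 _ _ _ _] := ex0.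
have f1 := extends_entry ts ex0 (erefl _) (erefl _) en1.
have f2 := extends_entry ts ex0 (erefl _) (erefl _) en2.
rewrite /s' tokenE // ok eqxx t4.
have hN : rg (fetch s) vN + n <= K by apply: leq_trans rN; rewrite leq_add2r.
have hH : rg (fetch s) vH + n + 3 <= B by apply: leq_trans rH; rewrite !leq_add2r.
have [e' [ex en [sp bl] h' n']] := mul_spec t0 SPd f1 f2 zn hN hH.
have eI : rg (sem mul_cmd (fetch s)) vIn = (rg s vIn).+1 by rewrite sem_rg.
have eF : rg (sem mul_cmd (fetch s)) vFail = 0 by rewrite sem_rg.
have ex' := extends_trans ex0 ex; have [t' _ _ _ _] := ex.
split=> //; exists e'; split=> //; split=> //; rewrite ?eI.
- by rewrite ltnS; apply: ltnW; apply: ltnW.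
- apply: leq_trans h' _; rewrite -(addnA _ n 3) mulSn [leqRHS]addnCA [leqRHS]addnC leq_add2r.
  exact: bH.
by apply: leq_trans n' _; rewrite mulSn [leqRHS]addnCA [leqRHS]addnC leq_add2r.
Qed.

Lemma swap_step s e d z g (s' := sem token_body s) :
  rg s vIn < n -> token (rg s vIn) = 5 -> good s e d.+1 ->
  entry s e d z g -> z <= n ->
  rg s' vIn = (rg s vIn).+1 /\
  if swap g is Some g' then
    [/\ extends s e s' e, good s' e d.+1, entry s' e d z g' & below d s s']
  else rg s' vFail != 0.
Proof.
move=> ltn t5 [ts SPd ok dI bH bN] en zn; have [iB rH rN] := room ltn.
have ex0 := fetch_extends ts; have [t0 _ _ _ _] := ex0.
have f1 := extends_entry ts ex0 (erefl _) (erefl _) en.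
rewrite /s' tokenE // ok eqxx t5.
have hH : rg (fetch s) vH < B.
  apply: leq_ltn_trans bH _; apply: leq_trans rH.
  by rewrite [leqRHS]addn3 ltnS; apply: leqW; apply: leqW; apply: leq_addr.
have [sp bl h' n' fin] := swap_spec t0 SPd f1 zn hH ok.
have eI : rg (sem swap_cmd (fetch s)) vIn = (rg s vIn).+1 by rewrite sem_rg.
split=> //; case: (swap g) fin => // g' [eF ex en'].
have ex' := extends_trans ex0 ex; have [t' _ _ _ _] := ex.
split=> //; split=> //; rewrite ?eI.
- exact: leqW.
- rewrite h' mulSn addnCA; apply: leq_ltn_trans bH _.
  by rewrite -[X in X < _]add0n ltn_add2r addnS.
by rewrite n'; apply: leq_trans bN _; rewrite mulSn leq_add2l leq_addl.
Qed.

Lemma token_suffix pre t post : w = pre ++ t :: post -> token (size post) = t.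
Proof.
move=> ew; rewrite /token ew size_cat /= addnS subn1 /= addnK.
by rewrite nth_cat ltnn subnn.
Qed.

Definition parsed s e d z (o : option ZhalfZ) s' :=
  rg s' vIn = rg s vIn + z /\
  if o is Some g then exists e',
    [/\ extends s e s' e', good s' e' d.+1, entry s' e' d z g & below d s s']
  else rg s' vFail != 0.

Lemma parse_leaf t pre post s e d :
  w = pre ++ t :: post -> rg s vIn = size post -> good s e d -> t < 4 ->
  parsed s e d 1 (Some (leaf_val t)) (sem token_body s).
Proof.
move=> ew eI gs t4; have et := token_suffix ew; rewrite -eI in et.
have ltn : rg s vIn < n by rewrite eI ew size_cat /= addnS ltnS leq_addl.
have := leaf_step ltn gs; rewrite et => /(_ t4) [h1 h2 h3 h4 h5].
by split; [rewrite addn1 | exists e].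
Qed.

(** The letters of a subexpression are read in as many turns, starting from the
    right.  For a product the second operand is pushed first; its entry survives
    the evaluation of the first, which only extends the table and the stack. *)
Lemma parse_spec x pre post s e d :
  w = pre ++ encode x ++ post -> rg s vIn = size post -> good s e d ->
  parsed s e d (size (encode x)) (eval x) (iter (size (encode x)) (sem token_body) s).
Proof.
elim: x pre post s e d => [||||x1 IH1 x2 IH2|x IHx] pre post s e d ew eI gs.
- exact: (parse_leaf ew eI gs).
- exact: (parse_leaf ew eI gs).
- exact: (parse_leaf ew eI gs).
- exact: (parse_leaf ew eI gs).
- set E1 := encode x1 in IH1 ew *; set E2 := encode x2 in IH2 ew *.
  have -> : encode (EMul x1 x2) = 4 :: E1 ++ E2 by [].
  rewrite -[size _]/(size (E1 ++ E2)).+1 size_cat iterS iterD.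
  have ew2 : w = (pre ++ 4 :: E1) ++ E2 ++ post by rewrite ew /= -?catA /= -?catA.
  have ew1 : w = (pre ++ [:: 4]) ++ E1 ++ E2 ++ post by rewrite ew /= -?catA /= -?catA.
  have ew0 : w = pre ++ 4 :: E1 ++ E2 ++ post by rewrite ew /= -?catA.
  have sw : n = size pre + (size E1 + size E2 + size post).+1.
    by rewrite ew0 size_cat /= !size_cat addnA.
  have [eI2 out2] := IH2 _ _ _ _ _ ew2 eI gs.
  move: (iter (size E2) _ s) eI2 out2 => s2 eI2.
  rewrite -[eval (EMul _ _)]/(if (eval x1, eval x2) is (Some x, Some y)
                              then Some (x * y)%g else None).
  case: (eval x2) => [g2|]; last first.
    move=> f2; rewrite -iterS.
    have [] := @token_failed (size E1).+1 s2 f2.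
      by rewrite eI2 eI sw addnS -addnA [size post + _]addnC [size E2 + _]addnC leq_addl.
    move=> h1 h2; split; last by case: (eval x1).
    by rewrite h1 eI2 -addnA addnS [size E2 + _]addnC.
  case=> e2 [ex2 gs2 en2 b2].
  have eI2' : rg s2 vIn = size (E2 ++ post) by rewrite eI2 eI size_cat addnC.
  have [eI1 out1] := IH1 _ _ _ _ _ ew1 eI2' gs2.
  move: (iter (size E1) _ s2) eI1 out1 => s1 eI1.
  have eI1' : rg s1 vIn = size (E1 ++ E2 ++ post) by rewrite eI1 eI2' !size_cat addnC.
  have lt1 : rg s1 vIn < n by rewrite eI1' sw !size_cat addnA leq_addl.
  have eIz : (rg s1 vIn).+1 = rg s vIn + (size E1 + size E2).+1.
    by rewrite eI1 eI2 addnS -addnA [size E2 + _]addnC.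
  case: (eval x1) => [g1|f1]; last first.
    have [] := @token_failed 1 s1 f1; first by rewrite addn1.
    by move=> h1 h2; split=> //; rewrite -eIz -[in RHS]addn1 -h1.
  case=> e1 [ex1 gs1 en1 b1].
  have [br bm] := b1 d (ltnSn d).
  have en2' := extends_entry (g_table gs2) ex1 br bm en2.
  have t4 : token (rg s1 vIn) = 4 by rewrite eI1'; apply: token_suffix ew0.
  have [] := mul_step lt1 t4 gs1 en1 en2'.
    by apply: leq_trans (leq_addr (size post) _) _; rewrite sw addnS leqW ?leq_addl.
  move=> eI0 [e' [ex0 gs0 en0 b0]]; split; first by rewrite eI0.
  exists e'; split=> //.
  - exact: extends_trans ex2 (extends_trans ex1 ex0).
  - exact: entry_mono en0.
  exact: (below_trans (leqnn d) (below_trans (leqnSn d) b2 b1) b0).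
set E := encode x in IHx ew *.
have -> : encode (ESwap x) = 5 :: E by [].
rewrite -[size _]/(size E).+1 iterS.
have ew1 : w = (pre ++ [:: 5]) ++ E ++ post by rewrite ew /= -?catA.
have sw : n = size pre + (size E + size post).+1 by rewrite ew size_cat /= size_cat.
have [eI1 out1] := IHx _ _ _ _ _ ew1 eI gs.
move: (iter (size E) _ s) eI1 out1 => s1 eI1.
rewrite -[eval (ESwap _)]/(obind swap (eval x)).
have eI1' : rg s1 vIn = size (E ++ post) by rewrite eI1 eI size_cat addnC.
have lt1 : rg s1 vIn < n by rewrite eI1' sw size_cat leq_addl.
have eIz : (rg s1 vIn).+1 = rg s vIn + (size E).+1 by rewrite eI1 addnS.
case: (eval x) => [g1|f1]; last first.
  have [] := @token_failed 1 s1 f1; first by rewrite addn1.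
    by move=> h1 h2; split=> //; rewrite -eIz -[in RHS]addn1 -h1.
case=> e1 [ex1 gs1 en1 b1]; rewrite [obind _ _]/=.
have t5 : token (rg s1 vIn) = 5 by rewrite eI1'; apply: token_suffix ew.
have zn : size E <= n by apply: leq_trans (leq_addr (size post) _) _; rewrite sw addnS leqW ?leq_addl.
have [eI0 out0] := swap_step lt1 t5 gs1 en1 zn; split; first by rewrite eI0.
case: (swap g1) out0 => // g [ex0 gs0 en0 b0]; exists e1; split=> //.
- exact: extends_trans ex1 ex0.
- exact: entry_mono en0.
exact: (below_trans (leqnn d) b1 b0).
Qed.

Lemma init_spec (s := sem init_cmd store0) : good s (fun _ => 0%R) 0 /\ rg s vIn = 0.
Proof.
have [M16 Mn M2 K2 KB] := M_facts.
have B0 : 0 < B by apply: leq_trans KB; rewrite muln_gt0 andbb; apply: leq_trans M2; rewrite muln_gt0 /=; apply: leq_trans M16.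
have KB' : K <= B by apply: leq_trans KB; apply: leq_trans K2; apply: leq_pmull.
pose body := (Put aPow (vK + #1) #0 (Get aPow vK #0 * #2) ;; vK ::= vK + #1).
pose s1 := sem (vK ::= #0) (sem (Put aPow #0 #0 #1) store0).
pose s2 := sem (Rep (Rep body)) s1.
have es : s = setr (setr s2 vN 1) vH 2.
  by rewrite /s /init_cmd !sem_seq -/body -/s1 -/s2 !sem_asgn.
have [_ hp] : rg s2 vK = K /\ forall i, i <= K -> ar s2 aPow i 0 = minn (2 ^ i) B.
  apply: (@rep2_inv (fun k t => rg t vK = k /\ forall i, i <= k -> ar t aPow i 0 = minn (2 ^ i) B)).
    split=> // i; rewrite leqn0 => /eqP->.
    by rewrite (minn_idPl _).
  move=> k t ltk [tk tp].
  have c1 : clip B (rg t vK + 1) = k.+1 by rewrite tk addn1 clip_id // (leq_trans ltk).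
  have c2 : clip B (ar t aPow (rg t vK) 0 * 2) = minn (2 ^ k.+1) B.
    by rewrite tk tp // expnSr mulnC [2 ^ k * 2]mulnC /clip clip_mul.
  rewrite /body sem_seq sem_put sem_asgn /= c1 c2; split=> // i le.
  rewrite eqxx andbT; case: eqP => [->//|/eqP ne].
  by apply: tp; rewrite -ltnS ltn_neqAle ne.
have ar2 a : a != aPow -> ar s2 a = fun _ _ => 0.
  move=> na; rewrite /s2 sem_ar ?inE // /s1 sem_asgn sem_put /=.
  by rewrite (negPf na).
have rg2 x : x != vK -> rg s2 x = 0.
  move=> nx; rewrite /s2 sem_rg ?inE // /s1 sem_asgn sem_put /=.
  by rewrite (negPf nx).
have l0 h : lst s h = [::] by rewrite es /lst /= ar2.
have o0 : ords s = [:: 0] by rewrite es /ords /= ar2.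
split; last by rewrite es /= rg2.
split; rewrite ?es /= ?rg2 // -?es.
split; rewrite ?o0 ?l0 //.
- by move=> v u; rewrite !inE => /eqP-> /eqP-> _; rewrite subrr !subnn.
- move=> v; rewrite inE => /eqP->; rewrite l0; split=> //; exact: val_nil.
move=> v; rewrite inE => /eqP->.
by rewrite es /co /= ar2.
Qed.

(** A sum is 0 in any unit, so it does not matter that the first component can
    have negative exponents. *)
Lemma zero_test s e a (u := sem horner_cmd (setr s vA a)) :
  table s e -> wfl e (ords s) (lst s a) -> size (lst s a) <= n ->
  (ev u (vP + vQ)%I == 0) = (val_of e (lst s a) == 0%R) /\ extends s e u e.
Proof.
move=> ts wl sl; have [M16 Mn M2 K2 KB] := M_facts.
have nM : n <= M by apply: leq_trans Mn; apply: leq_pmull.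
have M0 : 0 < M by apply: leq_trans M16.
have nK : n < K.
  by apply: leq_trans M2; apply: leq_ltn_trans nM _; rewrite -[X in X < _]mul1n ltn_mul2r M0.
have nB : n < B.
  by apply: leq_trans nK _; apply: leq_trans KB; apply: leq_trans K2; apply: leq_pmull.
have k1 : keeps 1 s (setr s vA a) by split.
have ex1 : extends s e (setr s vA a) e by apply: extends_keeps.
have k2 : keeps 1 s u.
  split; rewrite /u ?sem_ar ?sem_rg // => h h1; rewrite lst_sem //.
have ex2 : extends s e u e by apply: extends_keeps => //; rewrite /u sem_rg.
split=> //; have [t1 _ _ _ _] := ex1.
have [|t [z [ev_l _ st pB qB]]] := @horner_spec _ _ t1 wl; first exact: leq_trans sl nM.
have B0 : 0 < B - size (lst s a) by rewrite subn_gt0; apply: leq_ltn_trans nB.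
have [_ t0 _ _] := sat_min st (leq0n _) B0.
rewrite [X in _ = (X == _)]ev_l mulf_eq0 (negPf (two_neq0 _)) orbF intr_eq0 t0.
have -> : ev u (vP + vQ)%I = clip B (rg u vP + rg u vQ) by [].
rewrite -addn_eq0 /clip; case: (_ + _) => [|m]; first by rewrite min0n.
by rewrite minnE; case: (B) nB => // b _; rewrite subSS subSn ?leq_subr.
Qed.

Lemma is_one (g : ZhalfZ) : (g == 1%g) = (val g.1 == 0%R) && (g.2%:~R == 0 :> rat)%R.
Proof. by case: g => r m; rewrite intr_eq0. Qed.

Lemma final_ok s e g : good s e 1 -> entry s e 0 n g ->
  (rg (sem final_cmd s) vAcc != 0) = (g == 1%g).
Proof.
move=> [ts _ ok _ _ _] en.
pose s0 := setr s vAcc 0; have k0 : keeps 1 s s0 by split.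
have ex0 : extends s e s0 e by apply: extends_keeps.
have [t0 _ _ _ _] := ex0.
have en0 := extends_entry ts ex0 (erefl _) (erefl _) en.
have [[_ _ wr sr _] _ vr _ _] := en0.
have [z1 ex1] := zero_test t0 wr sr.
pose u := sem horner_cmd (setr s0 vA (ar s0 aSR 0 0)); rewrite -/u in z1 ex1.
have rm : ar u aSR 0 0 = ar s0 aSR 0 0 by rewrite /u sem_ar.
have sm : ar u aSM 0 0 = ar s0 aSM 0 0 by rewrite /u sem_ar.
have [_ [_ _ wm szm _] _ vm _] := extends_entry t0 ex1 rm sm en0.
have [t1 _ _ _ _] := ex1.
have [z2 _] := zero_test t1 wm szm.
have A0 : rg u vAcc = 0 by rewrite /u sem_rg.
have [_ _ _ ls1 _] := ex1; have [_ _ _ _ en5] := en0.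
pose u2 := sem horner_cmd (setr u vA (ar u aSM 0 0)); rewrite -/u2 in z2.
have A2 : rg u2 vAcc = 0 by rewrite /u2 sem_rg.
rewrite /final_cmd sem_seq sem_asgn -/s0 sem_if.
have -> : ev s0 vFail == 0 by apply/eqP.
rewrite sem_seq sem_asgn sem_seq -[sem horner_cmd _]/u sem_if z1 vr is_one.
case: ifP => [_|_]; last by rewrite sem_skip A0.
rewrite sem_seq sem_asgn sem_seq -[sem horner_cmd _]/u2 sem_if z2 vm.
by case: ifP => [_|_]; rewrite ?sem_skip ?A2 ?sem_asgn.
Qed.

Lemma final_failed s : rg s vFail != 0 -> rg (sem final_cmd s) vAcc = 0.
Proof.
move=> F; rewrite /final_cmd sem_seq sem_asgn sem_if.
by rewrite -[ev _ _]/(rg s vFail) (negPf F) sem_skip.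
Qed.

(** The loop has more turns than the word has letters; the turns beyond the last
    letter do nothing. *)
Lemma main_spec x : w = encode x ->
  rg (sem main_cmd store0) vAcc != 0 <-> word_problem x.
Proof.
move=> ew; have [M16 Mn M2 K2 KB] := M_facts.
have nM : n <= M by apply: leq_trans Mn; apply: leq_pmull.
rewrite /main_cmd sem_seq sem_seq; have [gs eI] := init_spec.
move: (sem init_cmd store0) gs eI => s gs eI.
have ew' : w = [::] ++ encode x ++ [::] by rewrite cats0.
have [] := parse_spec ew' eI gs; rewrite eI -ew add0n.
have -> : sem (Rep token_body) s = iter (M - n) (sem token_body) (iter n (sem token_body) s).
  by rewrite -iterD subnK.
move: (iter n _ s) => s1 eI1.
have -> : iter (M - n) (sem token_body) s1 = s1.
  by apply: iter_fix; apply: token_stop; rewrite eI1.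
rewrite /word_problem; case: (eval x) => [g [e [_ gs1 en _]]|F].
  by rewrite (final_ok gs1 en); split=> [/eqP->|[->]].
by rewrite final_failed.
Qed.

End Correctness.

(** * The word problem *)

Lemma size_encode_gt0 x : 0 < size (encode x).
Proof. by case: x. Qed.

Lemma encode_small x : all (fun t => t <= 5) (encode x).
Proof. by elim: x => //= x1 IH1 x2 IH2; rewrite all_cat IH1. Qed.

Lemma clip_vs_cap M : 16 <= M ->
  64 * (M * M * (M * M)) <= M ^ 8 /\ M ^ 8 <= 2 ^ (M * M).
Proof.
move=> M16; split.
  have -> : M * M * (M * M) = M ^ 4 by rewrite -!mulnA.
  rewrite -[8]/(4 + 4) expnD leq_mul2r; apply/orP; right.
  by apply: leq_trans (_ : 16 ^ 4 <= _); rewrite ?leq_exp2r.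
have : M ^ 8 <= (2 ^ M) ^ 8 by rewrite leq_exp2r // ltnW // ltn_expl.
move/leq_trans; apply; rewrite -expnM leq_pexp2l // leq_mul2l.
by apply/orP; right; apply: leq_trans M16.
Qed.

Theorem theorem2 :
  exists T : nat -> nat,
    is_bigO T (fun n => n ^ 4) /\
    decidable_in_time encode word_problem T.
Proof.
exists (fun n => weight main_cmd * capof n ^ 4 + 9); split.
  (* the weight is a large explicit number, which must not be computed *)
  move: (weight main_cmd) => W; exists (W * 16 ^ 4 + 9), 1 => n n0.
  rewrite mulnDl -mulnA -expnMn leq_add ?leq_mul2l ?leq_exp2r ?leq_pmulr ?expn_gt0 ?n0 //.
  by apply/orP; right; rewrite /capof mulnS; lia.
rewrite -depth_main; apply: (language_decides (x := 0)).
- exact: cok_main.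
- exact: size_encode_gt0.
- move=> x i; apply: (@leq_trans 5) => //.
  have [lt|le] := ltnP i (size (encode x)); last by rewrite nth_default.
  exact: (all_nthP 0 (encode_small x)).
move=> x n; have M16 : 16 <= capof n.
  by rewrite /capof -[16]/(8 * 2) leq_mul2l ltnS size_encode_gt0.
have [le1 le2] := clip_vs_cap M16.
exact: (main_spec (size_encode_gt0 x) (erefl _) le1 le2).
Qed.
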